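(* Let $d\ge1$, let $C$ be a $d\times d$ positive definite matrix, let $A_1$ be a real $d\times d$ matrix, and let $(X_t:t\in\mathbb{Z})$ be the associated BEKK-ARCH(1) process with $l=1$, with representation $X_t=m_{1,t}A_1X_{t-1}+Q_t$ as described in the context. Suppose that there exist a non-singular real $d\times d$ matrix $P$ and a real diagonal matrix $D_1$ with diagonal elements $D_{11},\dots,D_{dd}$ such that $D_1=PA_1P^{-1}$, and that for each $j=1,\dots,d$ there exists $\alpha_j^{(Y)}>0$ with $\mathbb{E}[|D_{jj}m_{1,t}|^{\alpha_j^{(Y)}}]=1$, so that the process is strictly stationary. Let $P^{ij}$ denote element $(i,j)$ of $P^{-1}$. For $i\in\{1,\dots,d\}$ let $\mathcal{A}_i=\{\alpha=\alpha_j^{(Y)}:j=1,\dots,d\text{ and }P^{ij}\neq0\}$, $\alpha_i=\min\mathcal{A}_i$, and $\mathcal{G}_i=\{j=1,\dots,d: P^{ij}\ne0,\ \alpha_j^{(Y)}=\alpha_i\}$. Suppose that $D_{jj}=D_{kk}$ for all $k,j\in\mathcal{G}_i$. Then $X_{i,t}$, the $i$th component of $X_t$, is regularly varying with index $\alpha_i$.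
   Context: The BEKK-ARCH(1) process with $l=1$ is $X_t=H_t^{1/2}Z_t$, $(Z_t)$ i.i.d. with $Z_t\sim N(0,I_d)$, $H_t=C+A_1X_{t-1}X_{t-1}'A_1'$, $t\in\mathbb{Z}$. It has the stochastic recurrence representation $X_t=M_tX_{t-1}+Q_t$ with $M_t=m_{1,t}A_1$, where $(m_{1,t}:t\in\mathbb{Z})$ is i.i.d. $N(0,1)$ and $(Q_t:t\in\mathbb{Z})$ is i.i.d. with $Q_t\sim N(0,C)$, independent of $(m_{1,t})$. $X_t=(X_{1,t},\dots,X_{d,t})'$ is its strictly stationary solution. A real random variable $X$ is regularly varying with index $\alpha\ge0$ if $\lim_{x\to\infty}\mathbb{P}(|X|>cx)/\mathbb{P}(|X|>x)=c^{-\alpha}$ for every $c>0$ and there are constants $p,q\ge0$ with $p+q=1$, $\lim_{x\to\infty}\mathbb{P}(X>x)/\mathbb{P}(|X|>x)=p$ and $\lim_{x\to\infty}\mathbb{P}(X\le -x)/\mathbb{P}(|X|>x)=q$. *)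

(* Defs.v *)
From HB Require Import structures.
From mathcomp Require Import all_boot all_order all_algebra.
From mathcomp Require Import all_classical all_reals all_analysis.

Set Implicit Arguments.
Unset Strict Implicit.
Unset Printing Implicit Defensive.

Import Order.TTheory GRing.Theory Num.Theory.
Import numFieldNormedType.Exports.

Local Open Scope classical_set_scope.
Local Open Scope ring_scope.

Section matrices.
Context {R : realType} {d : nat}.
Implicit Types S H : 'M[R]_d.

Definition quad_form S (u : 'cV[R]_d) : R := (u^T *m S *m u) 0 0.

Definition psd_mx S := S^T = S /\ forall u, 0 <= quad_form S u.

Definition pd_mx S := S^T = S /\ forall u, u != 0 -> 0 < quad_form S u.

(* S = H^{1/2}, the symmetric positive semidefinite square root *)
Definition is_sqrtmx H S := psd_mx S /\ S *m S = H.

End matrices.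

Section independence.
Context {disp : measure_display} {T : measurableType disp} {R : realType}.
Variable Pr : probability T R.

Definition sigma_gen (K : Type) (F : K -> T -> R) : set (set T) :=
  <<s \bigcup_k preimage_set_system setT (F k) measurable >>.

Definition mutually_independent (I : eqType) (G : I -> set (set T)) :=
  forall (s : seq I) (A : I -> set T), uniq s ->
    (forall i, i \in s -> G i (A i)) ->
    fine (Pr (\bigcap_(i in [set` s]) A i)) = \prod_(i <- s) fine (Pr (A i)).

Definition independent (G1 G2 : set (set T)) :=
  forall A B, G1 A -> G2 B -> (Pr (A `&` B) = Pr A * Pr B)%E.

End independence.

Section gaussian.
Context {disp : measure_display} {T : measurableType disp} {R : realType}.
Context {d : nat}.
Variable Pr : probability T R.

Definition vcoord (V : T -> 'cV[R]_d) (i : 'I_d) : T -> R := fun w => V w i 0.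

(* The second argument of normal_prob is the standard deviation, and
   normal_prob 0 0 is not the Dirac mass at 0. *)
Definition normal_var (v : R) : set R -> \bar R :=
  if v == 0 then \d_(0 : R) else normal_prob 0 (Num.sqrt v).

(* V ~ N(0, S): every linear combination u'V is N(0, u'Su) *)
Definition gaussian_vec (S : 'M[R]_d) (V : T -> 'cV[R]_d) :=
  forall (u : 'cV[R]_d) (B : set R), measurable B ->
    Pr [set w | B ((u^T *m V w) 0 0)] = normal_var (quad_form S u) B.

Record iid_gaussian_vec (S : 'M[R]_d) (V : int -> T -> 'cV[R]_d) : Prop := {
  igv_meas : forall t i, measurable_fun setT (vcoord (V t) i) ;
  igv_law : forall t, gaussian_vec S (V t) ;
  igv_indep : mutually_independent Pr (fun t => sigma_gen (vcoord (V t))) }.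

Record iid_std_normal (m : int -> {RV Pr >-> R}) : Prop := {
  isn_law : forall t (B : set R), measurable B ->
    distribution Pr (m t) B = normal_prob 0 1 B ;
  isn_indep : mutually_independent Pr
    (fun t => sigma_gen (fun _ : unit => m t : T -> R)) }.

End gaussian.

Section bekk.
Context {disp : measure_display} {T : measurableType disp} {R : realType}.
Context {d : nat}.
Variable Pr : probability T R.
Implicit Types (C A : 'M[R]_d) (X Q Z : int -> T -> 'cV[R]_d).

Definition path_cylinders : set (set (int -> 'cV[R]_d)) :=
  <<s [set E | exists (t : int) (i : 'I_d) (B : set R),
         measurable B /\ E = [set x : int -> 'cV[R]_d | B (x t i 0)]] >>.

Definition strictly_stationary X :=
  forall (h : int) (E : set (int -> 'cV[R]_d)), path_cylinders E ->
    Pr [set w | E (fun t => X (t + h) w)] = Pr [set w | E (fun t => X t w)].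

Definition bekk_vol C A X (t : int) (w : T) : 'M[R]_d :=
  C + A *m X (t - 1) w *m (X (t - 1) w)^T *m A^T.

Definition bekk_arch1 C A X :=
  exists Z, iid_gaussian_vec Pr 1%:M Z /\
    forall t, {ae Pr, forall w, exists2 S,
      is_sqrtmx (bekk_vol C A X t w) S & X t w = S *m Z t w}.

Record sre_representation C A X (m : int -> {RV Pr >-> R}) Q : Prop := {
  sre_m : iid_std_normal m ;
  sre_Q : iid_gaussian_vec Pr C Q ;
  sre_indep : independent Pr (sigma_gen (fun t => m t : T -> R))
    (sigma_gen (fun ti : int * 'I_d => vcoord (Q ti.1) ti.2)) ;
  sre_eq : forall t,
    {ae Pr, forall w, X t w = (m t w *: A) *m X (t - 1) w + Q t w} }.

End bekk.

Section regular_variation.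
Context {disp : measure_display} {T : measurableType disp} {R : realType}.
Variable Pr : probability T R.
Implicit Types Y : T -> R.

Definition tail_abs Y (x : R) : R := fine (Pr [set w | x < `|Y w|]).

Definition regularly_varying Y (alpha : R) :=
  [/\ 0 <= alpha,
      forall c : R, 0 < c ->
        tail_abs Y (c * x) / tail_abs Y x @[x --> +oo] --> c `^ (- alpha)
    & exists p q : R, [/\ 0 <= p, 0 <= q, p + q = 1,
        fine (Pr [set w | x < Y w]) / tail_abs Y x @[x --> +oo] --> p
      & fine (Pr [set w | Y w <= - x]) / tail_abs Y x @[x --> +oo] --> q]].

End regular_variation.

Section indices.
Context {R : realType} {d : nat}.
Variables (P : 'M[R]_d) (alpha : 'I_d -> R) (i : 'I_d).

Definition index_set : set R :=
  [set alpha j | j in [set j | invmx P i j != 0]].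

Definition is_min (E : set R) (a : R) := E a /\ lbound E a.

Definition minimal_indices (a : R) : set 'I_d :=
  [set j | invmx P i j != 0 /\ alpha j = a].

End indices.

(* Main.v *)
Require Import Defs.
From HB Require Import structures.
From mathcomp Require Import all_boot all_order all_algebra.
From mathcomp Require Import all_classical all_reals all_analysis.
From mathcomp Require Import measurable_realfun.
From mathcomp Require Import ring lra.

Set Implicit Arguments.
Unset Strict Implicit.
Unset Printing Implicit Defensive.

Import Order.TTheory GRing.Theory Num.Theory.
Import numFieldNormedType.Exports.

Local Open Scope classical_set_scope.
Local Open Scope ring_scope.


(** The idea is to reduce to dimension one.  If u is a row vector with
    u A1 = a u, the scalar process W_t = u X_t satisfies
    W_t = a m_t W_(t-1) + N_t, where N_t = u Q_t is normal with a positive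
    variance because C is positive definite.  The rows of P are such vectors, and
    so is the combination of the rows of index in G_i with coefficients P^(ij),
    since D_jj is constant on G_i.  Hence X_i = W + V, where W has a multiplier
    with E |a m|^alpha_i = 1 and V is a linear combination of projections with
    strictly larger exponents.  These have finite moments of some order
    exceeding alpha_i, so V does not contribute to the tail
    ([light_tail_moment]), and X_i inherits the tail of W
    ([regularly_varying_perturbation]).

    It remains to find the tail of W.  Conditionally on W_(t-1), the variable
    a m_t W_(t-1) + N_t is centred normal, so the stationary law satisfies the
    fixed point equation: W has the law of B (W) Z with Z standard normal
    independent of W and B (s) = sqrt (a^2 s^2 + sg^2) ([law_fixed_point]).
    Stationarity alone does not make W_(t-1) independent of the noise at time t;
    the equation is first proved for the partial causal solutions, which converge
    to W in probability because E |a m|^b < 1 for b < alpha_i.  The fixed point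
    equation shows that W is symmetric ([tail_symmetric]), which gives equal
    weights 1/2 to the two tails, and that E |W|^b is finite for b < alpha_i
    ([moment_fin]).

    Write al for alpha_i, y = |a Z| and J (x) = E min(|W|, x)^al.  The weights
    y^al have mean 1, so K f (x) = E [y^al f (x / y)] is an averaging operator,
    and the fixed point equation shows that L = J - K J is nonnegative,
    nondecreasing, bounded and not identically 0.  Hence L has a limit G0 > 0,
    and J solves a renewal equation in ln x with drift m = E [y^al ln y] > 0.
    This equation is solved by a maximum principle.  The increments
    q (x) = J (l x) - J (x) satisfy q - K q -> 0; near points where q approaches
    its upper limit S, the average of q can only be that large if q is close to
    S at all comparable scales ([profile_cst_of_le]), and summing increments
    shows that L at these points is between S (m / ln l - 1) and
    S (m / ln l + 1) ([profile_balance]).  The same holds for the lower limit.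
    When l tends to 1 this gives q (x) / ln l -> G0 / m.  Since
    (l^al - 1) x^al P (|W| > l x) <= q (x) <= (l^al - 1) x^al P (|W| > x), it
    follows that x^al P (|W| > x) converges to G0 / (al m) > 0
    ([renewal_tail_pos], [fixed_point_tail]). *)

(** * Integrals of sequences with a one-sided limit *)

Section integral_limits.
Context d (V : measurableType d) (R : realType) (nu : {measure set V -> \bar R}).
Implicit Types (f g H : V -> R).
Local Notation integ f := (nu.-integrable setT (EFin \o f)).

Lemma integrable_dom f H : measurable_fun setT f -> integ H ->
  (forall z, `|f z| <= H z) -> integ f.
Proof.
move=> mf iH fH; apply: le_integrable iH => //; first exact/measurable_EFinP.
by move=> z _ /=; rewrite lee_fin (le_trans (fH z))// ler_norm.
Qed.

Lemma integD f g : integ f -> integ g -> integ (fun z => f z + g z).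
Proof. by move=> i1 i2; exact: (@integrableD _ _ _ nu setT measurableT _ _ i1 i2). Qed.

Lemma integB f g : integ f -> integ g -> integ (fun z => f z - g z).
Proof. by move=> i1 i2; exact: (@integrableB _ _ _ nu setT measurableT _ _ i1 i2). Qed.

Lemma integZl (r : R) f : integ f -> integ (fun z => r * f z).
Proof. by move=> i1; exact: (@integrableZl _ _ _ nu setT measurableT r _ i1). Qed.

Lemma integZr (r : R) f : integ f -> integ (fun z => f z * r).
Proof. by move=> i1; exact: (@integrableZr _ _ _ nu setT measurableT r _ i1). Qed.

Lemma Rintegral_cvg0 (f_ : nat -> V -> R) H :
  (forall n, measurable_fun setT (f_ n)) -> integ H ->
  (forall n z, `|f_ n z| <= H z) ->
  (forall z, f_ n z @[n --> \oo] --> 0) ->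
  \int[nu]_z f_ n z @[n --> \oo] --> 0.
Proof.
move=> mf iH fH f0.
have [] := @dominated_convergence _ _ _ nu setT measurableT
  (fun n => EFin \o f_ n) (cst 0%E) (EFin \o H).
- by move=> n; exact/measurable_EFinP.
- exact: measurable_cst.
- by apply: aeW => z _; apply/fine_cvgP; split; [exact: nearW|exact: f0].
- exact: iH.
- by apply: aeW => z n _ /=; rewrite lee_fin fH.
by rewrite integral0 => _ _ /fine_cvgP [].
Qed.

(** Only an upper limit of [f_ n] is controlled pointwise, so dominated
    convergence is applied to the positive parts. *)
Lemma Rintegral_limsup_le0 (f_ : nat -> V -> R) H :
  (forall n, measurable_fun setT (f_ n)) -> integ H ->
  (forall n z, `|f_ n z| <= H z) ->
  (forall z (e : R), 0 < e -> \forall n \near \oo, f_ n z <= e) ->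
  \int[nu]_z Num.max (f_ n z) 0 @[n --> \oo] --> 0.
Proof.
move=> mf iH fH f0; apply: (@Rintegral_cvg0 _ H) => //.
- by move=> n; apply: measurable_maxr => //; exact: measurable_cst.
- move=> n z; rewrite ger0_norm ?le_max ?lexx ?orbT// ge_max.
  by rewrite (le_trans _ (fH n z)) ?ler_norm//= (le_trans _ (fH n z)).
- move=> z; apply/cvgrPdist_le => e e0; near=> n.
  rewrite sub0r normrN ger0_norm ?le_max ?lexx ?orbT// ge_max (ltW e0) andbT.
  by near: n; exact: f0.
Unshelve. all: end_near. Qed.

Lemma Rintegral_limsup_le (f_ : nat -> V -> R) H :
  (forall n, measurable_fun setT (f_ n)) -> integ H ->
  (forall n z, `|f_ n z| <= H z) ->
  (forall z (e : R), 0 < e -> \forall n \near \oo, f_ n z <= e) ->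
  forall e : R, 0 < e -> \forall n \near \oo, \int[nu]_z f_ n z <= e.
Proof.
move=> mf iH fH f0 e e0.
have /cvgrPdist_le/(_ e e0) := Rintegral_limsup_le0 mf iH fH f0.
apply: filterS => n; rewrite sub0r normrN => le_e.
apply: le_trans (le_trans (ler_norm _) le_e).
apply: le_Rintegral => //.
- exact: integrable_dom (mf n) iH (fH n).
- apply: integrable_dom iH _ => [|z].
    by apply: measurable_maxr => //; exact: measurable_cst.
  rewrite ger0_norm ?le_max ?lexx ?orbT// ge_max.
  by rewrite (le_trans _ (fH n z)) ?ler_norm//= (le_trans _ (fH n z)).
- by move=> z _; rewrite le_max lexx.
Qed.

(** Since |f| = 2 max(f, 0) - f, a pointwise upper limit 0 together with the
    convergence of the integrals already gives convergence in L^1.  This is the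
    analytic core of the maximum principle used below. *)
Lemma Rintegral_norm_cvg0 (f_ : nat -> V -> R) H :
  (forall n, measurable_fun setT (f_ n)) -> integ H ->
  (forall n z, `|f_ n z| <= H z) ->
  (forall z (e : R), 0 < e -> \forall n \near \oo, f_ n z <= e) ->
  \int[nu]_z f_ n z @[n --> \oo] --> 0 ->
  \int[nu]_z `|f_ n z| @[n --> \oo] --> 0.
Proof.
move=> mf iH fH f0 if0.
have mi n : integ (fun z => Num.max (f_ n z) 0).
  apply: integrable_dom iH _ => [|z].
    by apply: measurable_maxr => //; exact: measurable_cst.
  rewrite ger0_norm ?le_max ?lexx ?orbT// ge_max.
  by rewrite (le_trans _ (fH n z)) ?ler_norm//= (le_trans _ (fH n z)).
have i2 n : integ (fun z => 2 * Num.max (f_ n z) 0).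
  exact: integZl.
rewrite [X in X @ _](_ : _ = fun n => 2 * (\int[nu]_z Num.max (f_ n z) 0) -
   \int[nu]_z f_ n z); last first.
  apply/funext => n; rewrite -RintegralZl// -RintegralB//; last first.
    exact: integrable_dom (mf n) iH (fH n).
  apply: eq_Rintegral => z _; rewrite /Order.max; case: ifPn => [z0|].
    by rewrite ltr0_norm//; ring.
  by rewrite -leNgt => z0; rewrite ger0_norm//; ring.
rewrite -[X in _ --> X]subr0; apply: cvgB => //.
rewrite -[X in _ --> X](mulr0 (2 : R)); apply: cvgM; first exact: cvg_cst.
exact: Rintegral_limsup_le0 mf iH fH f0.
Unshelve. all: end_near. Qed.

End integral_limits.

(** * Elementary asymptotics *)

Lemma cvg_sum_cst (R : realType) (f : nat -> nat -> R) (S : R) k :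
  (forall i, f i n @[n --> \oo] --> S) ->
  \sum_(i < k) f i n @[n --> \oo] --> k%:R * S.
Proof.
move=> fS; elim: k => [|k IH].
  rewrite mul0r; under eq_cvg do rewrite big_ord0; exact: cvg_cst.
under eq_cvg do rewrite big_ord_recr /=.
by rewrite -natr1 mulrDl mul1r; exact: cvgD.
Qed.

Lemma pow_bracket (R : realType) (l u : R) : 1 < l -> 1 <= u ->
  exists k : nat, l ^+ k <= u <= l ^+ k.+1 /\
    k%:R <= ln u / ln l <= k%:R + 1.
Proof.
move=> l1 u1; have u0 : 0 < u by exact: lt_le_trans u1.
have l0 : 0 < l by exact: lt_trans l1.
have lnl : 0 < ln l by exact: ln_gt0.
have x0 : 0 <= ln u / ln l by rewrite divr_ge0 ?ln_ge0// ltW.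
have /andP[h1 h2] := truncn_itv x0.
exists (Num.trunc (ln u / ln l)); split; last by rewrite h1 natr1 ltW.
move: h1 h2; set k := Num.trunc _ => h1 h2.
apply/andP; split.
  rewrite -ler_ln ?posrE ?exprn_gt0// lnXn// -mulr_natl.
  by rewrite -ler_pdivlMr.
rewrite -ler_ln ?posrE ?exprn_gt0// lnXn// -mulr_natl.
by rewrite -ler_pdivrMr// ltW.
Qed.

Lemma geometric_sum_le (R : realType) (rho : R) k : 1 < rho ->
  \sum_(i < k.+1) rho ^+ i <= rho / (rho - 1) * rho ^+ k.
Proof.
move=> r1; have r10 : 0 < rho - 1 by rewrite subr_gt0.
elim: k => [|k IH].
  rewrite big_ord1 expr0 mulr1 ler_pdivlMr// mul1r; lra.
rewrite big_ord_recr /=; apply: le_trans (lerD IH (lexx _)) _.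
rewrite exprS le_eqVlt; apply/orP; left; apply/eqP; field.
by rewrite gt_eqF.
Qed.

(** Supplies the points at which the maximum principle is applied; it serves for
    lower limits as well, through the opposite function. *)
Lemma limsup_attained (R : realType) (f : R -> R) (B : R) :
  (forall x, 0 < x -> `|f x| <= B) ->
  exists (S : R) (x_ : nat -> R), [/\ forall n, n.+1%:R <= x_ n,
    f (x_ n) @[n --> \oo] --> S &
    forall e : R, 0 < e -> exists2 X, 0 < X & forall x, X <= x -> f x <= S + e].
Proof.
move=> fB.
pose A n := [set f x | x in [set x | n.+1%:R <= x]].
have A0 n : A n !=set0 by exists (f n.+1%:R); exists n.+1%:R => /=.
have AB n : has_sup (A n).
  split => //; exists B => _ [x /= nx <-]; apply: le_trans (ler_norm _) (fB _ _).
  by apply: lt_le_trans nx; rewrite ltr0Sn.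
pose s n := sup (A n).
have s_ub n x : n.+1%:R <= x -> f x <= s n.
  by move=> nx; apply: (sup_upper_bound (AB n)); exists x.
have s_nd : nonincreasing_seq s.
  move=> n k nk; apply: ge_sup => // _ [x /= kx <-]; apply: s_ub.
  by apply: le_trans kx; rewrite ler_nat.
have s_lb : has_lbound (range s).
  exists (- B) => _ [n _ <-]; have := s_ub n _ (lexx _); apply: le_trans.
  by rewrite lerNl; apply: le_trans (fB _ (ltr0Sn _ n)); rewrite ler_normr lexx orbT.
have s_cvg := nonincreasing_cvgn s_nd s_lb.
set S := inf (range s) in s_cvg.
have ex n : exists x, n.+1%:R <= x /\ s n - n.+1%:R^-1 < f x.
  have [_ [x /= nx <-] h] := sup_adherent (ltac:(by rewrite invr_gt0 ltr0Sn) :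
     0 < n.+1%:R^-1 :> R) (AB n).
  by exists x.
have [x_ x_P] := choice ex.
exists S, x_; split.
- by move=> n; have [] := x_P n.
- apply: (@squeeze_cvgr _ _ _ _ (fun n => s n - n.+1%:R^-1) s) => //.
    apply: nearW => n; have [h1 h2] := x_P n.
    by rewrite (ltW h2) s_ub.
  rewrite -[X in _ --> X]subr0; apply: cvgB => //; exact: cvg_harmonic.
- move=> e e0; move/cvgrPdist_le : s_cvg => /(_ e e0) [N _ /(_ N (leqnn N))] /= h.
  exists N.+1%:R; first by rewrite ltr0Sn.
  move=> x Nx; apply: le_trans (s_ub _ _ Nx) _.
  by move: h; rewrite ler_distlC => /andP[].
Qed.

Lemma cvg_powR_small (R : realType) (e_ : nat -> R) (u : R) : 0 < u ->
  e_ n @[n --> \oo] --> 0 -> u `^ (- e_ n) @[n --> \oo] --> (1 : R).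
Proof.
move=> u0 e0.
have -> : (fun n => u `^ (- e_ n)) = (expR \o (fun n => - e_ n * ln u)).
  by apply/funext => n; rewrite /powR gt_eqF.
rewrite -[X in _ --> X]expR0; apply: continuous_cvg; first exact: continuous_expR.
rewrite -[X in _ --> X](mul0r (ln u)); apply: cvgM; last exact: cvg_cst.
by rewrite -[X in _ --> X]oppr0; apply: cvgN.
Qed.


(** * A renewal theorem proved by a maximum principle *)

Section renewal.
Context d (V : measurableType d) (R : realType) (nu : probability V R).
Local Notation integ f := (nu.-integrable setT (EFin \o f)).
Variables (y : V -> R) (al Lb : R) (J : R -> R).
Hypothesis al_gt0 : 0 < al.
Hypothesis my : measurable_fun setT y.
Hypothesis y_ge0 : forall z, 0 <= y z.
Hypothesis iy : integ (fun z => y z `^ al).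
Hypothesis y1 : \int[nu]_z (y z `^ al) = 1.
Hypothesis ilog : integ (fun z => y z `^ al * ln (y z)).
Let m := \int[nu]_z (y z `^ al * ln (y z)).
Hypothesis m_gt0 : 0 < m.
Hypothesis y_itv : forall u v : R, 0 < u -> u < v ->
  0 < fine (nu [set z | u <= y z <= v]).
Hypothesis J_ge0 : forall x, 0 <= J x.
Hypothesis J_le : forall x : R, 0 < x -> J x <= x `^ al.
Hypothesis J_nd : {homo J : x x' / x <= x'}.
Hypothesis J_scale : forall l t x : R, 1 <= l -> 1 <= t -> 0 < x ->
  J (l * (t * x)) - J (t * x) <= t `^ al * (J (l * x) - J x).
Hypothesis J_growth : forall e : R, 0 < e < al ->
  exists C, forall x : R, 0 < x -> J x <= C * x `^ e.
(** The operator K f (x) = E [y^al f (x / y)] averages along dilations with the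
    probability weights [y `^ al], and [L] = J - K J.  So [J] solves a
    renewal equation, additive in ln x, whose drift is [m]. *)
Let L x := \int[nu]_z (y z `^ al * (J x - J (x / y z))).
Hypothesis L_nd : forall x x' : R, 0 < x -> x <= x' -> L x <= L x'.
Hypothesis L_ge0 : forall x : R, 0 < x -> 0 <= L x.
Hypothesis L_le : forall x : R, 0 < x -> L x <= Lb.

Let mJ : measurable_fun setT J.
Proof. exact: nondecreasing_measurable. Qed.

Lemma measurable_weight : measurable_fun setT (fun z => y z `^ al).
Proof. exact: (measurableT_comp (measurable_powR al) my). Qed.

Lemma measurable_convolved x : measurable_fun setT (fun z => J (x / y z)).
Proof.
apply: (measurableT_comp mJ); apply: measurable_funM => //.
have -> : (fun z => (y z)^-1) = (fun z => y z `^ (-1)).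
  by apply/funext => z; rewrite powR_inv1.
exact: (measurableT_comp (measurable_powR _) my).
Qed.

Lemma convolved_bound x z : 0 < x -> 0 <= y z `^ al * J (x / y z) <= x `^ al.
Proof.
move=> x0; rewrite mulr_ge0 ?powR_ge0//=.
have := y_ge0 z; rewrite le_eqVlt => /orP[/eqP <-|yz].
  by rewrite powR0 ?gt_eqF// mul0r powR_ge0.
apply: le_trans (ler_wpM2l (powR_ge0 _ _) (J_le (divr_gt0 x0 yz))) _.
rewrite -powRM//; last by rewrite divr_ge0 // ltW.
by rewrite mulrC divfK ?gt_eqF.
Qed.

Lemma integrable_convolved x : 0 < x -> integ (fun z => y z `^ al * J (x / y z)).
Proof.
move=> x0; apply: (@integrable_dom _ _ _ _ _ (cst (x `^ al))).
- by apply: measurable_funM; [exact: measurable_weight|exact: measurable_convolved].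
- exact: finite_measure_integrable_cst.
- by move=> z; have /andP[h1 h2] := convolved_bound z x0; rewrite ger0_norm.
Qed.

Lemma integrable_weight_cst (c : R) : integ (fun z => y z `^ al * c).
Proof. exact: (integZr c iy). Qed.

Lemma Rintegral_weight_cst (c : R) : \int[nu]_z (y z `^ al * c) = c.
Proof. by rewrite RintegralZr// y1 mul1r. Qed.

Lemma balance_convolved x : 0 < x -> L x = J x - \int[nu]_z (y z `^ al * J (x / y z)).
Proof.
move=> x0; rewrite -[in RHS](Rintegral_weight_cst (J x)) -RintegralB//.
- by apply: eq_Rintegral => z _; rewrite mulrBr.
- exact: integrable_weight_cst.
- exact: integrable_convolved.
Qed.

(** The limit of [L] at infinity, since [L] is nondecreasing. *)
Let G0 := sup [set L x | x in [set x | 0 < x]].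

Lemma balance_near_sup (e : R) : 0 < e ->
  exists2 X, 0 < X & forall x, X <= x -> G0 - e <= L x <= G0.
Proof.
move=> e0; pose A := [set L x | x in [set x | 0 < x]].
have AB : has_sup A.
  by split; [exists (L 1); exists 1 => //=|exists Lb => _ [x /= x0 <-]; exact: L_le].
have [_ [X /= X0 <-] h] := sup_adherent e0 AB.
exists X => // x Xx; have x0 : 0 < x by exact: lt_le_trans Xx.
rewrite (le_trans (ltW h)) ?L_nd//=.
by apply: (sup_upper_bound AB); exists x.
Qed.

(** Unlike [J], the increment q of [J] over a dilation by [l] is almost invariant
    under K, because L (l x) - L x tends to 0. *)
Section scale.
Variable l : R.
Hypothesis l1 : 1 < l.
Let l0 : 0 < l. Proof. exact: lt_trans l1. Qed.
Let lnl : 0 < ln l. Proof. exact: ln_gt0. Qed.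
Let q x := J (l * x) - J x.

Lemma increment_ge0 x : 0 < x -> 0 <= q x.
Proof. by move=> x0; rewrite subr_ge0 J_nd// ler_peMl// ltW. Qed.

Lemma increment_scale t x : 1 <= t -> 0 < x -> q (t * x) <= t `^ al * q x.
Proof. by move=> t1 x0; apply: J_scale => //; exact: ltW. Qed.

Lemma increment_scaleV x u u0 : 0 < x -> 0 < u -> u <= u0 ->
  q (x / u) <= (u0 / u) `^ al * q (x / u0).
Proof.
move=> x0 u_gt0 uu0; have u00 : 0 < u0 by exact: lt_le_trans uu0.
have -> : x / u = (u0 / u) * (x / u0) by field; rewrite !gt_eqF.
by apply: increment_scale; rewrite ?divr_gt0// ler_pdivlMr// mul1r.
Qed.

Lemma integrable_convolved_increment x : 0 < x -> integ (fun z => y z `^ al * q (x / y z)).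
Proof.
move=> x0.
have -> : (fun z => y z `^ al * q (x / y z)) =
   (fun z => y z `^ al * J (l * x / y z) - y z `^ al * J (x / y z)).
  by apply/funext => z; rewrite /q mulrBr mulrA.
by apply: integB; apply: integrable_convolved => //; exact: mulr_gt0.
Qed.

Lemma increment_balance x : 0 < x ->
  q x - \int[nu]_z (y z `^ al * q (x / y z)) = L (l * x) - L x.
Proof.
move=> x0; have lx0 : 0 < l * x by exact: mulr_gt0.
rewrite !balance_convolved//.
have -> : \int[nu]_z (y z `^ al * q (x / y z)) =
   \int[nu]_z (y z `^ al * J (l * x / y z)) -
   \int[nu]_z (y z `^ al * J (x / y z)).
  rewrite -RintegralB//; [|exact: integrable_convolved|exact: integrable_convolved].
  by apply: eq_Rintegral => z _; rewrite /q mulrBr mulrA.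
rewrite /q; ring.
Qed.

(** The profile [F n] describes q around the point [x_ n], in units of [c_ n].
    By [L_flat] the weighted average of [F n] differs from [F n 1] by o(1).  If
    [F n 1] tends to [S] and [S] is asymptotically an upper (or a lower) bound of
    the profile, the whole profile must therefore tend to [S]. *)
Section profile.
Variables (x_ c_ : nat -> R) (S C : R).
Hypothesis x_gt0 : forall n, 0 < x_ n.
Hypothesis c_gt0 : forall n, 0 < c_ n.
Let F n u := q (x_ n / u) / c_ n.
Hypothesis F_past : forall n u, 1 <= u -> F n u <= C.
Hypothesis F1 : F n 1 @[n --> \oo] --> S.

Let F_ge0 n u : 0 < u -> 0 <= F n u.
Proof. by move=> u0; rewrite divr_ge0 ?increment_ge0 ?divr_gt0// ltW. Qed.

Let F_scaleV n u u0 : 0 < u -> u <= u0 -> F n u <= (u0 / u) `^ al * F n u0.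
Proof.
move=> u_gt0 uu0; rewrite /F mulrA ler_pM2r ?invr_gt0//.
exact: increment_scaleV.
Qed.

Let C_ge0 : 0 <= C.
Proof. exact: le_trans (F_ge0 0%N ltr01) (F_past 0%N (lexx 1)). Qed.

Let mF n : measurable_fun setT (fun z => F n (y z)).
Proof.
apply: measurable_funM; last exact: measurable_cst.
apply: measurable_funB; last exact: measurable_convolved.
under eq_fun do rewrite mulrA; exact: measurable_convolved.
Qed.

Let yaF n z : 0 <= y z `^ al * F n (y z) <= C * y z `^ al + C.
Proof.
have := y_ge0 z; rewrite le_eqVlt => /orP[/eqP <-|yz].
  by rewrite powR0 ?gt_eqF// mul0r mulr0 add0r lexx C_ge0.
rewrite mulr_ge0 ?powR_ge0 ?F_ge0//=.
have [y1'|y1'] := leP 1 (y z).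
  rewrite mulrC -[leLHS]addr0 lerD// ler_wpM2r ?powR_ge0//; exact: F_past.
rewrite -[leLHS]add0r lerD ?mulr_ge0 ?powR_ge0//.
apply: le_trans (ler_wpM2l (powR_ge0 _ _) (F_scaleV n yz (ltW y1'))) _.
rewrite mulrA -powRM//; last by rewrite divr_ge0.
rewrite [y z * _]mulrC divfK ?gt_eqF// powR1 mul1r; exact: F_past.
Qed.

Let G n z := y z `^ al * (F n (y z) - S).

Let mG n : measurable_fun setT (G n).
Proof.
apply: measurable_funM; first exact: measurable_weight.
by apply: measurable_funB => //; exact: measurable_cst.
Qed.

Let H z := C * y z `^ al + C + y z `^ al * `|S|.

Let iH : integ H.
Proof.
apply: integD; last exact: integrable_weight_cst.
apply: integD; first exact: integZl.
exact: finite_measure_integrable_cst.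
Qed.

Let GH n z : `|G n z| <= H z.
Proof.
rewrite /G /H mulrBr; apply: le_trans (ler_normB _ _) _.
have /andP[h1 h2] := yaF n z.
by apply: lerD; [rewrite ger0_norm|rewrite normrM ger0_norm ?powR_ge0].
Qed.

Hypothesis L_flat : (L (l * x_ n) - L (x_ n)) / c_ n @[n --> \oo] --> 0.

Let G_cvg0 : \int[nu]_z G n z @[n --> \oo] --> 0.
Proof.
rewrite [X in X @ _](_ : _ =
    fun n => F n 1 - (L (l * x_ n) - L (x_ n)) / c_ n - S); last first.
  apply/funext => n; rewrite -increment_balance//.
  have -> : \int[nu]_z G n z =
      (\int[nu]_z (y z `^ al * q (x_ n / y z))) / c_ n - S.
    rewrite -RintegralZr//; last exact: integrable_convolved_increment.
    rewrite -[X in _ - X]Rintegral_weight_cst -RintegralB//; last 2 first.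
    - exact: (integZr _ (integrable_convolved_increment _)).
    - exact: integrable_weight_cst.
    by apply: eq_Rintegral => z _; rewrite /G /F; ring.
  by rewrite /F divr1; ring.
rewrite -[X in _ --> X](_ : S - 0 - S = 0); last by ring.
apply: cvgB; last exact: cvg_cst.
exact: cvgB.
Qed.

(** Convergence in L^1 becomes pointwise because [F_scaleV] makes q monotone up
    to the factor of a dilation: a deviation at [u0] persists on an interval
    adjacent to [u0], and [y] falls in that interval with positive probability. *)
Let normG_cvg : \int[nu]_z `|G n z| @[n --> \oo] --> 0 ->
  forall u, 0 < u -> F n u @[n --> \oo] --> S.
Proof.
move=> nG u0 u0_gt0.
have imass (u v c : R) : 0 < u -> u < v -> 0 < c -> exists2 b, 0 < b &
    forall n, (forall w, u <= w <= v -> c <= `|F n w - S|) ->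
      b <= \int[nu]_z `|G n z|.
  move=> u_gt0 uv c0; pose A := [set z | u <= y z <= v].
  have mA : measurable A.
    have -> : A = y @^-1` `[u, v]%classic.
      by apply/seteqP; split => z /=; rewrite in_itv.
    by rewrite -[X in measurable X]setTI; exact: my.
  have iA : integ (fun z => \1_A z).
    by apply: integrable_indic => //; rewrite setIT; exact: fin_num_fun_lty.
  exists (u `^ al * c * fine (nu A)).
    by rewrite mulr_gt0 ?mulr_gt0 ?powR_gt0// y_itv.
  move=> n h.
  have -> : u `^ al * c * fine (nu A) =
      \int[nu]_z (u `^ al * c * \1_A z).
    by rewrite RintegralZl// /Rintegral integral_indic// setIT.
  apply: le_Rintegral => //.
  - exact: (integZl _ iA).
  - apply: integrable_dom iH _; first by apply: measurableT_comp.
    by move=> z; rewrite normr_id.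
  - move=> z _; rewrite indicE; case: (boolP (z \in A)) => /=; last by rewrite mulr0.
    rewrite inE => /= /[dup] Az /andP[uy yv]; rewrite mulr1 /G /= normrM.
    rewrite ger0_norm ?powR_ge0// ler_pM ?powR_ge0 ?(ltW c0) ?h//.
    by rewrite ge0_ler_powR ?nnegrE// ltW.
apply/cvgrPdist_le => e e0.
have Se0 : 0 < 2 * (`|S| + e) by rewrite mulr_gt0// ltr_wpDl.
pose dl := e / (2 * (`|S| + e)).
have dl0 : 0 < dl by rewrite divr_gt0.
have dlS : dl * (`|S| + e) = e / 2.
  by rewrite /dl; field; rewrite gt_eqF// ltr_wpDl.
have SS : S <= `|S| by exact: ler_norm.
pose t := (1 + dl) `^ al^-1.
have t1 : 1 < t.
  suff : 1 `^ al^-1 < t by rewrite powR1.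
  by apply: gt0_ltr_powR; rewrite ?invr_gt0 ?nnegrE ?ltrDl// addr_ge0// ltW.
have t0 : 0 < t by exact: lt_trans t1.
have ta : t `^ al = 1 + dl.
  by rewrite /t -powRrM mulVf ?gt_eqF// powRr1//; lra.
have [b1 b10 Hb1] := imass (u0 / t) u0 (e / 2) (divr_gt0 u0_gt0 t0)
  ltac:(by rewrite ltr_pdivrMr// ltr_pMr) ltac:(by rewrite divr_gt0).
have [b2 b20 Hb2] := imass u0 (t * u0) (e / 2) u0_gt0
  ltac:(by rewrite ltr_pMl) ltac:(by rewrite divr_gt0).
have /cvgrPdist_lt/(_ (Num.min b1 b2)) := nG.
rewrite lt_min b10 b20 => /(_ isT); apply: filterS => n.
rewrite sub0r normrN lt_min => /andP[nb1 nb2].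
have iGge0 : 0 <= \int[nu]_z `|G n z| by exact: Rintegral_ge0.
rewrite ger0_norm// in nb1 nb2.
rewrite ler_distlC; apply/andP; split; rewrite leNgt; apply/negP => hF.
- have : b1 <= \int[nu]_z `|G n z|.
    apply: Hb1 => w /andP[w1 w2].
    have w0 : 0 < w by apply: lt_le_trans w1; exact: divr_gt0.
    have h1 : F n w <= (1 + dl) * F n u0.
      apply: le_trans (F_scaleV n w0 w2) _.
      rewrite ler_wpM2r ?F_ge0// -ta ge0_ler_powR ?nnegrE ?divr_ge0 ?(ltW al_gt0) ?(ltW t0) ?(ltW w0) ?(ltW u0_gt0)//.
      by rewrite ler_pdivrMr// mulrC -ler_pdivrMr.
    have h2 : dl * F n u0 <= dl * (`|S| + e) by rewrite ler_pM2l//; lra.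
    rewrite distrC ler_normr; apply/orP; left; lra.
  by rewrite leNgt nb1.
- have : b2 <= \int[nu]_z `|G n z|.
    apply: Hb2 => w /andP[w1 w2].
    have w0 : 0 < w by exact: lt_le_trans w1.
    have h1 : F n u0 <= (1 + dl) * F n w.
      apply: le_trans (F_scaleV n u0_gt0 w1) _.
      rewrite ler_wpM2r ?F_ge0// -ta ge0_ler_powR ?nnegrE ?divr_ge0 ?(ltW al_gt0) ?(ltW t0) ?(ltW w0) ?(ltW u0_gt0)//.
      by rewrite ler_pdivrMr.
    rewrite ler_normr; apply/orP; left; rewrite leNgt; apply/negP => h2.
    have h3 : dl * F n w <= dl * (`|S| + e) by rewrite ler_pM2l//; lra.
    lra.
  by rewrite leNgt nb2.
Qed.

Lemma profile_cst_of_le :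
  (forall u e : R, 0 < u -> 0 < e -> \forall n \near \oo, F n u <= S + e) ->
  forall u, 0 < u -> F n u @[n --> \oo] --> S.
Proof.
move=> FS; apply: normG_cvg; apply: (Rintegral_norm_cvg0 mG iH GH) => // z e e0.
have := y_ge0 z; rewrite le_eqVlt => /orP[/eqP yz|yz].
  by apply: nearW => n; rewrite /G -yz powR0 ?gt_eqF// mul0r ltW.
have := FS _ (e / y z `^ al) yz (divr_gt0 e0 (powR_gt0 _ yz)).
apply: filterS => n h.
by rewrite /G mulrC -ler_pdivlMr ?powR_gt0// lerBlDl.
Qed.

Lemma profile_cst_of_ge :
  (forall u e : R, 0 < u -> 0 < e -> \forall n \near \oo, S - e <= F n u) ->
  forall u, 0 < u -> F n u @[n --> \oo] --> S.
Proof.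
move=> FS; apply: normG_cvg.
rewrite [X in X @ _](_ : _ = fun n => \int[nu]_z `|- G n z|); last first.
  by apply/funext => n; apply: eq_Rintegral => z _; rewrite normrN.
apply: (@Rintegral_norm_cvg0 _ _ _ _ (fun n z => - G n z) H) => //.
- by move=> n; apply: measurableT_comp.
- by move=> n z; rewrite normrN.
- move=> z e e0.
  have := y_ge0 z; rewrite le_eqVlt => /orP[/eqP yz|yz].
    by apply: nearW => n; rewrite /G -yz powR0 ?gt_eqF// mul0r oppr0 ltW.
  have := FS _ (e / y z `^ al) yz (divr_gt0 e0 (powR_gt0 _ yz)).
  apply: filterS => n h.
  rewrite /G -mulrN mulrC -ler_pdivlMr ?powR_gt0//; lra.
- rewrite [X in X @ _](_ : _ = fun n => (-1) * \int[nu]_z G n z); last first.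
    apply/funext => n; rewrite -RintegralZl//; last exact: integrable_dom (mG n) iH (GH n).
    by apply: eq_Rintegral => z _; rewrite mulN1r.
  rewrite -[X in _ --> X](mulr0 (-1 : R)).
  by apply: cvgM => //; exact: cvg_cst.
Qed.

(** [L (x_ n) / c_ n] is the weighted average of [D n], and [D n u] telescopes
    into about ln u / ln l values of the profile. *)
Let D n u := (J (x_ n) - J (x_ n / u)) / c_ n.

Let D_past u : 1 <= u -> exists k : nat, k%:R <= ln u / ln l <= k%:R + 1 /\
  forall n, \sum_(i < k) F n (l ^+ i.+1) <= D n u
    <= \sum_(i < k.+1) F n (l ^+ i.+1).
Proof.
move=> u1; have u0 : 0 < u by exact: lt_le_trans u1.
have [k [/andP[k1 k2] kln]] := pow_bracket l1 u1.
exists k; split => // n; rewrite -!mulr_suml !ler_pM2r ?invr_gt0//.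
have JV j : J (x_ n) - J (x_ n / l ^+ j) = \sum_(i < j) q (x_ n / l ^+ i.+1).
  elim: j => [|j IH]; first by rewrite big_ord0 expr0 divr1 subrr.
  rewrite big_ord_recr /= -IH /q exprS.
  have -> : l * (x_ n / (l * l ^+ j)) = x_ n / l ^+ j.
    by field; rewrite expf_neq0 gt_eqF.
  ring.
by rewrite -!JV !lerD2l !lerN2 !J_nd// ler_pM2l// lef_pV2 ?posrE ?exprn_gt0.
Qed.

Let D_future u : 0 < u -> u <= 1 ->
  exists k : nat, [/\ k%:R <= - (ln u / ln l) <= k%:R + 1, l ^+ k <= u^-1 &
  forall n, \sum_(i < k) F n (l ^- i) <= - D n u <= \sum_(i < k.+1) F n (l ^- i)].
Proof.
move=> u0 u1; have v1 : 1 <= u^-1 by rewrite invf_ge1.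
have [k [/andP[k1 k2] kln]] := pow_bracket l1 v1.
exists k; split => //; first by rewrite lnV ?posrE// mulNr in kln.
move=> n; rewrite -!mulr_suml -mulNr opprB !ler_pM2r ?invr_gt0//.
have JV j : J (l ^+ j * x_ n) - J (x_ n) = \sum_(i < j) q (x_ n / l ^- i).
  elim: j => [|j IH]; first by rewrite big_ord0 expr0 mul1r subrr.
  by rewrite big_ord_recr /= -IH /q exprS invrK [x_ n * _]mulrC mulrA; ring.
by rewrite -!JV !lerD2r !J_nd// [x_ n / u]mulrC ler_pM2r.
Qed.

Let K := l `^ al / (l `^ al - 1).

Let rho1 : 1 < l `^ al.
Proof.
suff : 1 `^ al < l `^ al by rewrite powR1.
by apply: gt0_ltr_powR => //; rewrite nnegrE ltW.
Qed.

(** For u >= 1 there are about ln u / ln l increments, each at most [C].  For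
    u < 1 they are only bounded by a geometric progression, but its sum is of
    order u^(-al), which the weight u^al compensates. *)
Let D_dom n u : 0 < u ->
  `|u `^ al * D n u| <= C * (`|u `^ al * ln u| / ln l + u `^ al) + C * K.
Proof.
move=> u0; have K0 : 0 <= K by rewrite divr_ge0 ?powR_ge0// subr_ge0 ltW.
have ua0 : 0 <= u `^ al by exact: powR_ge0.
have powXC j : (l ^+ j) `^ al = (l `^ al) ^+ j.
  by rewrite -powR_mulrn ?ltW// powRAC powR_mulrn ?powR_ge0.
have cnt (k : nat) (f : nat -> R) : (forall i, f i <= C) ->
    \sum_(i < k) f i <= k%:R * C.
  move=> fC; by rewrite mulr_natl -[in leRHS](card_ord k) -sumr_const; apply: ler_sum.
rewrite normrM [in leRHS]normrM !(ger0_norm ua0).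
have [u1|/ltW u1] := leP 1 u.
  have [k [/andP[h1 h2] /(_ n)/andP[h3 h4]]] := D_past u1.
  have D0 : 0 <= D n u.
    by apply: le_trans h3; apply: sumr_ge0 => i _; rewrite F_ge0 ?exprn_gt0.
  rewrite (ger0_norm D0) ger0_norm ?ln_ge0//.
  apply: (@le_trans _ _ (u `^ al * ((ln u / ln l + 1) * C))).
    rewrite ler_wpM2l//; apply: le_trans h4 _.
    apply: (le_trans (cnt k.+1 (fun i => F n (l ^+ i.+1)) _)).
      by move=> i; apply: F_past; rewrite exprn_ege1 ?ltW.
    by rewrite ler_wpM2r// -natr1 lerD2r.
  rewrite -[leLHS]addr0 lerD ?(mulr_ge0 C_ge0 K0)//.
  by rewrite le_eqVlt; apply/orP; left; apply/eqP; ring.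
have [k [_ lk /(_ n)/andP[h3 h4]]] := D_future u0 u1.
have D0 : 0 <= - D n u.
  by apply: le_trans h3; apply: sumr_ge0 => i _; rewrite F_ge0 ?invr_gt0 ?exprn_gt0.
rewrite -normrN (ger0_norm D0).
rewrite -[leLHS]add0r lerD ?mulr_ge0 ?addr_ge0 ?divr_ge0 ?mulr_ge0 ?(ltW lnl)//.
apply: (@le_trans _ _ (u `^ al * (C * (K * (l `^ al) ^+ k)))).
  rewrite ler_wpM2l//; apply: le_trans h4 _.
  apply: (@le_trans _ _ (\sum_(i < k.+1) C * (l `^ al) ^+ i)); last first.
    by rewrite -mulr_sumr ler_wpM2l// geometric_sum_le.
  apply: ler_sum => i _.
  have li0 : 0 < l ^- i by rewrite invr_gt0 exprn_gt0.
  apply: le_trans (@F_scaleV n _ 1 li0 _) _.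
    by rewrite invf_le1 ?exprn_gt0// exprn_ege1 ?ltW.
  rewrite div1r invrK powXC mulrC; apply: ler_wpM2r; first by rewrite exprn_ge0 ?powR_ge0.
  exact: F_past.
rewrite mulrCA ler_wpM2l// mulrCA ler_piMr//.
rewrite -powXC -powRM ?exprn_ge0 ?(ltW u0) ?(ltW l0)//.
rewrite -[leRHS](_ : 1 `^ al = 1); last by rewrite powR1.
apply: ge0_ler_powR; rewrite ?nnegrE ?ler01 ?(ltW al_gt0)//.
  by rewrite mulr_ge0 ?exprn_ge0 ?(ltW u0) ?(ltW l0).
by rewrite mulrC -ler_pdivlMr// div1r.
Qed.

(** Each increment that enters [D n u] tends to [S], so [D n u] is close to
    S ln u / ln l up to one increment, and averaging ln u gives the drift [m].
    The uncertainty of one increment is the source of the terms 1. *)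
Lemma profile_balance : (forall u, 0 < u -> F n u @[n --> \oo] --> S) ->
  forall e : R, 0 < e -> \forall n \near \oo,
    S * (m / ln l - 1) - e <= L (x_ n) / c_ n <= S * (m / ln l + 1) + e.
Proof.
move=> Fcvg e e0.
pose b z := ln (y z) / ln l.
have S0 : 0 <= S.
  have /cvg_lim <- // := F1; apply: limr_ge; first by apply/cvg_ex; exists S.
  by apply: nearW => n; exact: F_ge0.
pose H' z := C * (`|y z `^ al * ln (y z)| / ln l + y z `^ al) + C * K.
have iabs : integ (fun z => `|y z `^ al * ln (y z)|) by exact: integrable_norm ilog.
have iH' : integ H'.
  apply: integD; last exact: finite_measure_integrable_cst.
  by apply: integZl; apply: integD => //; exact: integZr.
have iyb c : integ (fun z => y z `^ al * (S * (b z + c))).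
  have -> : (fun z => y z `^ al * (S * (b z + c))) =
     (fun z => S / ln l * (y z `^ al * ln (y z)) + y z `^ al * (S * c)).
    by apply/funext => z; rewrite /b; ring.
  by apply: integD; [exact: integZl|exact: integrable_weight_cst].
have Eyb c : \int[nu]_z (y z `^ al * (S * (b z + c))) = S * (m / ln l + c).
  have -> : (fun z => y z `^ al * (S * (b z + c))) =
     (fun z => S / ln l * (y z `^ al * ln (y z)) + y z `^ al * (S * c)).
    by apply/funext => z; rewrite /b; ring.
  rewrite RintegralD//; [|exact: integZl|exact: integrable_weight_cst].
  by rewrite RintegralZl// Rintegral_weight_cst -/m; ring.
have mD n : measurable_fun setT (fun z => y z `^ al * D n (y z)).
  apply: measurable_funM; first exact: measurable_weight.
  apply: measurable_funM; last exact: measurable_cst.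
  by apply: measurable_funB; [exact: measurable_cst|exact: measurable_convolved].
have yD n z : `|y z `^ al * D n (y z)| <= H' z.
  have := y_ge0 z; rewrite le_eqVlt => /orP[/eqP yz|yz]; last exact: D_dom.
  have K0 : 0 <= K by rewrite divr_ge0 ?powR_ge0// subr_ge0 ltW.
  by rewrite /H' -yz powR0 ?gt_eqF// !mul0r normr0 mul0r addr0 mulr0 add0r mulr_ge0.
have iD n : integ (fun z => y z `^ al * D n (y z)).
  exact: integrable_dom (mD n) iH' (yD n).
have ED n : L (x_ n) / c_ n = \int[nu]_z (y z `^ al * D n (y z)).
  rewrite -RintegralZr//.
    by apply: eq_Rintegral => z _; rewrite /D mulrA.
  have -> : (fun z => y z `^ al * (J (x_ n) - J (x_ n / y z))) =
    (fun z => y z `^ al * D n (y z) * c_ n).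
    by apply/funext => z; rewrite /D -mulrA divfK// gt_eqF.
  exact: integZr.
have Dlim u e1 : 0 < u -> 0 < e1 -> \forall n \near \oo,
    S * (ln u / ln l + (-1)) - e1 <= D n u <= S * (ln u / ln l + 1) + e1.
  move=> u0 e10.
  have [u1|/ltW u1] := leP 1 u.
    have [k [/andP[h1 h2] h]] := D_past u1.
    have c1 := @cvg_sum_cst R (fun i n => F n (l ^+ i.+1)) S k
      (fun i => Fcvg _ (exprn_gt0 _ l0)).
    have c2 := @cvg_sum_cst R (fun i n => F n (l ^+ i.+1)) S k.+1
      (fun i => Fcvg _ (exprn_gt0 _ l0)).
    move/cvgrPdist_le : c1 => /(_ _ e10) c1; move/cvgrPdist_le : c2 => /(_ _ e10).
    apply: filterS2 c1 => n; rewrite !ler_distlC => /andP[c1 _] /andP[_ c2].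
    have /andP[h3 h4] := h n.
    have k1 : S * (ln u / ln l + (-1)) <= k%:R * S.
      by rewrite mulrC ler_wpM2r//; lra.
    have k2 : k.+1%:R * S <= S * (ln u / ln l + 1).
      by rewrite [leRHS]mulrC ler_wpM2r// -natr1; lra.
    by apply/andP; split; lra.
  have [k [/andP[h1 h2] _ h]] := D_future u0 u1.
  have li0 i : 0 < l ^- i by rewrite invr_gt0 exprn_gt0.
  have c1 := @cvg_sum_cst R (fun i n => F n (l ^- i)) S k (fun i => Fcvg _ (li0 i)).
  have c2 := @cvg_sum_cst R (fun i n => F n (l ^- i)) S k.+1 (fun i => Fcvg _ (li0 i)).
  move/cvgrPdist_le : c1 => /(_ _ e10) c1; move/cvgrPdist_le : c2 => /(_ _ e10).
  apply: filterS2 c1 => n; rewrite !ler_distlC => /andP[c1 _] /andP[_ c2].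
  have /andP[h3 h4] := h n.
  have k1 : - (S * (ln u / ln l + 1)) <= k%:R * S.
    by rewrite -mulrN mulrC ler_wpM2r//; lra.
  have k2 : k.+1%:R * S <= - (S * (ln u / ln l + (-1))).
    by rewrite -mulrN [leRHS]mulrC ler_wpM2r// -natr1; lra.
  by apply/andP; split; lra.
have dom c (sg : R) : `|sg| = 1 -> forall n z,
   `|sg * (y z `^ al * D n (y z) - y z `^ al * (S * (b z + c)))| <=
   H' z + `|y z `^ al * (S * (b z + c))|.
  move=> sg1 n z; rewrite normrM sg1 mul1r; apply: le_trans (ler_normB _ _) _.
  by rewrite lerD2r.
have side c (sg : R) : `|sg| = 1 ->
   (forall u e1, 0 < u -> 0 < e1 -> \forall n \near \oo,
      sg * (D n u - S * (ln u / ln l + c)) <= e1) ->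
   \forall n \near \oo, sg * (L (x_ n) / c_ n - S * (m / ln l + c)) <= e.
  move=> sg1 h.
  have idif n : integ (fun z => y z `^ al * D n (y z) - y z `^ al * (S * (b z + c))).
    exact: integB.
  suff : \forall n \near \oo, \int[nu]_z (sg * (y z `^ al * D n (y z) -
      y z `^ al * (S * (b z + c)))) <= e.
    by apply: filterS => n; rewrite RintegralZl// RintegralB// Eyb -ED.
  apply: (@Rintegral_limsup_le _ _ _ nu
    (fun n z => sg * (y z `^ al * D n (y z) - y z `^ al * (S * (b z + c))))
    (fun z => H' z + `|y z `^ al * (S * (b z + c))|) _ _ (dom c sg sg1) _ e e0).
  - move=> n; apply/measurable_EFinP; exact: measurable_int (integZl sg (idif n)).
  - by apply: integD => //; exact: integrable_norm.
  - move=> z e1 e10; have := y_ge0 z.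
    rewrite le_eqVlt => /orP[/eqP yz|yz].
      by apply: nearW => n; rewrite -yz powR0 ?gt_eqF// !mul0r subrr mulr0 ltW.
    have := h _ (e1 / y z `^ al) yz (divr_gt0 e10 (powR_gt0 _ yz)).
    apply: filterS => n h1.
    by rewrite -mulrBr mulrCA mulrC -ler_pdivlMr ?powR_gt0.
have s1 : \forall n \near \oo, 1 * (L (x_ n) / c_ n - S * (m / ln l + 1)) <= e.
  apply: side; first by rewrite normr1.
  move=> u e1 u0 e10; have := Dlim u e1 u0 e10; apply: filterS => n /andP[_ h].
  by rewrite mul1r lerBlDl.
have s2 : \forall n \near \oo, (-1) * (L (x_ n) / c_ n - S * (m / ln l + (-1))) <= e.
  apply: side; first by rewrite normrN1.
  move=> u e1 u0 e10; have := Dlim u e1 u0 e10; apply: filterS => n /andP[h _].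
  by rewrite mulN1r opprB lerBlDl -lerBlDr.
apply: filterS2 s1 s2 => n; rewrite mul1r mulN1r => h1 h2.
by apply/andP; split; lra.
Qed.

End profile.
Hypothesis lm : ln l < m.

Let m1 : 0 < m / ln l - 1.
Proof. by rewrite subr_gt0 ltr_pdivlMr// mul1r. Qed.

(** Were q unbounded, the near-maximisers of q (x) x^(-e) with e -> 0 would give
    points [x_ n] with q (x_ n) -> oo whose profile, in units of q (x_ n), tends
    to the constant 1.  By [profile_balance] L (x_ n) / q (x_ n) would then stay
    above a positive constant, whereas [L] is bounded. *)
Lemma increment_bounded : exists B, forall x, 0 < x -> q x <= B.
Proof.
apply: contrapT => nB.
have unb B : exists2 x, 0 < x & B < q x.
  apply: contrapT => h; apply: nB; exists B => x x0; rewrite leNgt; apply/negP => hx.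
  by apply: h; exists x.
(* the factor al / (al + 1) keeps the exponents below both 1 and al *)
pose ep n : R := al / (al + 1) * n.+1%:R^-1.
have al10 : 0 < al + 1 by rewrite addr_gt0.
have ep0 n : 0 < ep n by rewrite mulr_gt0 ?divr_gt0// invr_gt0 ltr0Sn.
have eple n : ep n <= al / (al + 1).
  by rewrite ler_piMr ?divr_ge0 ?(ltW al_gt0) ?(ltW al10)// invf_le1 ?ltr0Sn// ler1n.
have ep1 n : ep n <= 1.
  by apply: le_trans (eple n) _; rewrite ler_pdivrMr// mul1r lerDl.
have epal n : ep n < al.
  by apply: le_lt_trans (eple n) _; rewrite ltr_pdivrMr// ltr_pMr// ltrDr.
have epc : ep n @[n --> \oo] --> (0 : R).
  rewrite -[X in _ --> X](mulr0 (al / (al + 1))).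
  apply: cvgM; [exact: cvg_cst|exact: cvg_harmonic].
have ex n : exists x, [/\ 0 < x, 0 < q x &
    forall w, 0 < w -> q w * w `^ (- ep n) <= (1 + ep n) * (q x * x `^ (- ep n))].
  pose A := [set q x * x `^ (- ep n) | x in [set x | 0 < x]].
  have [C HC] := J_growth (ltac:(by rewrite ep0 epal) : 0 < ep n < al).
  have AB : has_sup A.
    split; first by exists (q 1 * 1 `^ (- ep n)); exists 1 => //=.
    exists (C * l `^ ep n) => _ [x /= x0 <-].
    rewrite powRN ler_pdivrMr ?powR_gt0//.
    apply: (@le_trans _ _ (J (l * x))); first by rewrite /q lerBlDr lerDl.
    apply: le_trans (HC _ (mulr_gt0 l0 x0)) _.
    by rewrite powRM ?(ltW l0) ?(ltW x0)// mulrA.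
  have [x1 x10 qx1] := unb 0.
  have s0 : 0 < sup A.
    apply: (@lt_le_trans _ _ (q x1 * x1 `^ (- ep n))).
      by rewrite mulr_gt0 ?powR_gt0.
    by apply: (sup_upper_bound AB); exists x1.
  have [|_ [x /= x0 <-] hx] := sup_adherent (_ : 0 < sup A - sup A / (1 + ep n)) AB.
    by rewrite subr_gt0 ltr_pdivrMr ?ltr_wpDr// ?ltr_pMr// ?ltrDl// ltW.
  have hx' : sup A / (1 + ep n) < q x * x `^ (- ep n) by lra.
  exists x; split => //.
    have : 0 < q x * x `^ (- ep n).
      by apply: lt_trans hx'; rewrite divr_gt0 ?addr_gt0.
    by rewrite pmulr_lgt0// powR_gt0.
  move=> w w0; apply: (@le_trans _ _ (sup A)).
    by apply: (sup_upper_bound AB); exists w.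
  by rewrite mulrC -ler_pdivrMr ?addr_gt0// ltW.
have [x_ x_P] := choice ex.
have x_gt0 n : 0 < x_ n by have [] := x_P n.
pose c_ n := q (x_ n).
have c_gt0 n : 0 < c_ n by have [] := x_P n.
have Fle n u : 0 < u -> q (x_ n / u) / c_ n <= (1 + ep n) * u `^ (- ep n).
  move=> u0; have [_ _ /(_ _ (divr_gt0 (x_gt0 n) u0))] := x_P n.
  have -> : (x_ n / u) `^ (- ep n) = x_ n `^ (- ep n) * u `^ ep n.
    rewrite powRM ?invr_ge0 ?(ltW u0) ?(ltW (x_gt0 n))//; congr (_ * _).
    by rewrite -[u^-1]powR_inv1 ?(ltW u0)// -powRrM mulN1r opprK.
  rewrite -/(c_ n) => h; rewrite ler_pdivrMr// powRN mulrAC ler_pdivlMr ?powR_gt0//.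
  have p0 : 0 < x_ n `^ (- ep n) by rewrite powR_gt0.
  rewrite -(ler_pM2r p0); apply: le_trans (le_trans _ h) _; rewrite le_eqVlt;
    by apply/orP; left; apply/eqP; ring.
have F_past n u : 1 <= u -> q (x_ n / u) / c_ n <= 2.
  move=> u1; have u0 : 0 < u by exact: lt_le_trans u1.
  apply: le_trans (Fle n u u0) _; rewrite -[leRHS]mulr1.
  apply: ler_pM; rewrite ?addr_ge0 ?powR_ge0 ?(ltW (ep0 n))//.
    by have := ep1 n; lra.
  by rewrite -(powRr0 u) ler_powR// oppr_le0 ltW.
have F1 : q (x_ n / 1) / c_ n @[n --> \oo] --> (1 : R).
  rewrite [X in X @ _](_ : _ = fun=> 1); first exact: cvg_cst.
  by apply/funext => n; rewrite divr1 -/(c_ n) divff// gt_eqF.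
have c_infty B : \forall n \near \oo, B <= c_ n.
  have [w w0 qw] := unb (4 * (`|B| + l `^ al)).
  have la0 : 0 < l `^ al by rewrite powR_gt0.
  have /cvgrPdist_le/(_ _ (ltac:(lra) : 0 < 2^-1 :> R)) := cvg_powR_small w0 epc.
  apply: filterS => n; rewrite !ler_distlC => /andP[wn _].
  have [_ _ /(_ _ w0)] := x_P n; rewrite -/(c_ n) => h.
  have qw0 : 0 < q w by apply: le_lt_trans qw; rewrite mulr_ge0// addr_ge0// ltW.
  have h1 : q w * 2^-1 <= q w * w `^ (- ep n).
    by rewrite ler_pM2l//; move: wn; lra.
  have cx0 : 0 < c_ n * x_ n `^ (- ep n) by rewrite mulr_gt0 ?powR_gt0.
  have h2 : (1 + ep n) * (c_ n * x_ n `^ (- ep n)) <= 2 * (c_ n * x_ n `^ (- ep n)).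
    by rewrite ler_pM2r//; have := ep1 n; lra.
  have BB := ler_norm B.
  have [x1|x1] := leP 1 (x_ n).
    have : c_ n * x_ n `^ (- ep n) <= c_ n.
      rewrite -[leRHS]mulr1 ler_pM2l// -(powRr0 (x_ n)) ler_powR// oppr_le0 ltW//.
    lra.
  have : c_ n * x_ n `^ (- ep n) <= l `^ al.
    apply: (@le_trans _ _ ((l * x_ n) `^ al * x_ n `^ (- ep n))).
      rewrite ler_pM2r ?powR_gt0//; apply: le_trans (J_le (mulr_gt0 l0 (x_gt0 n))).
      by rewrite /c_ /q lerBlDr lerDl.
    rewrite powRM ?(ltW l0) ?(ltW (x_gt0 n))// -mulrA -powRD; last first.
      by rewrite (gt_eqF (x_gt0 n)) implybT.
    rewrite -[leRHS]mulr1 ler_pM2l// -(powRr0 (x_ n)); apply: ger_powR.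
      by rewrite x_gt0 (ltW x1).
    by rewrite subr_ge0 ltW.
  move=> h3; have h5 := normr_ge0 B; exfalso.
  have h4 := le_trans h1 (le_trans h h2); lra.
have L_flat : (L (l * x_ n) - L (x_ n)) / c_ n @[n --> \oo] --> 0.
  apply/cvgrPdist_le => e e0.
  have := c_infty (Lb / e); apply: filterS => n h.
  have lx0 := mulr_gt0 l0 (x_gt0 n).
  have d0 : 0 <= L (l * x_ n) - L (x_ n).
    by rewrite subr_ge0 L_nd// ler_peMl// ltW.
  rewrite sub0r normrN ger0_norm; last by rewrite divr_ge0// ltW.
  rewrite ler_pdivrMr// [leRHS]mulrC -ler_pdivrMr//; apply: (le_trans _ h).
  by rewrite ler_pM2r ?invr_gt0//; have := L_le lx0; have := L_ge0 (x_gt0 n); lra.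
have Fcvg : forall u, 0 < u -> q (x_ n / u) / c_ n @[n --> \oo] --> (1 : R).
  apply: (profile_cst_of_le x_gt0 c_gt0 F_past F1 L_flat) => u e u0 e0.
  have ub : (1 + ep n) * u `^ (- ep n) @[n --> \oo] --> (1 : R).
    rewrite -[X in _ --> X](_ : (1 + 0) * 1 = 1); last by rewrite addr0 mul1r.
    apply: cvgM; last exact: cvg_powR_small.
    by apply: cvgD => //; exact: cvg_cst.
  move/cvgrPdist_le : ub => /(_ e e0); apply: filterS => n.
  rewrite ler_distlC => /andP[_]; apply: le_trans; exact: Fle.
pose e := (m / ln l - 1) / 2.
have e0 : 0 < e by rewrite divr_gt0.
have hL := profile_balance x_gt0 c_gt0 F_past F1 Fcvg e0.
have hc := c_infty (Lb / e + 1).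
have [n [/andP[h1 _] h2]] := filter_ex (filterI hL hc).
have : L (x_ n) / c_ n <= Lb / c_ n by rewrite ler_pM2r ?invr_gt0// L_le.
have : Lb / c_ n < e.
  rewrite ltr_pdivrMr// [ltRHS]mulrC -ltr_pdivrMr//; lra.
rewrite /e in h1 *; lra.
Qed.

Let L_flat (x_ : nat -> R) : (forall n, n.+1%:R <= x_ n) ->
  (L (l * x_ n) - L (x_ n)) / 1 @[n --> \oo] --> 0.
Proof.
move=> nx; apply/cvgrPdist_le => e e0; have [X X0 HX] := balance_near_sup e0.
near=> n.
have Xx : X <= x_ n.
  apply: le_trans (nx n); rewrite -natr1 (@le_trans _ _ n%:R) ?lerDl//.
  by near: n; exact: nbhs_infty_ger.
have xlx : x_ n <= l * x_ n.
  by rewrite ler_peMl ?(ltW l1)//; exact: le_trans (ltW X0) Xx.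
have /andP[h1 h2] := HX _ Xx; have /andP[h3 h4] := HX _ (le_trans Xx xlx).
rewrite sub0r normrN divr1 ger0_norm; first by lra.
by rewrite subr_ge0 L_nd//; exact: lt_le_trans Xx.
Unshelve. all: end_near. Qed.

(** Along sequences realising the upper and the lower limit of q the profile is
    asymptotically constant, and [profile_balance] compares both limits with
    [G0]. *)
Lemma increment_asymptotics (e : R) : 0 < e -> exists2 X, 0 < X &
  forall x, X <= x ->
    G0 * ln l / (m + ln l) - e <= J (l * x) - J x <= G0 * ln l / (m - ln l) + e.
Proof.
move=> e0; have [B qB] := increment_bounded.
have qnB x : 0 < x -> `|q x| <= B by move=> x0; rewrite ger0_norm ?qB ?increment_ge0.
have nx0 (x_ : nat -> R) : (forall n, n.+1%:R <= x_ n) -> forall n, 0 < x_ n.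
  by move=> h n; apply: lt_le_trans (h n); rewrite ltr0Sn.
have past (x_ : nat -> R) : (forall n, n.+1%:R <= x_ n) ->
    forall n u, 1 <= u -> q (x_ n / u) / 1 <= B.
  move=> h n u u1; rewrite divr1; apply: qB.
  exact: divr_gt0 (nx0 _ h n) (lt_le_trans ltr01 u1).
have far (x_ : nat -> R) X u : (forall n, n.+1%:R <= x_ n) -> 0 < u ->
    \forall n \near \oo, X <= x_ n / u.
  move=> h u0; near=> n; rewrite ler_pdivlMr//; apply: le_trans (h n).
  rewrite -natr1 (@le_trans _ _ n%:R) ?lerDl//.
  by near: n; exact: nbhs_infty_ger.
have [S [xs [xs1 xs2 xs3]]] := limsup_attained qnB.
have qNB x : 0 < x -> `|- q x| <= B by move=> x0; rewrite normrN qnB.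
have [I [xi [xi1 xi2 xi3]]] := limsup_attained qNB.
have S_lim : forall u, 0 < u -> q (xs n / u) / 1 @[n --> \oo] --> S.
  apply: (profile_cst_of_le (nx0 _ xs1) (fun=> ltr01) (past _ xs1) _ (L_flat xs1)).
    by under eq_cvg do rewrite !divr1.
  move=> u e1 u0 e10; have [X X0 HX] := xs3 _ e10.
  apply: filterS (far xs X u xs1 u0) => n h; rewrite divr1; exact: HX.
have I_lim : forall u, 0 < u -> q (xi n / u) / 1 @[n --> \oo] --> - I.
  apply: (profile_cst_of_ge (nx0 _ xi1) (fun=> ltr01) (past _ xi1) _ (L_flat xi1)).
    under eq_cvg do rewrite !divr1 -[q _]opprK; exact: cvgN.
  move=> u e1 u0 e10; have [X X0 HX] := xi3 _ e10.
  apply: filterS (far xi X u xi1 u0) => n h; rewrite divr1.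
  by rewrite -opprD lerNl; exact: HX.
have SL := profile_balance (nx0 _ xs1) (fun=> ltr01) (past _ xs1) _ S_lim.
have IL := profile_balance (nx0 _ xi1) (fun=> ltr01) (past _ xi1) _ I_lim.
have hS : S * (m / ln l - 1) <= G0.
  apply/ler_addgt0Pr => e1 e10; have [X X0 HX] := balance_near_sup e10.
  have [n [h1 /andP[h2 _]]] := filter_ex (filterI (far xs X 1 xs1 ltr01)
    (SL (S_lim 1 ltr01) e1 e10)).
  have /andP[_ h3] := HX _ h1; rewrite divr1 in h3.
  by move: h2; rewrite divr1; lra.
have hI : G0 <= - I * (m / ln l + 1).
  apply/ler_addgt0Pr => e1 e10.
  have e20 : 0 < e1 / 2 by rewrite divr_gt0.
  have [X X0 HX] := balance_near_sup e20.
  have [n [h1 /andP[_ h2]]] := filter_ex (filterI (far xi X 1 xi1 ltr01)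
    (IL (I_lim 1 ltr01) _ e20)).
  have /andP[h3 _] := HX _ h1; rewrite divr1 in h3.
  by move: h2; rewrite divr1; lra.
have [X X0 HX] := xs3 _ e0; have [Y Y0 HY] := xi3 _ e0.
exists (Num.max X Y); first by rewrite lt_max X0.
move=> x; rewrite ge_max => /andP[Xx Yx].
have {}HX := HX _ Xx; have {}HY := HY _ Yx.
have S_le : S <= G0 * ln l / (m - ln l).
  rewrite ler_pdivlMr ?subr_gt0//.
  have -> : S * (m - ln l) = S * (m / ln l - 1) * ln l by field; rewrite gt_eqF.
  by rewrite ler_pM2r.
have I_ge : G0 * ln l / (m + ln l) <= - I.
  rewrite ler_pdivrMr ?addr_gt0//.
  have -> : - I * (m + ln l) = - I * (m / ln l + 1) * ln l.
    by field; rewrite gt_eqF.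
  by rewrite ler_pM2r.
by apply/andP; split; rewrite -/(q x); lra.
Unshelve. all: end_near. Qed.

End scale.
Lemma small_dilation (e : R) : 0 < e -> exists2 s : R, 0 < s < m &
  expR (al * s) * (G0 / (al * (m - s))) <= G0 / (al * m) + e /\
  G0 / (al * m) - e <= expR (- (al * s)) * (G0 / (al * (m + s))).
Proof.
move=> e0; pose h n : R := n.+1%:R^-1.
have h0 : h n @[n --> \oo] --> (0 : R) by exact: cvg_harmonic.
have alm : al * m != 0 by rewrite mulf_neq0 ?gt_eqF.
have cexp (a : R) : expR (a * h n) @[n --> \oo] --> (1 : R).
  rewrite -[X in _ --> X]expR0; apply: continuous_cvg; first exact: continuous_expR.
  rewrite -[X in _ --> X](mulr0 a); apply: cvgM => //; exact: cvg_cst.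
have c1 : expR (al * h n) * (G0 / (al * (m - h n))) @[n --> \oo] --> G0 / (al * m).
  rewrite -[X in _ --> X]mul1r; apply: cvgM => //; apply: cvgM; first exact: cvg_cst.
  apply: cvgV => //; apply: cvgM; first exact: cvg_cst.
  by rewrite -[X in _ --> X]subr0; apply: cvgB => //; exact: cvg_cst.
have c2 : expR (- al * h n) * (G0 / (al * (m + h n))) @[n --> \oo] --> G0 / (al * m).
  rewrite -[X in _ --> X]mul1r; apply: cvgM => //; apply: cvgM; first exact: cvg_cst.
  apply: cvgV => //; apply: cvgM; first exact: cvg_cst.
  by rewrite -[X in _ --> X]addr0; apply: cvgD => //; exact: cvg_cst.
move/cvgrPdist_le : c1 => /(_ e e0) c1; move/cvgrPdist_le : c2 => /(_ e e0) c2.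
move/cvgrPdist_lt : h0 => /(_ m m_gt0) h0.
have [n [[]]] := filter_ex (filterI (filterI c1 c2) h0).
rewrite !ler_distlC sub0r normrN => /andP[_ h1] /andP[h2 _] h3.
have hn0 : 0 < h n by rewrite invr_gt0 ltr0Sn.
exists (h n); first by rewrite hn0 -(ger0_norm (ltW hn0)).
by rewrite -mulNr.
Qed.

(** The increments of [J] over a dilation by l bracket x^al p (x) up to the
    factor l^al - 1, equivalent to al ln l, while they are close to
    G0 ln l / m; the two estimates match when l tends to 1. *)
Lemma renewal_tail (p : R -> R) : (forall x, 0 <= p x) ->
  (forall l x, 1 <= l -> 0 < x ->
     (l `^ al - 1) * (x `^ al * p (l * x)) <= J (l * x) - J x
       <= (l `^ al - 1) * (x `^ al * p x)) ->
  x `^ al * p x @[x --> +oo] --> G0 / (al * m).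
Proof.
move=> p0 pJ; apply/cvgrPdist_le => e e0.
have e20 : 0 < e / 2 by rewrite divr_gt0.
have [s /andP[s0 sm] [up lo]] := small_dilation e20.
pose l := expR s.
have lnl : ln l = s by rewrite expRK.
have l1 : 1 < l by rewrite expR_gt1.
have lm : ln l < m by rewrite lnl.
have l0 : 0 < l by exact: expR_gt0.
have la : l `^ al = expR (al * s) by rewrite /powR gt_eqF// lnl.
have als : 0 < al * s by exact: mulr_gt0.
pose e' := e / 2 * (al * s * expR (- (al * s))).
have e'0 : 0 < e' by rewrite !mulr_gt0 ?expR_gt0.
have [X X0 HX] := increment_asymptotics l1 lm e'0.
have E1 : al * s <= l `^ al - 1 by rewrite la lerBrDl expR_ge1Dx.
have E2 : l `^ al - 1 <= al * s * l `^ al.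
  have := expR_ge1Dx (- (al * s)); rewrite -(ler_pM2r (expR_gt0 (al * s))).
  by rewrite -expRD addNr expR0 la; lra.
have Ecan : expR (- (al * s)) * l `^ al = 1 by rewrite la -expRD addNr expR0.
have Einv : expR (- (al * s)) = (l `^ al)^-1 by rewrite la expRN.
have la0 : 0 < l `^ al by rewrite powR_gt0.
have la1 : 0 < l `^ al - 1 by exact: lt_le_trans E1.
near=> x.
have Xx : X * l <= x by near: x; apply: nbhs_pinfty_ge; exact: num_real.
have x0 : 0 < x by apply: lt_le_trans Xx; exact: mulr_gt0.
have Xl : X <= x / l by rewrite ler_pdivlMr.
have xl0 : 0 < x / l by exact: divr_gt0.
have xX : X <= x.
  by apply: le_trans Xx; rewrite ler_peMr ?(ltW X0)// ltW.
have /andP[lo1 _] := HX _ xX; have /andP[_ hi1] := HX _ Xl.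
have /andP[_ hi2] := pJ l x (ltW l1) x0.
have /andP[lo2 _] := pJ l (x / l) (ltW l1) xl0.
have lxl : l * (x / l) = x by rewrite mulrC divfK// gt_eqF.
rewrite lxl in lo2 hi1; rewrite !lnl in lo1 hi1.
have px0 : 0 <= x `^ al * p x by rewrite mulr_ge0 ?powR_ge0.
have xa : x `^ al = l `^ al * (x / l) `^ al by rewrite -powRM ?lxl ?ltW.
rewrite ler_distlC; apply/andP; split.
- have h1 : G0 * s / (m + s) - e' <= al * s * l `^ al * (x `^ al * p x).
    apply: le_trans lo1 _; apply: le_trans hi2 _.
    by rewrite ler_wpM2r.
  have h2 : (al * s * l `^ al)^-1 * (G0 * s / (m + s) - e') <= x `^ al * p x.
    by rewrite [leLHS]mulrC ler_pdivrMr ?mulr_gt0// [leRHS]mulrC.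
  have h3 : (al * s * l `^ al)^-1 * (G0 * s / (m + s)) =
      expR (- (al * s)) * (G0 / (al * (m + s))).
    by rewrite Einv; field; rewrite !gt_eqF ?addr_gt0.
  have h4 : (al * s * l `^ al)^-1 * e' <= e / 2.
    rewrite [leLHS]mulrC ler_pdivrMr ?mulr_gt0// /e' ler_pM2l// ler_pM2l//.
    rewrite Einv; apply: (@le_trans _ _ 1); last by lra.
    by rewrite invf_le1//; lra.
  rewrite mulrBr h3 in h2; lra.
- have h1 : x `^ al * p x * (al * s) <= l `^ al * (G0 * s / (m - s) + e').
    rewrite xa -mulrA -mulrA ler_pM2l// mulrA mulrC.
    apply: le_trans hi1; apply: le_trans lo2.
    by rewrite ler_wpM2r// mulr_ge0 ?powR_ge0.
  have h2 : x `^ al * p x <= l `^ al * (G0 * s / (m - s) + e') / (al * s).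
    by rewrite ler_pdivlMr.
  have h3 : l `^ al * (G0 * s / (m - s) + e') / (al * s) =
      expR (al * s) * (G0 / (al * (m - s))) + e / 2.
    rewrite -la /e' Einv; field.
    by rewrite !gt_eqF ?subr_gt0.
  lra.
Unshelve. all: end_near. Qed.

Theorem renewal_tail_pos (p : R -> R) : (exists2 x, 0 < x & 0 < L x) ->
  (forall x, 0 <= p x) ->
  (forall l x : R, 1 <= l -> 0 < x ->
     (l `^ al - 1) * (x `^ al * p (l * x)) <= J (l * x) - J x
       <= (l `^ al - 1) * (x `^ al * p x)) ->
  exists2 c : R, 0 < c & x `^ al * p x @[x --> +oo] --> c.
Proof.
move=> [x0 x00 Lx0] p0 pJ; exists (G0 / (al * m)); last exact: renewal_tail.
rewrite divr_gt0 ?mulr_gt0//; apply: lt_le_trans Lx0 _.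
apply: sup_upper_bound; last by exists x0.
by split; [exists (L x0); exists x0|exists Lb => _ [x /= x1 <-]; exact: L_le].
Qed.

End renewal.

(** * The normal distribution *)

(** The parameter [s] is the standard deviation. *)
Definition gauss {R : realType} (c s : R) : probability (measurableTypeR R) R :=
  normal_prob c s.

Section gaussian_facts.
Context {R : realType}.
Local Notation mu := (@lebesgue_measure R).

Lemma law_exists d (T : measurableType d) (P : probability T R) (X : T -> R) :
  measurable_fun setT X ->
  {Q : probability (measurableTypeR R) R | forall A, Q A = P (X @^-1` A)}.
Proof.
move=> mX.
have mX' : @measurable_fun _ _ T (measurableTypeR R) setT X by exact: mX.
by exists (distribution P (@mfun_Sub _ _ T (measurableTypeR R) X (mem_set mX'))).
Qed.

Lemma ge0_integral_law d (T : measurableType d) (P : probability T R) (X : T -> R) (Q : probability (measurableTypeR R) R) :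
  measurable_fun setT X -> (forall A, measurable A -> Q A = P (X @^-1` A)) ->
  forall f : R -> \bar R, (forall x, (0 <= f x)%E) -> measurable_fun setT f ->
  (\int[P]_w f (X w) = \int[Q]_x f x)%E.
Proof.
move=> mX QE f f0 mf.
have mX' : @measurable_fun _ _ T (measurableTypeR R) setT X by exact: mX.
have mf' : @measurable_fun _ _ (measurableTypeR R) (\bar R) setT f by exact: mf.
rewrite -[LHS](@ge0_integral_pushforward _ _ T (measurableTypeR R) R X mX' P setT f)//.
apply: eq_measure_integral => A mA _; exact/esym/QE.
Qed.

(** Closed rays are used because their indicators are decreasing limits of
    Lipschitz functions. *)
Lemma measure_eq_rays (P1 P2 : probability (measurableTypeR R) R) :
  (forall x : R, P1 `[x, +oo[%classic = P2 `[x, +oo[%classic) ->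
  forall A, measurable A -> P1 A = P2 A.
Proof.
move=> h A mA.
apply: (@measure_unique _ R (measurableTypeR R) (@RGenCInfty.G R)
  (fun n => `[- n%:R, +oo[%classic) _ _ _ _ P1 P2).
- exact: RGenCInfty.measurableE.
- move=> _ _ [x ->] [y ->]; exists (Num.max x y).
  by apply/seteqP; split => z /=; rewrite !in_itv/= !andbT ge_max;
    [case=> -> ->|case/andP].
- by move=> n; exists (- n%:R).
- apply/seteqP; split => // z _; exists (Num.trunc `|z|).+1 => //=.
  rewrite in_itv/= andbT lerNl ltW//.
  have /andP[_] := truncn_itv (normr_ge0 z); apply: le_lt_trans.
  by rewrite ler_normr lexx orbT.
- by move=> _ [x ->]; exact: h.
- by move=> n; rewrite (le_lt_trans (probability_le1 _ _))// ltry.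
- exact: mA.
Qed.

Lemma ge0_integral_normal (c s : R) (f : R -> \bar R) : s != 0 ->
  (forall x, (0 <= f x)%E) -> measurable_fun setT f ->
  (\int[normal_prob c s]_x f x = \int[mu]_x (f x * (normal_pdf c s x)%:E))%E.
Proof.
move=> s0 f0 mf.
have dom := normal_prob_dominates c s.
rewrite -(Radon_Nikodym_SigmaFinite.change_of_variables dom f0 measurableT mf).
have mpdf : measurable_fun setT (fun x => (normal_pdf c s x)%:E).
  by apply/measurable_EFinP; exact: measurable_normal_pdf.
have iRN := Radon_Nikodym_SigmaFinite.f_integrable dom.
apply: ge0_ae_eq_integral => //.
- apply: emeasurable_funM => //; exact: measurable_int iRN.
- exact: emeasurable_funM.
- by move=> x _; rewrite mule_ge0 ?Radon_Nikodym_SigmaFinite.f_ge0.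
- by move=> x _; rewrite mule_ge0 ?lee_fin ?normal_pdf_ge0.
apply: ae_eqe_mul2l; apply: integral_ae_eq => //.
by move=> E _ mE; rewrite -Radon_Nikodym_SigmaFinite.f_integral.
Qed.

Lemma normal_pdf_affine (c s z : R) : 0 < s ->
  normal_pdf c s (c + s * z) * s = normal_pdf 0 1 z.
Proof.
move=> s0; rewrite !normal_pdfE ?gt_eqF//= /normal_peak /normal_fun.
rewrite -[s ^+ 2 * pi *+ 2]mulrnAr sqrtrM ?sqr_ge0// sqrtr_sqr gtr0_norm//.
rewrite expr1n mul1r subr0 -mulrnAr.
rewrite invfM -!mulrA mulrCA; congr (_ * _).
rewrite mulrA mulrAC mulVf ?gt_eqF// mul1r; congr expR.
rewrite addrAC subrr add0r -[_ *+ 2]mulr_natr -[1 *+ 2]mulr_natr exprMn.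
by field; rewrite gt_eqF.
Qed.

Lemma normal_prob_affine (c s : R) : 0 < s -> forall A, measurable A ->
  normal_prob c s A = normal_prob 0 1 [set z | A (c + s * z)].
Proof.
move=> s0 A mA.
pose F z : R := c + s * z.
have mF : measurable_fun setT F by apply: measurable_funD => //; apply: measurable_funM.
have [Q QE] := law_exists (normal_prob 0 1) mF.
rewrite -[RHS]QE; apply: measure_eq_rays mA => x; rewrite QE.
pose a := (x - c) / s.
have xa : x = F a by rewrite /F /a mulrC divfK ?gt_eqF// addrC subrK.
have -> : F @^-1` `[x, +oo[%classic = `[a, +oo[%classic.
  apply/seteqP; split => z /=; rewrite !in_itv/= !andbT xa /F.
    by rewrite lerD2l ler_pM2l.
  by rewrite lerD2l ler_pM2l.
rewrite xa.
change ((\int[mu]_(x in `[F a, +oo[) (normal_pdf c s x)%:E =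
  \int[mu]_(x in `[a, +oo[) (normal_pdf 0 1 x)%:E)%E).
have dF : F^`()%classic = cst s.
  apply/funext => z; rewrite /F derive1E deriveD// derive_cst add0r.
  by rewrite deriveM// derive_cst derive_id scaler0 addr0 /GRing.scale/= mulr1.
rewrite (@increasing_ge0_integration_by_substitutiony R F (normal_pdf c s) a).
- by apply: eq_integral => z _; rewrite dF /=; congr EFin; exact: normal_pdf_affine.
- by move=> y z _ _ yz; rewrite /F ltrD2l ltr_pM2l.
- by rewrite dF => z _; exact: cst_continuous.
- by rewrite dF; exact: is_cvg_cst.
- by rewrite dF; exact: is_cvg_cst.
- split; first by move=> z _; rewrite /F; apply: derivableD => //; apply: derivableM.
  apply: cvg_at_right_filter; rewrite /F; apply: cvgD; first exact: cvg_cst.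
  by apply: cvgM; [exact: cvg_cst|exact: cvg_id].
- apply/cvgryPge => B.
  have := nbhs_pinfty_ge (num_real ((B - c) / s)); apply: filterS => z.
  by rewrite ler_pdivrMr// lerBlDl mulrC.
- by apply: continuous_subspaceT; apply: continuous_normal_pdf; rewrite gt_eqF.
- by move=> z _; exact: normal_pdf_ge0.
Unshelve. all: end_near. Qed.

Lemma normal_peakE (s : R) : 0 < s ->
  normal_peak s = s^-1 * (Num.sqrt (pi *+ 2))^-1.
Proof.
move=> s0; rewrite /normal_peak -mulrnAr sqrtrM ?sqr_ge0// sqrtr_sqr gtr0_norm//.
by rewrite invfM.
Qed.

(** Bayes formula for a normal prior on z and a normal observation u with mean
    a z: on the right, the marginal density of u times the posterior density of
    z. *)
Lemma normal_pdf_bayes (a b u z : R) : 0 < b -> let r := Num.sqrt (a ^+ 2 + b ^+ 2) in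
  normal_pdf (a * z) b u * normal_pdf 0 1 z =
  normal_pdf 0 r u * normal_pdf (u * a / r ^+ 2) (b / r) z.
Proof.
move=> b0 r.
have r20 : 0 < a ^+ 2 + b ^+ 2 by rewrite ltr_wpDl ?sqr_ge0 ?exprn_gt0.
have r0 : 0 < r by rewrite sqrtr_gt0.
have r2 : r ^+ 2 = a ^+ 2 + b ^+ 2 by rewrite sqr_sqrtr// ltW.
rewrite !normal_pdfE ?gt_eqF ?divr_gt0//= /normal_fun.
rewrite !normal_peakE ?divr_gt0// mulrACA [RHS]mulrACA -!expRD.
congr (_ * expR _); first by move: (Num.sqrt _)^-1 => c; field; rewrite !gt_eqF.
rewrite -[_ *+ 2]mulr_natr -[1 ^+ 2 *+ 2]mulr_natr -[r ^+ 2 *+ 2]mulr_natr.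
rewrite -[(b / r) ^+ 2 *+ 2]mulr_natr expr_div_n r2.
by field; rewrite !gt_eqF.
Qed.

Lemma measurable_normal_kernel (a b : R) (f : R -> R) : 0 < b ->
  measurable_fun setT f -> measurable_fun setT
    (fun zu : R * R => f zu.2 * normal_pdf (a * zu.1) b zu.2).
Proof.
move=> b0 mf; apply: measurable_funM; first exact: measurableT_comp.
rewrite [X in measurable_fun _ X](_ : _ = fun zu =>
    normal_peak b * expR (- (zu.2 - a * zu.1) ^+ 2 / (b ^+ 2 *+ 2))); last first.
  by apply/funext => zu; rewrite normal_pdfE ?gt_eqF.
apply: measurable_funM => //; apply: measurableT_comp => //.
apply: measurable_funM => //; apply: measurableT_comp => //.
apply: measurable_funX; apply: measurable_funB => //; exact: measurable_funM.
Qed.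

(** Integrating z out of [normal_pdf_bayes] leaves the marginal density of u. *)
Lemma gauss_mixture (a b : R) (f : R -> R) : 0 < b ->
  (forall u, 0 <= f u) -> measurable_fun setT f ->
  (\int[gauss 0 1]_z \int[gauss (a * z) b]_u (f u)%:E =
   \int[gauss 0 (Num.sqrt (a ^+ 2 + b ^+ 2))]_u (f u)%:E)%E.
Proof.
rewrite /gauss.
move=> b0 f0 mf; set r := Num.sqrt _.
have r20 : 0 < a ^+ 2 + b ^+ 2 by rewrite ltr_wpDl ?sqr_ge0 ?exprn_gt0.
have r0 : 0 < r by rewrite sqrtr_gt0.
have f0E u : (0 <= (f u)%:E)%E by rewrite lee_fin.
have mfE : measurable_fun setT (fun u => (f u)%:E) by exact/measurable_EFinP.
have fpdf c s : s != 0 -> (\int[normal_prob c s]_u (f u)%:E =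
    \int[mu]_u (f u * normal_pdf c s u)%:E)%E.
  by move=> s0; rewrite ge0_integral_normal//; under eq_integral do rewrite -EFinM.
have b0' : b != 0 by rewrite gt_eqF.
under eq_integral => z _ do rewrite fpdf//.
rewrite (@ge0_integral_normal 0 1) ?oner_neq0//; last 2 first.
- move=> z; apply: integral_ge0 => u _.
  by rewrite lee_fin mulr_ge0 ?normal_pdf_ge0.
- apply: (@measurable_fun_fubini_tonelli_F _ _ _ _ _ mu
    (fun zu : R * R => (f zu.2 * normal_pdf (a * zu.1) b zu.2)%:E)).
    by apply/measurable_EFinP; exact: measurable_normal_kernel.
  by move=> zu; rewrite lee_fin mulr_ge0 ?normal_pdf_ge0.
pose g (zu : R * R) := (f zu.2 * normal_pdf (a * zu.1) b zu.2 * normal_pdf 0 1 zu.1)%R.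
have mg : measurable_fun setT g.
  apply: measurable_funM; first exact: measurable_normal_kernel.
  by apply: measurableT_comp; [exact: measurable_normal_pdf|exact: measurable_fst].
have g0 zu : 0 <= g zu by rewrite !mulr_ge0 ?normal_pdf_ge0.
transitivity (\int[mu]_z \int[mu]_u (g (z, u))%:E)%E.
  apply: eq_integral => z _; rewrite -ge0_integralZr//.
  - apply/measurable_EFinP; apply: measurable_funM => //.
    exact: measurable_normal_pdf.
  - by move=> u _; rewrite lee_fin mulr_ge0 ?normal_pdf_ge0.
  - by rewrite lee_fin normal_pdf_ge0.
transitivity (\int[mu]_u \int[mu]_z (g (z, u))%:E)%E.
  apply: (@fubini_tonelli _ _ _ _ _ mu mu (fun zu => (g zu)%:E)).
    exact/measurable_EFinP.
  by move=> zu; rewrite lee_fin.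
rewrite fpdf ?gt_eqF//; apply: eq_integral => u _; rewrite /g /=.
under eq_integral => z _ do
  rewrite -[(f u * _ * _)%R]mulrA normal_pdf_bayes// mulrA EFinM.
rewrite ge0_integralZl//.
- by rewrite integral_normal_pdf mule1.
- by apply/measurable_EFinP; exact: measurable_normal_pdf.
- by move=> z _; rewrite lee_fin normal_pdf_ge0.
- by rewrite lee_fin mulr_ge0 ?normal_pdf_ge0.
Qed.

Lemma normal_pdfN (z : R) : normal_pdf 0 1 (- z) = normal_pdf 0 1 z.
Proof. by rewrite !normal_pdfE ?oner_neq0// /normal_fun !subr0 sqrrN. Qed.

Lemma gauss_sym (A : set R) : measurable A ->
  gauss 0 1 [set z : R | A (- z)] = gauss 0 1 A.
Proof.
rewrite /gauss.
move=> mA; pose F (z : R) := - z.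
have mF : measurable_fun setT F by exact: measurableT_comp.
have [Q QE] := law_exists (normal_prob 0 1) mF.
rewrite -[LHS]QE; apply: measure_eq_rays mA => x; rewrite QE.
have -> : F @^-1` `[x, +oo[%classic = `]-oo, - x]%classic.
  by apply/seteqP; split => z /=; rewrite !in_itv/= !andbT lerNr.
change ((\int[mu]_(z in `]-oo, (- x)%R]) (normal_pdf 0 1 z)%:E =
  \int[mu]_(z in `[x, +oo[) (normal_pdf 0 1 z)%:E)%E).
have c1 : {within `]-oo, - x], continuous (normal_pdf (0 : R) 1)}.
  by apply: continuous_subspaceT; apply: continuous_normal_pdf; rewrite oner_neq0.
have p0 : {in `]-oo, - x[, forall z : R, 0 <= normal_pdf (0 : R) 1 z}.
  by move=> z _; exact: normal_pdf_ge0.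
apply: (etrans (ge0_integration_by_substitutionNy c1 p0)).
by apply: eq_integral => z _; rewrite /= normal_pdfN.
Qed.

Lemma gauss_itv_gt0 (u v : R) : u < v -> (0 < gauss 0 1 `[u, v]%classic)%E.
Proof.
rewrite /gauss.
move=> uv; pose M := Num.max `|u| `|v|.
pose c := normal_pdf 0 1 M.
have c0 : 0 < c.
  by rewrite /c normal_pdfE ?oner_neq0// mulr_gt0 ?expR_gt0// normal_peak_gt0 ?oner_neq0.
apply: (@lt_le_trans _ _ (\int[mu]_(z in `[u, v]) c%:E)%E).
  rewrite integral_cst//= lebesgue_measure_itv/= lte_fin uv -EFinB mule_gt0//.
  by rewrite lte_fin subr_gt0.
apply: ge0_le_integral => //=.
- by move=> z _; rewrite lee_fin ltW.
- by apply/measurable_EFinP/measurable_funTS; exact: measurable_normal_pdf.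
- move=> z; rewrite in_itv/= => /andP[uz zv]; rewrite lee_fin /c.
  rewrite !normal_pdfE ?oner_neq0// /normal_fun ler_wpM2l ?normal_peak_ge0//.
  rewrite ler_expR !subr0 !mulNr lerN2 ler_pM2r ?invr_gt0 ?expr1n ?ltr0n//.
  rewrite -[leLHS]real_normK ?num_real// lerXn2r ?nnegrE ?le_max ?normr_ge0//.
  have [z0|z0] := leP 0 z.
    by apply/orP; right; rewrite ger0_norm//; exact: le_trans zv (ler_norm _).
  apply/orP; left; rewrite ltr0_norm// ler_normr; apply/orP; right.
  by rewrite lerN2.
Qed.

(** The estimates |z|^p <= e^(p |z|) and p |z| <= p^2 + z^2 / 4 dominate the
    integrand by a multiple of the density of variance 2. *)
Lemma gauss_moment (p : R) : 0 <= p ->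
  (\int[gauss 0 1]_z (`|z| `^ p)%:E < +oo)%E.
Proof.
rewrite /gauss.
move=> p0.
have mp : measurable_fun setT (fun z : R => (`|z| `^ p)%:E).
  apply/measurable_EFinP.
  by apply: (measurableT_comp (measurable_powR p)); exact: normr_measurable.
rewrite ge0_integral_normal ?oner_neq0//.
pose s := Num.sqrt (2 : R).
have s0 : 0 < s by rewrite sqrtr_gt0.
pose K := expR (p ^+ 2) * normal_peak 1 / normal_peak s.
apply: (@le_lt_trans _ _ (\int[mu]_z (K%:E * (normal_pdf 0 s z)%:E))%E); last first.
  rewrite ge0_integralZl//.
  - by rewrite integral_normal_pdf mule1 ltry.
  - by apply/measurable_EFinP; exact: measurable_normal_pdf.
  - by move=> z _; rewrite lee_fin normal_pdf_ge0.
  - by rewrite lee_fin !mulr_ge0 ?invr_ge0 ?normal_peak_ge0 ?expR_ge0.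
apply: ge0_le_integral => //=.
- by move=> z _; rewrite mule_ge0 ?lee_fin ?powR_ge0 ?normal_pdf_ge0.
- by apply: emeasurable_funM => //; apply/measurable_EFinP; exact: measurable_normal_pdf.
- by apply: emeasurable_funM => //; apply/measurable_EFinP; exact: measurable_normal_pdf.
move=> z _; rewrite -!EFinM lee_fin !normal_pdfE ?oner_neq0 ?gt_eqF//.
have ps0 : 0 < normal_peak s by rewrite normal_peak_gt0 ?gt_eqF.
have -> : K * (normal_peak s * normal_fun 0 s z) =
   normal_peak 1 * (expR (p ^+ 2) * normal_fun 0 s z).
  by rewrite /K; field; rewrite gt_eqF.
rewrite mulrCA ler_wpM2l ?normal_peak_ge0// /normal_fun !subr0 -expRD.
have h1 : `|z| `^ p <= expR (p * `|z|).
  rewrite /powR; case: ifPn => [/eqP ->|z0].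
    rewrite mulr0 expR0; by case: (p == 0).
  rewrite ler_expR ler_wpM2l// ltW// ln_sublinear//.
  by rewrite lt_neqAle eq_sym z0 normr_ge0.
apply: le_trans (ler_wpM2r (expR_ge0 _) h1) _.
rewrite -expRD ler_expR sqr_sqrtr// expr1n.
have := sqr_ge0 (`|z| / 2 - p).
rewrite sqrrB expr_div_n real_normK ?num_real// -[_ *+ 2]mulr_natr.
rewrite -[1 *+ 2]/2; lra.
Qed.


Lemma gaussE (c s : R) A : gauss c s A = normal_prob c s A.
Proof. by []. Qed.

Lemma gauss_affine (c s : R) (f : R -> \bar R) : 0 < s ->
  (forall u, (0 <= f u)%E) -> measurable_fun setT f ->
  (\int[gauss c s]_u f u = \int[gauss 0 1]_z f (c + s * z)%R)%E.
Proof.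
move=> s0 f0 mf.
apply/esym.
apply: (@ge0_integral_law _ _ (gauss 0 1) (fun z => c + s * z) (gauss c s)).
- by apply: measurable_funD => //; exact: measurable_funM.
- by move=> A mA; exact: normal_prob_affine.
- exact: f0.
- exact: mf.
Qed.

Lemma gauss_integral_measurable (b : R) (f : R -> R) : 0 < b ->
  (forall u, 0 <= f u) -> measurable_fun setT f ->
  measurable_fun setT (fun c => \int[gauss c b]_u (f u)%:E)%E.
Proof.
move=> b0 f0 mf; rewrite (_ : (fun c => _) = fun v =>
    \int[lebesgue_measure]_u (f u * normal_pdf (1 * v) b u)%:E)%E; last first.
  apply/funext => c; have b0' : b != 0 by rewrite gt_eqF.
  have f0E u : (0 <= (f u)%:E)%E by rewrite lee_fin.
  have mfE : measurable_fun setT (fun u => (f u)%:E) by exact/measurable_EFinP.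
  apply: (etrans (ge0_integral_normal c b0' f0E mfE)).
  by apply: eq_integral => u _; rewrite mul1r EFinM.
apply: (@measurable_fun_fubini_tonelli_F _ _ _ _ _ lebesgue_measure
  (fun zu : R * R => (f zu.2 * normal_pdf (1 * zu.1) b zu.2)%:E)).
  by apply/measurable_EFinP; exact: measurable_normal_kernel.
by move=> zu; rewrite lee_fin mulr_ge0 ?normal_pdf_ge0.
Qed.

End gaussian_facts.

Opaque gauss.

(** * Independence *)

Section joint_law.
Context d (T : measurableType d) (R : realType) (P : probability T R).

(** The joint law of two independent variables is the product of their laws, so
    Tonelli's theorem applies to it. *)
Lemma ge0_integral_indep (X Y : T -> R) (Q : probability (measurableTypeR R) R) :
  measurable_fun setT X -> measurable_fun setT Y ->
  (forall A, measurable A -> Q A = P (X @^-1` A)) ->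
  (forall A B, measurable A -> measurable B ->
    P (X @^-1` A `&` Y @^-1` B) = (P (X @^-1` A) * P (Y @^-1` B))%E) ->
  forall f : R * R -> \bar R, (forall x, (0 <= f x)%E) -> measurable_fun setT f ->
  (\int[P]_w f (X w, Y w) = \int[Q]_x \int[P]_w f (x, Y w))%E.
Proof.
move=> mX mY QE XY f f0 mf.
have [QY QYE] := law_exists P mY.
pose M := measurableTypeR R.
have mXY : @measurable_fun _ _ T (M * M)%type setT (fun w => (X w, Y w)).
  by apply/measurable_fun_pairP; split; [exact: mX|exact: mY].
have mf' : @measurable_fun _ _ (M * M)%type (\bar R) setT f by exact: mf.
rewrite -[LHS](@ge0_integral_pushforward _ _ T (M * M)%type R _ mXY P setT f)//.
pose J : probability (M * M)%type R :=
  distribution P (@mfun_Sub _ _ T (M * M)%type _ (mem_set mXY)).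
transitivity (\int[(Q \x QY)%E]_x f x)%E.
  apply: (@eq_measure_integral _ (M * M)%type R setT _ _ f) => A mA _.
  apply/esym; apply: (@product_measure_unique _ _ M M R Q QY J) => // A1 A2 mA1 mA2.
  transitivity (P (X @^-1` A1 `&` Y @^-1` A2)); first by [].
  by rewrite XY// -QE// -QYE.
rewrite (@fubini_tonelli1 _ _ M M R Q QY f mf' f0); apply: eq_integral => x _.
apply/esym; apply: (@ge0_integral_law _ _ T P Y QY mY _ (fun y => f (x, y))) => //.
exact: measurableT_comp mf (measurable_pair1 _).
Qed.

End joint_law.

Section mutual_independence.
Context d (T : measurableType d) (R : realType) (P : probability T R).
Context (I : choiceType) (xi : I -> T -> R).
Hypothesis mxi : forall i, measurable_fun setT (xi i).

(** A pi-system that generates the sigma-algebra of the [xi i] with [i] in [K]. *)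
Definition cylinders (K : set I) : set (set T) :=
  [set E | exists (s : seq I) (A : I -> set R),
    [/\ uniq s, forall i, i \in s -> K i, forall i, measurable (A i) &
      E = \bigcap_(i in [set` s]) xi i @^-1` A i]].

Definition adapted (K : set I) (U : T -> R) :=
  @measurable_fun _ _ (g_sigma_algebraType (cylinders K)) R setT U.

Lemma cylinders_measurable K : cylinders K `<=` measurable.
Proof.
move=> _ [s [A [us sK mA ->]]]; rewrite bigcap_seq.
apply: bigsetI_measurable => i _; rewrite -[X in measurable X]setTI; exact: mxi.
Qed.

Lemma cylinders_setI K : setI_closed (cylinders K).
Proof.
move=> _ _ [s [A [us sK mA ->]]] [t [B [ut tK mB ->]]].
exists (undup (s ++ t)), (fun i => (if i \in s then A i else setT) `&`
  (if i \in t then B i else setT)); split.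
- exact: undup_uniq.
- by move=> i; rewrite mem_undup mem_cat => /orP[/sK|/tK].
- by move=> i; apply: measurableI; case: ifP.
- apply/seteqP; split => [w [wA wB] i /= _|w h].
    by split; case: ifPn => // iS; [exact: wA|exact: wB].
  split => i /= iS.
    by have := h i; rewrite /= mem_undup mem_cat iS => /(_ isT) [].
  by have := h i; rewrite /= mem_undup mem_cat iS orbT => /(_ isT) [].
Qed.

Lemma adapted_measurable K U : adapted K U -> measurable_fun setT U.
Proof.
move=> aU _ B mB; have := aU measurableT B mB.
apply: smallest_sub; first exact: sigma_algebra_measurable.
exact: cylinders_measurable.
Qed.

Lemma adapted_sub K K' U : K `<=` K' -> adapted K U -> adapted K' U.
Proof.
move=> KK' aU _ B mB; have := aU measurableT B mB.
apply: smallest_sub; first exact: smallest_sigma_algebra.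
move=> _ [s [A [us sK mA ->]]]; apply: sub_sigma_algebra.
by exists s, A; split => // i /sK /KK'.
Qed.

Lemma adapted_xi (K : set I) i : K i -> adapted K (xi i).
Proof.
move=> Ki _ B mB; rewrite setTI; apply: sub_sigma_algebra.
exists [:: i], (fun=> B); split => //.
- by move=> j; rewrite inE => /eqP ->.
- by rewrite set_cons1 bigcap_set1.
Qed.

Hypothesis xi_indep : forall (s : seq I) (A : I -> set R), uniq s ->
  (forall i, measurable (A i)) ->
  fine (P (\bigcap_(i in [set` s]) xi i @^-1` A i)) =
  \prod_(i <- s) fine (P (xi i @^-1` A i)).

(** As functions of the second event, both sides are finite measures; they agree
    on the cylinders by mutual independence, hence on the sigma-algebra that the
    cylinders generate. *)
Lemma indep_adapted (K : set I) j U : ~ K j -> adapted K U ->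
  forall A B, measurable A -> measurable B ->
  P (xi j @^-1` A `&` U @^-1` B) = (P (xi j @^-1` A) * P (U @^-1` B))%E.
Proof.
move=> Kj aU A B mA mB.
have mAj : measurable (xi j @^-1` A).
  by rewrite -[X in measurable X]setTI; exact: mxi.
have c0 : (0 <= fine (P (xi j @^-1` A)))%R by rewrite fine_ge0.
pose m1 := mrestr P mAj.
pose m2 := mscale (NngNum c0) P.
rewrite setIC -[LHS]/(m1 (U @^-1` B)).
have -> : (P (xi j @^-1` A) * P (U @^-1` B))%E = m2 (U @^-1` B).
  by rewrite /m2 /mscale/= fineK// fin_num_measure.
have gU : <<s cylinders K >> (U @^-1` B).
  by have := aU measurableT B mB; rewrite setTI.
apply: (@g_sigma_algebra_measure_unique _ R T (cylinders K)
   (@cylinders_measurable K) (fun=> setT) _ _ m1 m2 (@cylinders_setI K)) gU.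
- move=> _; exists [::], (fun=> setT); split => //.
  by rewrite set_nil bigcap_set0.
- by rewrite bigcup_const//; exists 0%N.
- move=> _ [s [C [us sK mC ->]]].
  suff : P (\bigcap_(i in [set` s]) xi i @^-1` C i `&` xi j @^-1` A) =
    ((fine (P (xi j @^-1` A)))%:E * P (\bigcap_(i in [set` s]) xi i @^-1` C i))%E by [].
  have js : j \notin s by apply/negP => /sK.
  have mE : measurable (\bigcap_(i in [set` s]) xi i @^-1` C i).
    by apply: (@cylinders_measurable K); exists s, C.
  have fI := fin_num_measure P _ (measurableI _ _ mE mAj).
  have f2 := fin_num_measure P _ mE.
  rewrite -(fineK fI) -(fineK f2) -EFinM; congr EFin.
  rewrite xi_indep//.
  have := @xi_indep (j :: s) (fun i => if i == j then A else C i).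
  rewrite /= js us => /(_ isT); rewrite big_cons eqxx => h.
  have -> : \prod_(i <- s) fine (P (xi i @^-1` C i)) =
    \prod_(i <- s) fine (P (xi i @^-1` (if i == j then A else C i))).
    by apply: eq_big_seq => i iS; case: eqVneq => // ij; rewrite -ij iS in js.
  rewrite -h; last by move=> i; case: ifP.
  congr (fine (P _)); apply/seteqP; split => [w [h1 h2] i /=|w h1].
    rewrite inE; case: eqVneq => [-> _//|_ /= iS]; exact: h1.
  split => [i /= iS|].
    have := h1 i; rewrite /= inE iS orbT => /(_ isT).
    by case: eqVneq => // ij; rewrite -ij iS in js.
  by have := h1 j; rewrite /= inE eqxx => /(_ isT).
- move=> k; suff : (P (setT `&` xi j @^-1` A) < +oo)%E by [].
  by rewrite setTI (le_lt_trans (probability_le1 _ _))// ltry.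
Qed.

End mutual_independence.

(** * Moments of a Gaussian multiplier *)

Lemma Rintegral_gt0 d (T : measurableType d) (R : realType)
    (mu : {measure set T -> \bar R}) (f : T -> R) (A : set T) :
  (forall x, 0 <= f x) -> mu.-integrable setT (EFin \o f) ->
  measurable A -> (0 < mu A)%E -> (forall x, A x -> 0 < f x) ->
  0 < \int[mu]_x f x.
Proof.
move=> f0 intf mA A0 fA; rewrite lt_neqAle eq_sym Rintegral_ge0// andbT.
apply/eqP => If0.
have mf : measurable_fun setT (EFin \o f) by exact: measurable_int intf.
have : (\int[mu]_x `|(EFin \o f) x| = 0)%E.
  under eq_integral do rewrite /= ger0_norm//.
  have fi := integrable_fin_num measurableT intf.
  by rewrite -(fineK fi) -[fine _]/(\int[mu]_x f x) If0.
move=> /(ae_eq_integral_abs mu measurableT mf) [N [mN N0 fN]].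
have : (mu A <= mu N)%E.
  apply: le_measure; rewrite ?inE//.
  move=> x Ax; apply: fN => /= /(_ I) [fx0].
  by have := fA _ Ax; rewrite fx0 ltxx.
by rewrite N0 leNgt A0.
Qed.

Lemma Rintegral_prob_cst d (T : measurableType d) (R : realType)
  (P : probability T R) (c : R) : \int[P]_z c = c.
Proof.
by rewrite Rintegral_cst// [X in fine X](_ : _ = 1%E) ?mulr1//; exact: probability_setT.
Qed.

Section gaussian_multiplier.
Context {R : realType}.
Local Notation nu := (gauss (0 : R) 1).
Local Notation integ f := (nu.-integrable setT (EFin \o f)).
Variables (a al : R).
Hypothesis al_gt0 : 0 < al.
Hypothesis a_moment : (\int[nu]_z (`|a * z| `^ al)%:E = 1)%E.

Lemma multiplier_neq0 : a != 0.
Proof.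
apply/eqP => a0; move: a_moment; rewrite a0.
under eq_integral do rewrite mul0r normr0 powR0 ?gt_eqF//.
rewrite integral0 => /eqP; by rewrite eqe eq_sym oner_eq0.
Qed.

Lemma measurable_multiplier : measurable_fun setT (fun z : R => `|a * z|).
Proof. by apply: measurableT_comp => //; exact: measurable_funM. Qed.

Lemma measurable_multiplier_powR (p : R) :
  measurable_fun setT (fun z : R => `|a * z| `^ p).
Proof. exact: (measurableT_comp (measurable_powR p) measurable_multiplier). Qed.

Lemma integrable_multiplier_powR (p : R) : 0 <= p -> integ (fun z => `|a * z| `^ p).
Proof.
move=> p0; apply/integrableP; split.
  by apply/measurable_EFinP; exact: measurable_multiplier_powR.
under eq_integral => z _ do rewrite /= ger0_norm ?powR_ge0// normrM powRM// EFinM.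
rewrite ge0_integralZl//.
- by rewrite lte_mul_pinfty ?lee_fin ?powR_ge0// gauss_moment.
- by apply/measurable_EFinP; apply: (measurableT_comp (measurable_powR p)).
Qed.

Lemma multiplier_moment1 : \int[nu]_z (`|a * z| `^ al) = 1.
Proof. by rewrite /Rintegral a_moment. Qed.

Lemma measurable_multiplier_itv (u v : R) :
  measurable [set z : R | u <= `|a * z| <= v].
Proof.
have -> : [set z : R | u <= `|a * z| <= v] = (fun z => `|a * z|) @^-1` `[u, v]%classic.
  by apply/seteqP; split => z /=; rewrite in_itv.
by rewrite -[X in measurable X]setTI; exact: measurable_multiplier.
Qed.

Lemma multiplier_itv_gt0 (u v : R) : 0 < u -> u < v ->
  (0 < nu [set z : R | (u <= `|a * z| <= v)%R])%E.
Proof.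
move=> u0 uv; have a0 : 0 < `|a| by rewrite normr_gt0 multiplier_neq0.
apply: (@lt_le_trans _ _ (nu `[u / `|a|, v / `|a|]%classic)).
  by apply: gauss_itv_gt0; rewrite ltr_pM2r ?invr_gt0.
apply: le_measure; rewrite ?inE//; first exact: measurable_multiplier_itv.
move=> z /=; rewrite in_itv/= => /andP[h1 h2]; rewrite normrM.
have z0 : 0 <= z by apply: le_trans h1; rewrite divr_ge0// ltW.
by rewrite (ger0_norm z0) mulrC -ler_pdivrMr// h1 -ler_pdivlMr.
Qed.

(** Strict convexity of b |-> y^b on [0, al], from e^s > 1 + s applied at the two
    end points. *)
Lemma convex_powR_lt (y b : R) : 0 < y -> y != 1 -> 0 < b < al ->
  y `^ b < b / al * y `^ al + (1 - b / al).
Proof.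
move=> y0 y1 /andP[b0 bal].
pose th := b / al; pose s := al * ln y.
have th0 : 0 < th by rewrite divr_gt0.
have th1 : th < 1 by rewrite ltr_pdivrMr// mul1r.
have s0 : s != 0.
  by rewrite /s mulf_neq0//; [rewrite gt_eqF|rewrite ln_eq0].
have -> : y `^ al = expR s by rewrite /powR gt_eqF.
have -> : y `^ b = expR (th * s).
  by rewrite /powR gt_eqF// /th /s mulrA divfK// gt_eqF.
have h1 : expR (th * s) * (1 + (1 - th) * s) < expR s.
  have -> : expR s = expR (th * s) * expR ((1 - th) * s).
    by rewrite -expRD; congr expR; ring.
  by rewrite ltr_pM2l ?expR_gt0// expR_gt1Dx// mulf_neq0// gt_eqF// subr_gt0.
have h2 : expR (th * s) * (1 - th * s) < 1.
  have {2}-> : (1 : R) = expR (th * s) * expR (- (th * s)).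
    by rewrite -expRD subrr expR0.
  by rewrite ltr_pM2l ?expR_gt0// expR_gt1Dx// oppr_eq0 mulf_neq0// gt_eqF.
have := ltr_pM2l th0 (expR (th * s) * (1 + (1 - th) * s)) (expR s); rewrite h1 => h3.
have th1' : 0 < 1 - th by rewrite subr_gt0.
have := ltr_pM2l th1' (expR (th * s) * (1 - th * s)) 1; rewrite h2 => h4.
rewrite -/th; nra.
Qed.

Lemma convex_powR_le (y b : R) : 0 <= y -> 0 < b < al ->
  y `^ b <= b / al * y `^ al + (1 - b / al).
Proof.
move=> y0 /[dup] bb /andP[b0 bal].
move: y0; rewrite le_eqVlt => /orP[/eqP <-|y0].
  by rewrite !powR0 ?gt_eqF// mulr0 add0r subr_ge0 ler_pdivrMr// mul1r ltW.
have [->|y1] := eqVneq y 1; last exact/ltW/convex_powR_lt.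
by rewrite !powR1 mulr1 addrC subrK.
Qed.

(** The moment function b |-> E |a z|^b is strictly convex and equals 1 at 0 and
    at [al]. *)
Lemma multiplier_moment_lt1 (b : R) : 0 < b < al -> \int[nu]_z (`|a * z| `^ b) < 1.
Proof.
move=> /[dup] bb /andP[b0 bal].
have ib := integrable_multiplier_powR (ltW b0).
have ial := integrable_multiplier_powR (ltW al_gt0).
have ic : integ (fun z => b / al * `|a * z| `^ al + (1 - b / al)).
  apply: integD; first exact: integZl.
  exact: finite_measure_integrable_cst.
suff : 0 < \int[nu]_z (b / al * `|a * z| `^ al + (1 - b / al) - `|a * z| `^ b).
  rewrite RintegralB// RintegralD//; last 2 first.
  - exact: integZl.
  - exact: finite_measure_integrable_cst.
  rewrite RintegralZl// multiplier_moment1 Rintegral_prob_cst; lra.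
apply: (@Rintegral_gt0 _ _ _ nu _ [set z : R | 2 <= `|a * z| <= 3]).
- by move=> z; rewrite subr_ge0 convex_powR_le.
- exact: integB.
- exact: measurable_multiplier_itv.
- by apply: multiplier_itv_gt0; lra.
- move=> z /= /andP[z2 z3]; rewrite subr_gt0 convex_powR_lt//; first by lra.
  by rewrite gt_eqF//; lra.
Qed.

Lemma integrable_multiplier_ln :
  integ (fun z => `|a * z| `^ al * ln `|a * z|).
Proof.
apply: (@integrable_dom _ _ _ nu _ (fun z => al^-1 + `|a * z| `^ (al + 1))).
- apply: measurable_funM; first exact: measurable_multiplier_powR.
  exact: (measurableT_comp (@measurable_ln R) measurable_multiplier).
- apply: integD; first exact: finite_measure_integrable_cst.
  by apply: integrable_multiplier_powR; rewrite addr_ge0// ltW.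
move=> z; set y := `|a * z|.
have : 0 <= y by exact: normr_ge0.
rewrite le_eqVlt => /orP[/eqP <-|y0].
  rewrite !powR0 ?mul0r ?normr0 ?addr0 ?invr_ge0 ?(ltW al_gt0)// gt_eqF//.
  by rewrite addr_gt0.
rewrite normrM (ger0_norm (powR_ge0 _ _)).
have ya0 : 0 < y `^ al by rewrite powR_gt0.
have [y1|/ltW y1] := leP 1 y.
  rewrite ger0_norm ?ln_ge0// -[leLHS]add0r lerD ?invr_ge0 ?(ltW al_gt0)//.
  rewrite powRD; last by rewrite (gt_eqF y0) implybT.
  by rewrite powRr1 ?(ltW y0)// ler_wpM2l ?(ltW ya0)// ltW// ln_sublinear.
rewrite -[leLHS]addr0 lerD ?powR_ge0//.
rewrite ler0_norm ?ln_le0//.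
have : ln (y `^ - al) < y `^ - al by rewrite ln_sublinear// powR_gt0.
rewrite ln_powR powRN => h.
have -> : y `^ al * - ln y = al^-1 * (y `^ al * (- al * ln y)).
  by field; rewrite gt_eqF.
rewrite ler_piMr ?invr_ge0 ?(ltW al_gt0)//.
by rewrite mulrC -ler_pdivlMr// div1r ltW.
Qed.

(** The left derivative at [al] of the same moment function: al y^al ln y is at
    least y^al - 1, whose mean is 0, and the inequality is strict for y > 1. *)
Lemma multiplier_drift_gt0 : 0 < \int[nu]_z (`|a * z| `^ al * ln `|a * z|).
Proof.
have ial := integrable_multiplier_powR (ltW al_gt0).
suff : 0 < \int[nu]_z (al * (`|a * z| `^ al * ln `|a * z|) - (`|a * z| `^ al - 1)).
  rewrite RintegralB//; last 2 first.
  - exact: integZl integrable_multiplier_ln.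
  - by apply: integB => //; exact: finite_measure_integrable_cst.
  rewrite RintegralZl//; last exact: integrable_multiplier_ln.
  rewrite RintegralB//; last exact: finite_measure_integrable_cst.
  rewrite multiplier_moment1 Rintegral_prob_cst.
  by rewrite subrr subr0 pmulr_rgt0.
have key (y : R) : 0 <= y -> 0 <= al * (y `^ al * ln y) - (y `^ al - 1) /\
    (1 < y -> 0 < al * (y `^ al * ln y) - (y `^ al - 1)).
  rewrite le_eqVlt => /orP[/eqP <-|y0].
    by rewrite powR0 ?gt_eqF// mul0r mulr0; split; lra.
  have -> : al * (y `^ al * ln y) - (y `^ al - 1) =
      y `^ al * (expR (- (al * ln y)) - (1 + - (al * ln y))).
    by rewrite expRN /powR gt_eqF//; field; rewrite gt_eqF ?expR_gt0.
  split; first by rewrite mulr_ge0 ?powR_ge0// subr_ge0 expR_ge1Dx.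
  move=> y1; rewrite mulr_gt0 ?powR_gt0// subr_gt0 expR_gt1Dx//.
  by rewrite oppr_eq0 mulf_neq0 ?gt_eqF// ln_gt0.
apply: (@Rintegral_gt0 _ _ _ nu _ [set z : R | 2 <= `|a * z| <= 3]).
- by move=> z; have [] := key `|a * z| (normr_ge0 _).
- apply: integB; first exact: integZl integrable_multiplier_ln.
  by apply: integB => //; exact: finite_measure_integrable_cst.
- exact: measurable_multiplier_itv.
- by apply: multiplier_itv_gt0; lra.
- move=> z /= /andP[z2 z3]; have [_] := key `|a * z| (normr_ge0 _); apply; lra.
Qed.

End gaussian_multiplier.

(** * The stationary law of a scalar random-coefficient autoregression *)

Lemma max0_lipschitz (R : realType) (x y : R) :
  `|Num.max 0 x - Num.max 0 y| <= `|x - y|.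
Proof.
have [x0|x0] := leP 0 x; have [y0|y0] := leP 0 y => //.
- by rewrite subr0 !ger0_norm//; lra.
- rewrite sub0r normrN ger0_norm// ler0_norm; lra.
- by rewrite subrr normr0.
Qed.

Lemma Rintegral_bounded d (T : measurableType d) (R : realType)
  (P : probability T R) (f : T -> R) (M : R) :
  measurable_fun setT f -> (forall x, 0 <= f x <= M) ->
  [/\ P.-integrable setT (EFin \o f), 0 <= \int[P]_x f x <= M &
    (\int[P]_x (f x)%:E)%E = (\int[P]_x f x)%:E].
Proof.
move=> mf f01.
have intf : P.-integrable setT (EFin \o f).
  apply: (@integrable_dom _ _ _ P _ (cst M)) => //.
    exact: finite_measure_integrable_cst.
  by move=> x; have /andP[h1 h2] := f01 x; rewrite ger0_norm.
split => //; last by rewrite /Rintegral fineK//; exact: integrable_fin_num.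
apply/andP; split; first by apply: Rintegral_ge0 => x _; have /andP[] := f01 x.
rewrite -[leRHS](Rintegral_prob_cst P M); apply: le_Rintegral => //.
- exact: finite_measure_integrable_cst.
- by move=> x _; have /andP[] := f01 x.
Qed.

Lemma measurable_sd (R : realType) (a sg : R) :
  measurable_fun setT (fun s : R => Num.sqrt ((a * s) ^+ 2 + sg ^+ 2)).
Proof.
rewrite (_ : (fun s => _) =
    (fun u : R => u `^ (2^-1)) \o (fun s => (a * s) ^+ 2 + sg ^+ 2)).
  apply: measurableT_comp; first exact: measurable_powR.
  by apply: measurable_funD => //; apply: measurable_funX; exact: measurable_funM.
by apply/funext => s; rewrite /= powR12_sqrt// addr_ge0 ?sqr_ge0.
Qed.

Lemma measurable_norm_gt d (T : measurableType d) (R : realType) (U : T -> R) (c : R) :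
  measurable_fun setT U -> measurable [set w | c < `|U w|].
Proof.
move=> mU.
have -> : [set w | c < `|U w|] = (fun w => `|U w|) @^-1` `]c, +oo[%classic.
  by apply/seteqP; split => w /=; rewrite in_itv/= andbT.
by rewrite -[X in measurable X]setTI; apply: measurableT_comp.
Qed.

Lemma tight_rv d (T : measurableType d) (R : realType) (P : probability T R)
  (U : T -> R) (e : R) : measurable_fun setT U -> 0 < e ->
  exists2 M : R, 0 < M & fine (P [set w | M < `|U w|]) <= e.
Proof.
move=> mU e0.
have mset (M : R) : measurable [set w | M < `|U w|] by exact: measurable_norm_gt.
have : \int[P]_w \1_[set w | n.+1%:R < `|U w|] w @[n --> \oo] --> (0 : R).
  apply: (@Rintegral_cvg0 _ _ _ P (fun n => \1_[set w | n.+1%:R < `|U w|]) (cst 1)).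
  - by move=> n; exact: measurable_indic.
  - exact: finite_measure_integrable_cst.
  - by move=> n w; rewrite indicE; case: (_ \in _); rewrite /= ?normr1 ?normr0.
  - move=> w; apply: cvg_near_cst.
    have := nbhs_infty_ger `|U w|; apply: filterS => n h.
    rewrite indicE memNset//=; apply/negP; rewrite -leNgt (le_trans h)//.
    by rewrite ler_nat.
move=> /cvgrPdist_le/(_ e e0)[n _ /(_ n (leqnn n))] /=.
have -> : \int[P]_w \1_[set w | n.+1%:R < `|U w|] w =
    fine (P [set w | n.+1%:R < `|U w|]).
  by rewrite /Rintegral integral_indic ?setIT.
rewrite sub0r normrN ger0_norm ?fine_ge0// => h.
by exists n.+1%:R.
Qed.

Section recursion.
Context d (T : measurableType d) (R : realType) (P : probability T R).
Local Notation nu := (gauss (0 : R) 1).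
Variables (m N W : int -> T -> R) (a sg : R).
(** The two noises are indexed by one set, so that their joint independence is a
    single statement. *)
Definition noise (p : int * bool) := if p.2 then m p.1 else N p.1.
Hypothesis sg_gt0 : 0 < sg.
Hypothesis mm : forall t, measurable_fun setT (m t).
Hypothesis mN : forall t, measurable_fun setT (N t).
Hypothesis mW : forall t, measurable_fun setT (W t).
Hypothesis noise_indep : forall (s : seq (int * bool)) (A : int * bool -> set R),
  uniq s -> (forall i, measurable (A i)) ->
  fine (P (\bigcap_(i in [set` s]) noise i @^-1` A i)) =
  \prod_(i <- s) fine (P (noise i @^-1` A i)).
Hypothesis m_law : forall t A, measurable A -> P (m t @^-1` A) = nu A.
Hypothesis N_law : forall t A, measurable A -> P (N t @^-1` A) = gauss 0 sg A.
Hypothesis W_eq : forall t, {ae P, forall w, W t w = a * m t w * W (t - 1) w + N t w}.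
Hypothesis W_st : forall s t A, measurable A -> P (W s @^-1` A) = P (W t @^-1` A).

Let past (t : int) : set (int * bool) := [set p | (p.1 <= t)%R].

Let mnoise p : measurable_fun setT (noise p).
Proof. by rewrite /noise; case: p.2. Qed.

(** Iterating the recursion n times from time [t] gives
    W t = partial_sol n t + partial_coef n t * W (t - n), where both coefficients
    are functions of the noise up to time [t].  A stationary solution need not
    itself be such a function, which is why the partial solutions are needed. *)
Fixpoint partial_sol n t w : R :=
  if n is k.+1 then a * m t w * partial_sol k (t - 1) w + N t w else 0.

Fixpoint partial_coef n t w : R :=
  if n is k.+1 then a * m t w * partial_coef k (t - 1) w else 1.

Let m_adapted t : adapted noise (past t) (m t).
Proof. exact: (@adapted_xi _ _ _ _ noise (past t) (t, true)) (lexx t). Qed.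

Let N_adapted t : adapted noise (past t) (N t).
Proof. exact: (@adapted_xi _ _ _ _ noise (past t) (t, false)) (lexx t). Qed.

Let past_sub t : past (t - 1) `<=` past t.
Proof. by move=> p /le_trans; apply; rewrite lerBlDr lerDl. Qed.

Let adaptedM K U V : adapted noise K U -> adapted noise K V ->
  adapted noise K (fun w => U w * V w).
Proof. exact: measurable_funM. Qed.

Let adaptedD K U V : adapted noise K U -> adapted noise K V ->
  adapted noise K (fun w => U w + V w).
Proof. exact: measurable_funD. Qed.

Let adapted_cst K c : adapted noise K (fun=> c).
Proof. exact: measurable_cst. Qed.

Lemma partial_sol_adapted n t : adapted noise (past t) (partial_sol n t).
Proof.
elim: n t => [|n IH] t; first exact: adapted_cst.
apply: adaptedD; last exact: N_adapted.
apply: adaptedM; first by apply: adaptedM; [exact: adapted_cst|exact: m_adapted].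
exact: adapted_sub (@past_sub t) (IH (t - 1)).
Qed.

Lemma partial_coef_adapted n t : adapted noise (past t) (partial_coef n t).
Proof.
elim: n t => [|n IH] t; first exact: adapted_cst.
apply: adaptedM; first by apply: adaptedM; [exact: adapted_cst|exact: m_adapted].
exact: adapted_sub (@past_sub t) (IH (t - 1)).
Qed.

Let m_indep t U : adapted noise (past (t - 1)) U ->
  forall A B, measurable A -> measurable B ->
  P (m t @^-1` A `&` U @^-1` B) = (P (m t @^-1` A) * P (U @^-1` B))%E.
Proof.
move=> aU; apply: (@indep_adapted _ _ _ P _ noise mnoise noise_indep (past (t - 1)) (t, true)) => //=.
by apply/negP; rewrite -ltNge ltrBlDr ltrDl.
Qed.

Let N_indep t U : adapted noise (past (t - 1)) U ->
  forall A B, measurable A -> measurable B ->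
  P (N t @^-1` A `&` (fun w => a * m t w * U w) @^-1` B) =
  (P (N t @^-1` A) * P ((fun w => a * m t w * U w)%R @^-1` B))%E.
Proof.
move=> aU.
pose K := past (t - 1) `|` [set (t, true)].
have aV : adapted noise K (fun w => a * m t w * U w).
  apply: adaptedM; last by apply: (adapted_sub _ aU) => p; left.
  apply: adaptedM; first exact: adapted_cst.
  by apply: (@adapted_xi _ _ _ _ noise K (t, true)); right.
apply: (@indep_adapted _ _ _ P _ noise mnoise noise_indep K (t, false)) => //=.
move=> [/=|//]; by apply/negP; rewrite -ltNge ltrBlDr ltrDl.
Qed.

Lemma partial_coef_moment (b : R) n t : 0 <= b ->
  (\int[P]_w (`|partial_coef n t w| `^ b)%:E =
   ((\int[nu]_z (`|a * z| `^ b)) ^+ n)%:E)%E.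
Proof.
move=> b0; have ib := integrable_multiplier_powR a b0.
have Eb : (\int[nu]_z (`|a * z| `^ b)%:E)%E = (\int[nu]_z (`|a * z| `^ b))%:E.
  by rewrite /Rintegral fineK//; exact: integrable_fin_num.
have mabs (V : T -> R) : measurable_fun setT V ->
    measurable_fun setT (fun w => (`|V w| `^ b)%:E).
  move=> mV; apply/measurable_EFinP.
  by apply: (measurableT_comp (measurable_powR b)); exact: measurableT_comp.
elim: n t => [|n IH] t.
  rewrite /= normr1 powR1 integral_cst//= mul1e expr0; exact: probability_setT.
have mU := adapted_measurable mnoise (@partial_coef_adapted n (t - 1)).
rewrite /= (@ge0_integral_indep _ _ _ P (m t) (partial_coef n (t - 1)) nu _ _ _ _
  (fun zu => (`|a * zu.1 * zu.2| `^ b)%:E))//; last 3 first.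
- by move=> A mA; rewrite m_law.
- apply: m_indep; exact: partial_coef_adapted.
- apply/measurable_EFinP; apply: (measurableT_comp (measurable_powR b)).
  apply: measurableT_comp => //; apply: measurable_funM => //.
  exact: measurable_funM.
under eq_integral => z _.
  under eq_integral => w _ do rewrite /= normrM powRM// EFinM.
  rewrite ge0_integralZl//; last exact: mabs.
  rewrite IH; over.
rewrite ge0_integralZr//.
- by rewrite Eb -EFinM exprS.
- by apply/measurable_EFinP; exact: measurable_multiplier_powR.
- by rewrite lee_fin exprn_ge0// Rintegral_ge0// => z _; exact: powR_ge0.
Qed.

Let B (s : R) := Num.sqrt ((a * s) ^+ 2 + sg ^+ 2).

(** Conditionally on the past, a m U + N is a centred normal variable with
    standard deviation [B U], since m and N are independent of the past and of
    each other. *)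
Lemma step_law (f : R -> R) t U : (forall u, 0 <= f u) -> measurable_fun setT f ->
  adapted noise (past (t - 1)) U ->
  (\int[P]_w (f (a * m t w * U w + N t w))%:E =
   \int[P]_w \int[nu]_z (f (B (U w) * z))%:E)%E.
Proof.
move=> f0 mf aU.
have mU := adapted_measurable mnoise aU.
have mfE : measurable_fun setT (fun u => (f u)%:E) by exact/measurable_EFinP.
have f0E u : (0 <= (f u)%:E)%E by rewrite lee_fin.
pose V w := a * m t w * U w.
have mV : measurable_fun setT V.
  by apply: measurable_funM => //; apply: measurable_funM.
pose g v := (\int[gauss v sg]_u (f u)%:E)%E.
have mg : measurable_fun setT g by exact: gauss_integral_measurable.
have g0 v : (0 <= g v)%E by exact: integral_ge0.
transitivity (\int[gauss 0 sg]_x \int[P]_w (f (V w + x))%:E)%E.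
  apply: (@ge0_integral_indep _ _ _ P (N t) V (gauss 0 sg) _ _ _ _
    (fun xv => (f (xv.2 + xv.1))%:E)) => //.
  - by move=> A mA; rewrite N_law.
  - exact: N_indep.
  - apply/measurable_EFinP; apply: measurableT_comp => //.
    exact: measurable_funD.
transitivity (\int[P]_w g (V w))%E.
  transitivity (\int[P]_w \int[gauss 0 sg]_x (f (V w + x))%:E)%E.
    apply: (@fubini_tonelli _ _ _ _ _ (gauss 0 sg) P
      (fun xw => (f (V xw.2 + xw.1))%:E)).
      apply/measurable_EFinP; apply: measurableT_comp; first exact: mf.
      by apply: measurable_funD => //; exact: measurableT_comp.
    by move=> xw; exact: f0E.
  apply: eq_integral => w _; rewrite /g (gauss_affine (V w) sg_gt0 f0E mfE).
  rewrite (@gauss_affine _ 0 sg (fun x => (f (V w + x))%:E) sg_gt0).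
  - by apply: eq_integral => z _; rewrite add0r.
  - by move=> u; exact: f0E.
  - apply/measurable_EFinP; apply: measurableT_comp; first exact: mf.
    exact: measurable_funD.
transitivity (\int[nu]_z \int[P]_w g (a * z * U w)%R)%E.
  apply: (@ge0_integral_indep _ _ _ P (m t) U nu _ _ _ _ (fun zu => g (a * zu.1 * zu.2))).
  - exact: mm.
  - exact: mU.
  - by move=> A mA; rewrite m_law.
  - exact: m_indep.
  - by move=> zu; exact: g0.
  - apply: measurableT_comp; first exact: mg.
    apply: measurable_funM; last exact: measurable_snd.
    by apply: measurable_funM.
transitivity (\int[P]_w \int[nu]_z g (a * z * U w)%R)%E.
  apply: (@fubini_tonelli _ _ _ _ _ nu P (fun zw => g (a * zw.1 * U zw.2))).
    apply: measurableT_comp; first exact: mg.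
    apply: measurable_funM; last exact: measurableT_comp.
    exact: measurable_funM.
  by move=> zw; exact: g0.
apply: eq_integral => w _.
transitivity (\int[nu]_z g (a * U w * z)%R)%E.
  by apply: eq_integral => z _; rewrite mulrAC.
have Bw0 : 0 < B (U w) by rewrite sqrtr_gt0 ltr_wpDl ?sqr_ge0 ?exprn_gt0.
rewrite /g (gauss_mixture (a * U w) sg_gt0 f0 mf) -/(B (U w)).
rewrite (gauss_affine 0 Bw0 f0E mfE).
by apply: eq_integral => z _; rewrite add0r.
Qed.

Hypothesis contraction : exists2 b : R, 0 < b & \int[nu]_z (`|a * z| `^ b) < 1.

Let W_partial n t :
  {ae P, forall w, W t w - partial_sol n t w = partial_coef n t w * W (t - n%:Z) w}.
Proof.
elim: n t => [|n IH] t.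
  by apply: aeW => w /=; rewrite !subr0 mul1r.
apply: filterS2 (W_eq t) (IH (t - 1)) => w h1 h2.
have -> : t - n.+1%:Z = t - 1 - n%:Z by rewrite -addn1 PoszD; ring.
by rewrite /= -[RHS]mulrA -h2 {1}h1; ring.
Qed.

Lemma tight (e : R) : 0 < e -> exists2 M : R, 0 < M &
  forall t, fine (P [set w | M < `|W t w|]) <= e.
Proof.
move=> e0; have [M M0 HM] := tight_rv P (mW 0) e0; exists M => // t.
apply: le_trans HM; rewrite le_eqVlt; apply/orP; left; apply/eqP; congr fine.
exact: (W_st t 0 (measurable_norm_gt M (@measurable_id _ _ setT))).
Qed.

Let mpc n t : measurable_fun setT (partial_coef n t).
Proof. exact: (adapted_measurable mnoise (@partial_coef_adapted n t)). Qed.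

Let mps n t : measurable_fun setT (partial_sol n t).
Proof. exact: (adapted_measurable mnoise (@partial_sol_adapted n t)). Qed.

(** Markov's inequality for the moment of order b, which decays geometrically. *)
Lemma partial_coef_small (c e : R) t : 0 < c -> 0 < e ->
  \forall n \near \oo, fine (P [set w | c < `|partial_coef n t w|]) <= e.
Proof.
move=> c0 e0; have [b b0] := contraction; set k := \int[nu]_z _ => k1.
have k0 : 0 <= k by apply: Rintegral_ge0 => z _; exact: powR_ge0.
have cb0 : 0 < c `^ b by rewrite powR_gt0.
have : k ^+ n @[n --> \oo] --> (0 : R) by apply: cvg_expr; rewrite ger0_norm.
move=> /cvgrPdist_le/(_ _ (mulr_gt0 e0 cb0)); apply: filterS => n.
rewrite sub0r normrN ger0_norm ?exprn_ge0// => h.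
pose A := [set w | c < `|partial_coef n t w|].
have mA : measurable A by exact: measurable_norm_gt.
rewrite -(ler_pM2r cb0); apply: le_trans h.
rewrite -lee_fin -(partial_coef_moment n t (ltW b0)).
apply: (@le_trans _ _ (\int[P]_w (c `^ b * \1_A w)%:E)%E).
  under eq_integral do rewrite EFinM.
  rewrite ge0_integralZl//; last 2 first.
  - by apply/measurable_EFinP; exact: measurable_indic.
  - by rewrite lee_fin ltW.
  by rewrite integral_indic// setIT EFinM fineK ?fin_num_measure// muleC.
apply: ge0_le_integral => //.
- by move=> w _; rewrite lee_fin mulr_ge0// ltW.
- apply/measurable_EFinP; apply: measurable_funM => //; exact: measurable_indic.
- apply/measurable_EFinP.
  by apply: (measurableT_comp (measurable_powR b)); exact: measurableT_comp.
- move=> w _; rewrite lee_fin indicE; case: (boolP (w \in A)) => /=.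
    rewrite inE => /= /ltW h; rewrite mulr1; apply: ge0_ler_powR; rewrite ?nnegrE ?(ltW b0) ?(ltW c0)//.
  by rewrite mulr0 powR_ge0.
Qed.

(** The difference is a coefficient tending to 0 in probability times a variable
    whose law does not depend on [n]. *)
Lemma partial_sol_cvg (c e : R) t : 0 < c -> 0 < e ->
  \forall n \near \oo, fine (P [set w | c < `|W t w - partial_sol n t w|]) <= e.
Proof.
move=> c0 e0; have e20 : 0 < e / 2 by rewrite divr_gt0.
have [M M0 HM] := tight e20.
apply: filterS (partial_coef_small t (divr_gt0 c0 M0) e20) => n h.
pose A := [set w | c / M < `|partial_coef n t w|].
pose D := [set w | M < `|W (t - n%:Z) w|].
have mA : measurable A by exact: measurable_norm_gt.
have mD : measurable D by exact: measurable_norm_gt.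
apply: (@le_trans _ _ (fine (P A + P D))); last first.
  rewrite fineD ?fin_num_measure//; have := HM (t - n%:Z); rewrite -/D.
  by move=> h2; rewrite (splitr e) lerD.
have mdl : measurable [set w | c < `|W t w - partial_sol n t w|].
  by apply: measurable_norm_gt; exact: measurable_funB.
rewrite fine_le ?fin_numD ?fin_num_measure//.
apply: (le_trans _ (measureU2 P mA mD)).
have [N0 [mN0 PN0 sN0]] := W_partial n t.
apply: (@le_trans _ _ (P ((A `|` D) `|` N0))).
  apply: le_measure; rewrite ?inE//.
    by apply: measurableU => //; exact: measurableU.
  move=> w /= cw.
  have [h1|h1] := pselect (W t w - partial_sol n t w = partial_coef n t w * W (t - n%:Z) w);
    last by right; apply: sN0 => /=.
  left; rewrite /A /D /=.
  have [|p1] := ltP (c / M) `|partial_coef n t w|; first by left.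
  right; rewrite ltNge; apply/negP => p2.
  move: cw; rewrite h1 normrM ltNge => /negP; apply.
  by rewrite -(divfK (lt0r_neq0 M0) c) ler_pM.
by rewrite measureU0//; exact: measurableU.
Qed.

Lemma lipschitz_cvg (f : R -> R) (L : R) t : measurable_fun setT f ->
  (forall u, 0 <= f u <= 1) -> (forall u v, `|f u - f v| <= L * `|u - v|) ->
  \int[P]_w f (partial_sol n t w) @[n --> \oo] --> \int[P]_w f (W t w).
Proof.
move=> mf f01 fL; apply/cvgrPdist_le => e e0.
have L0 : 0 <= L.
  by have := fL 1 0; rewrite subr0 normr1 mulr1; apply: le_trans.
have e20 : 0 < e / 2 by rewrite divr_gt0.
have c0 : 0 < e / 2 / (L + 1) by rewrite divr_gt0// ltr_wpDl.
apply: filterS (partial_sol_cvg t c0 e20) => n h.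
set c := e / 2 / (L + 1) in h c0.
pose A := [set w | c < `|W t w - partial_sol n t w|].
have mA : measurable A by apply: measurable_norm_gt; exact: measurable_funB.
have mfW : measurable_fun setT (fun w => f (W t w)) by exact: measurableT_comp.
have mfS : measurable_fun setT (fun w => f (partial_sol n t w)) by exact: measurableT_comp.
have [iW _ _] := Rintegral_bounded P mfW (fun w => f01 _).
have [iS _ _] := Rintegral_bounded P mfS (fun w => f01 _).
have iA : P.-integrable setT (EFin \o (fun w => \1_A w : R)).
  by apply: integrable_indic => //; rewrite setIT; exact: fin_num_fun_lty.
rewrite -RintegralB//; apply: le_trans (le_normr_Rintegral _ _) _ => //.
  exact: integB.
apply: (@le_trans _ _ (\int[P]_w (\1_A w + L * c))).
  apply: le_Rintegral => //.
  - by apply: integrable_norm => //; exact: integB.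
  - by apply: integD => //; exact: finite_measure_integrable_cst.
  move=> w _; rewrite indicE; case: (boolP (w \in A)) => /= [_|].
    have /andP[h1 h2] := f01 (W t w); have /andP[h3 h4] := f01 (partial_sol n t w).
    apply: (@le_trans _ _ 1); first by rewrite ler_norml; apply/andP; split; lra.
    by rewrite lerDl mulr_ge0// ltW.
  move=> /negP wA; rewrite add0r; apply: le_trans (fL _ _) _; rewrite ler_wpM2l//.
  by rewrite leNgt; apply/negP => cw; apply: wA; rewrite inE.
rewrite RintegralD//; last exact: finite_measure_integrable_cst.
rewrite Rintegral_prob_cst /Rintegral integral_indic// setIT (splitr e) lerD//.
rewrite /c mulrA ler_pdivrMr ?ltr_wpDl// mulrC ler_pM2l//; lra.
Qed.

Lemma sd_lipschitz (s s' : R) : `|B s - B s'| <= `|a| * `|s - s'|.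
Proof.
have Bpos u : 0 < B u by rewrite sqrtr_gt0 ltr_wpDl ?sqr_ge0 ?exprn_gt0.
have B2 u : B u ^+ 2 = (a * u) ^+ 2 + sg ^+ 2.
  by rewrite sqr_sqrtr// addr_ge0 ?sqr_ge0.
have Bge u : `|a * u| <= B u.
  rewrite -(@ler_pXn2r _ 2) ?nnegrE ?(ltW (Bpos _))// B2 real_normK ?num_real//.
  by rewrite lerDl sqr_ge0.
have BB : 0 < B s + B s' by rewrite addr_gt0.
rewrite -normrM -(ler_pM2r BB) -{1}(gtr0_norm BB) -normrM.
have -> : (B s - B s') * (B s + B s') = (a * (s - s')) * (a * s + a * s').
  have -> : (B s - B s') * (B s + B s') = B s ^+ 2 - B s' ^+ 2 by ring.
  by rewrite !B2; ring.
rewrite [leLHS]normrM ler_wpM2l//; apply: le_trans (ler_normD _ _) _.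
exact: lerD.
Qed.

Let mB : measurable_fun setT B.
Proof. exact: measurable_sd. Qed.

(** [step_law] holds along the partial solutions and passes to the limit in
    probability on both sides, because averaging a bounded Lipschitz function
    over the normal law keeps it bounded and Lipschitz in the scale [B]. *)
Lemma lipschitz_fixed_point (f : R -> R) (L : R) t : measurable_fun setT f ->
  (forall u, 0 <= f u <= 1) -> (forall u v, `|f u - f v| <= L * `|u - v|) ->
  (\int[P]_w (f (W t w))%:E = \int[P]_w \int[nu]_z (f (B (W t w) * z))%:E)%E.
Proof.
move=> mf f01 fL.
have L0 : 0 <= L.
  by have := fL 1 0; rewrite subr0 normr1 mulr1; apply: le_trans.
have f0 u : 0 <= f u by have /andP[] := f01 u.
pose h (s : R) := \int[nu]_z f (B s * z).
have mfB s : measurable_fun setT (fun z : R => f (B s * z)).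
  by apply: measurableT_comp => //; exact: measurable_funM.
have h01 s : 0 <= h s <= 1.
  by have [] := Rintegral_bounded nu (mfB s) (fun z => f01 _).
have hE s : (\int[nu]_z (f (B s * z))%:E)%E = (h s)%:E.
  by have [] := Rintegral_bounded nu (mfB s) (fun z => f01 _).
have mh : measurable_fun setT h.
  apply/measurable_EFinP.
  rewrite [X in measurable_fun _ X](_ : _ =
    fun s => (\int[nu]_z (f (B s * z))%:E)%E); last first.
    by apply/funext => s; rewrite hE.
  apply: (@measurable_fun_fubini_tonelli_F _ _ _ _ _ nu
    (fun sz : R * R => (f (B sz.1 * sz.2))%:E)) => //; last first.
    by move=> sz; rewrite lee_fin.
  apply/measurable_EFinP; apply: measurableT_comp => //.
  by apply: measurable_funM => //; exact: measurableT_comp.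
pose c1 := \int[nu]_z `|z|.
have iz : nu.-integrable setT (EFin \o (fun z : R => `|z|)).
  rewrite (_ : (fun z : R => `|z|) = (fun z => `|1 * z| `^ 1)).
    exact: integrable_multiplier_powR.
  by apply/funext => z /=; rewrite mul1r powRr1.
have hL u v : `|h u - h v| <= L * `|a| * c1 * `|u - v|.
  have [iu _ _] := Rintegral_bounded nu (mfB u) (fun z => f01 _).
  have [iv _ _] := Rintegral_bounded nu (mfB v) (fun z => f01 _).
  rewrite -RintegralB//; apply: le_trans (le_normr_Rintegral _ _) _ => //.
    exact: integB.
  have -> : L * `|a| * c1 * `|u - v| = \int[nu]_z (L * `|a| * `|u - v| * `|z|).
    by rewrite RintegralZl// mulrAC.
  apply: le_Rintegral => //.
  - by apply: integrable_norm => //; exact: integB.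
  - exact: integZl.
  move=> z _; apply: le_trans (fL _ _) _; rewrite -!mulrA ler_wpM2l//.
  by rewrite -mulrBl normrM mulrA ler_wpM2r// sd_lipschitz.
clearbody h.
have mfW : measurable_fun setT (fun w => f (W t w)) by exact: measurableT_comp.
have [_ _ ->] := Rintegral_bounded P mfW (fun w => f01 _).
under eq_integral => w _ do rewrite hE.
have mhW s : measurable_fun setT (fun w => h (W s w)) by exact: measurableT_comp.
have [_ _ ->] := Rintegral_bounded P (mhW t) (fun w => h01 _).
congr EFin.
have c1E := @lipschitz_cvg f L t mf f01 fL.
have c2E := @lipschitz_cvg h _ (t - 1) mh h01 hL.
have mps' n s : measurable_fun setT (fun w => f (partial_sol n s w)).
  exact: measurableT_comp.
have mhs n s : measurable_fun setT (fun w => h (partial_sol n s w)).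
  exact: measurableT_comp.
have step n : \int[P]_w f (partial_sol n.+1 t w) = \int[P]_w h (partial_sol n (t - 1) w).
  apply: EFin_inj.
  have [_ _ <-] := Rintegral_bounded P (mps' n.+1 t) (fun w => f01 _).
  have [_ _ <-] := Rintegral_bounded P (mhs n (t - 1)) (fun w => h01 _).
  apply: etrans (step_law f0 mf (@partial_sol_adapted n (t - 1))) _.
  by apply: eq_integral => w _; rewrite -hE.
have -> : \int[P]_w h (W t w) = \int[P]_w h (W (t - 1) w).
  apply: EFin_inj.
  have [_ _ <-] := Rintegral_bounded P (mhW t) (fun w => h01 _).
  have [_ _ <-] := Rintegral_bounded P (mhW (t - 1)) (fun w => h01 _).
  have [Q QE] := law_exists P (mW t).
  have h0E u : (0 <= (h u)%:E)%E by rewrite lee_fin; have /andP[] := h01 u.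
  have mhE : measurable_fun setT (fun u => (h u)%:E) by exact/measurable_EFinP.
  have QE' A : measurable A -> Q A = P (W (t - 1) @^-1` A).
    by move=> mA; rewrite QE; exact: W_st.
  apply: etrans (ge0_integral_law (mW t) (fun A _ => QE A) h0E mhE) _.
  exact/esym/(ge0_integral_law (mW (t - 1)) QE' h0E mhE).
move: c1E; rewrite -cvg_shiftS => c1E.
apply: (@cvg_unique R^o _ _ _ _ _ c1E) => //.
by rewrite [X in X @ _](_ : _ = fun n => \int[P]_w h (partial_sol n (t - 1) w))//; apply/funext.
Qed.

(** Two laws that agree on bounded Lipschitz functions agree on closed rays, whose
    indicators are limits of the piecewise affine functions [f_ n]. *)
Theorem law_fixed_point t (f : R -> \bar R) : (forall u, (0 <= f u)%E) ->
  measurable_fun setT f ->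
  (\int[P]_w f (W t w) = \int[P]_w \int[nu]_z f (B (W t w) * z)%R)%E.
Proof.
move=> f0 mf.
pose Y (wz : T * R) := B (W t wz.1) * wz.2.
have mY : measurable_fun setT Y.
  apply: measurable_funM => //; apply: measurableT_comp => //.
  exact: measurableT_comp.
pose PP : probability (T * measurableTypeR R)%type R := (P \x nu)%E.
have [Q QE] := law_exists PP mY.
have fub (g : R -> \bar R) : (forall u, (0 <= g u)%E) -> measurable_fun setT g ->
    (\int[PP]_wz g (Y wz) = \int[P]_w \int[nu]_z g (B (W t w) * z)%R)%E.
  move=> g0 mg; rewrite (@fubini_tonelli1 _ _ _ _ _ P nu (fun wz => g (Y wz)))//.
  exact: measurableT_comp.
have [QW QWE] := law_exists P (mW t).
have QQ : forall A, measurable A -> QW A = Q A.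
  apply: measure_eq_rays => x.
  pose f_ (n : nat) (u : R) := Num.max 0 (1 - n%:R * Num.max 0 (x - u)).
  have mf_ n : measurable_fun setT (f_ n).
    apply: measurable_maxr => //; apply: measurable_funB => //.
    apply: measurable_funM => //; apply: measurable_maxr => //.
    exact: measurable_funB.
  have f01 n u : 0 <= f_ n u <= 1.
    rewrite le_max lexx/= ge_max ler01/= lerBlDr lerDl mulr_ge0//.
    by rewrite le_max lexx.
  have fL n u v : `|f_ n u - f_ n v| <= n%:R * `|u - v|.
    apply: le_trans (max0_lipschitz _ _) _.
    have -> : 1 - n%:R * Num.max 0 (x - u) - (1 - n%:R * Num.max 0 (x - v)) =
        n%:R * (Num.max 0 (x - v) - Num.max 0 (x - u)) by ring.
    rewrite normrM ger0_norm// ler_wpM2l//; apply: le_trans (max0_lipschitz _ _) _.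
    by rewrite (_ : x - v - (x - u) = u - v)//; ring.
  have fcvg u : f_ n u - \1_`[x, +oo[ u @[n --> \oo] --> 0.
    rewrite indicE; have [xu|ux] := leP x u.
      rewrite mem_set/=; last by rewrite in_itv/= xu.
      apply: cvg_near_cst; apply: nearW => n.
      have -> : f_ n u = 1.
        have m0 : Num.max 0 (x - u) = 0 by apply/max_idPl; rewrite subr_le0.
        by rewrite /f_ m0 mulr0 subr0; apply/max_idPr.
      by rewrite subrr.
    rewrite memNset/=; last by rewrite in_itv/= leNgt ux.
    apply: cvg_near_cst.
    have := nbhs_infty_ger (x - u)^-1; apply: filterS => n hn.
    have xu0 : 0 < x - u by rewrite subr_gt0.
    rewrite subr0 /f_ (max_idPr (ltW xu0)); apply/max_idPl.
    by rewrite subr_le0 -ler_pdivrMr// div1r.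
  have lim d' (T' : measurableType d') (P' : probability T' R) (Z : T' -> R) :
      measurable_fun setT Z ->
      \int[P']_w f_ n (Z w) @[n --> \oo] --> fine (P' (Z @^-1` `[x, +oo[%classic)).
    move=> mZ; pose D := Z @^-1` `[x, +oo[%classic.
    have mD : measurable D by rewrite -[X in measurable X]setTI; exact: mZ.
    have mfZ n : measurable_fun setT (fun w => f_ n (Z w)) by exact: measurableT_comp.
    have i1 n : P'.-integrable setT (EFin \o (fun w => f_ n (Z w))).
      by have [] := Rintegral_bounded P' (mfZ n) (fun w => f01 n _).
    have i2 : P'.-integrable setT (EFin \o (fun w => \1_`[x, +oo[ (Z w))).
      rewrite (_ : (fun w => _) = (\1_D : T' -> R)).
        by apply: integrable_indic => //; rewrite setIT; exact: fin_num_fun_lty.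
      by apply/funext => w; rewrite !indicE.
    have E2 : \int[P']_w \1_`[x, +oo[ (Z w) = fine (P' D).
      rewrite (_ : (fun w => _) = (\1_D : T' -> R)).
        by rewrite /Rintegral integral_indic// setIT.
      by apply/funext => w; rewrite !indicE.
    rewrite -/D -E2 [X in X @ _](_ : _ = fun n =>
        \int[P']_w (f_ n (Z w) - \1_`[x, +oo[ (Z w)) + \int[P']_w \1_`[x, +oo[ (Z w)).
      rewrite -[X in _ --> X]add0r; apply: cvgD; last exact: cvg_cst.
      apply: (@Rintegral_cvg0 _ _ _ P' _ (cst 1)) => //.
      - by move=> n; apply: measurable_funB => //; apply: measurableT_comp => //;
          exact: measurable_indic.
      - exact: finite_measure_integrable_cst.
      - move=> n w; have /andP[h1 h2] := f01 n (Z w).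
        rewrite indicE; case: (_ \in _); rewrite /= ler_norml; apply/andP; split; lra.
    by apply/funext => n; rewrite RintegralB// subrK.
  have l1 := lim _ _ P _ (mW t).
  have l2 := lim _ _ PP _ mY.
  rewrite QWE QE -[LHS]fineK ?fin_num_measure//; last first.
    by rewrite -[X in measurable X]setTI; exact: mW.
  rewrite -[RHS]fineK ?fin_num_measure//; last first.
    by rewrite -[X in measurable X]setTI; exact: mY.
  congr EFin; apply: (@cvg_unique R^o _ _ _ _ _ l1) => //.
  rewrite [X in X @ _](_ : _ = fun n => \int[PP]_w f_ n (Y w))//.
  apply/funext => n; rewrite /Rintegral; congr fine.
  rewrite (@lipschitz_fixed_point (f_ n) _ t (mf_ n) (f01 n) (fL n)).
  rewrite (fub (fun u => (f_ n u)%:E))//.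
    by move=> u; rewrite lee_fin; have /andP[] := f01 n u.
  exact/measurable_EFinP.
rewrite -fub// (@ge0_integral_law _ _ _ P (W t) QW)//.
rewrite (@ge0_integral_law _ _ _ PP Y QW)//.
by move=> A mA; rewrite QQ// QE.
Qed.

End recursion.

(** * Powers of a sum of squares *)

(** The additive noise costs a factor arbitrarily close to 1 plus a constant: this
    is what makes the drift of |W|^b negative away from 0. *)
Lemma powR_sqrt_add_le (R : realType) (sg b e : R) : 0 < sg -> 0 < b -> 0 < e ->
  exists2 C : R, 0 <= C & forall A, 0 <= A ->
    Num.sqrt (A ^+ 2 + sg ^+ 2) `^ b <= (1 + e) * A `^ b + C.
Proof.
move=> sg0 b0 e0.
(* r is chosen with r ^ b = 1 + e; then A + sg <= r * A as soon as
   A >= sg / (r - 1), and for smaller A the left side is bounded *)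
pose r := (1 + e) `^ b^-1.
have r1 : 1 < r.
  suff : 1 `^ b^-1 < r by rewrite powR1.
  by apply: gt0_ltr_powR; rewrite ?invr_gt0 ?nnegrE ?ltrDl// addr_ge0// ltW.
have r0 : 0 < r by exact: lt_trans r1.
have rb : r `^ b = 1 + e.
  by rewrite /r -powRrM mulVf ?gt_eqF// powRr1// addr_ge0// ltW.
pose t := sg / (r - 1).
have t0 : 0 < t by rewrite divr_gt0// subr_gt0.
have le1 A : 0 <= A -> Num.sqrt (A ^+ 2 + sg ^+ 2) <= A + sg.
  move=> A0; rewrite -(@ler_pXn2r _ 2) ?nnegrE ?sqrtr_ge0 ?addr_ge0 ?(ltW sg0)//.
  rewrite sqr_sqrtr ?addr_ge0 ?sqr_ge0// sqrrD.
  have : 0 <= A * sg *+ 2 by rewrite mulrn_wge0 ?mulr_ge0 ?(ltW sg0).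
  lra.
exists ((t + sg) `^ b); first exact: powR_ge0.
move=> A A0.
have Ab0 : 0 <= (1 + e) * A `^ b by rewrite mulr_ge0 ?powR_ge0// addr_ge0// ltW.
have [tA|At] := leP t A.
  rewrite -[leLHS]addr0 lerD ?powR_ge0//.
  rewrite -rb -powRM ?(ltW r0)//; apply: ge0_ler_powR.
  - exact: ltW.
  - by rewrite nnegrE sqrtr_ge0.
  - by rewrite nnegrE mulr_ge0 ?(ltW r0).
  - apply: le_trans (le1 _ A0) _.
    have : sg <= A * (r - 1) by rewrite -ler_pdivrMr ?subr_gt0.
    lra.
rewrite -[leLHS]add0r lerD//; apply: ge0_ler_powR.
- exact: ltW.
- by rewrite nnegrE sqrtr_ge0.
- by rewrite nnegrE addr_ge0 ?(ltW sg0) ?(ltW t0).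
- by apply: le_trans (le1 _ A0) _; rewrite lerD2r ltW.
Qed.

(** The additive noise changes the power [al] by a quantity of strictly lower
    order, hence integrable when the moments of order less than [al] are
    finite. *)
Lemma powR_sqrt_sub_le (R : realType) (sg al : R) : 0 < sg -> 0 < al ->
  exists b C : R, [/\ 0 < b < al, 0 <= C & forall A, 0 <= A ->
    Num.sqrt (A ^+ 2 + sg ^+ 2) `^ al - A `^ al <= C * (1 + A `^ b)].
Proof.
move=> sg0 al0.
(* for A >= sg the increment is of order A ^ (al - 2), which is at most
   of order A ^ b since b >= al - 2 *)
pose b := Num.max (al / 2) (al - 1).
have b0 : 0 < b by rewrite lt_max divr_gt0.
have bal : b < al by rewrite gt_max; apply/andP; split; lra.
have b1 : al - 1 <= b by rewrite le_max lexx orbT.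
pose h := al / 2.
have h0 : 0 < h by rewrite divr_gt0.
pose K := h * expR h * sg ^+ 2.
pose C := (2 * sg) `^ al + K * sg `^ (al - 2 - b).
have K0 : 0 <= K.
  apply: mulr_ge0; last exact: sqr_ge0.
  by apply: mulr_ge0; [exact: ltW|exact: expR_ge0].
have C1 : 0 <= (2 * sg) `^ al by exact: powR_ge0.
have C2 : 0 <= K * sg `^ (al - 2 - b) by rewrite mulr_ge0 ?powR_ge0.
exists b, C; split; [by rewrite b0 bal|exact: addr_ge0|].
move=> A A0.
have Ab0 : 0 <= A `^ b by exact: powR_ge0.
have [sA|As] := leP sg A; last first.
  apply: (@le_trans _ _ ((2 * sg) `^ al)).
    rewrite lerBlDr -[leLHS]addr0 lerD ?powR_ge0//; apply: ge0_ler_powR.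
    - exact: ltW.
    - by rewrite nnegrE sqrtr_ge0.
    - by rewrite nnegrE mulr_ge0 ?(ltW sg0).
    rewrite -(@ler_pXn2r _ 2) ?nnegrE ?sqrtr_ge0 ?mulr_ge0 ?(ltW sg0)//.
    rewrite sqr_sqrtr ?addr_ge0 ?sqr_ge0// exprMn.
    have : A ^+ 2 <= sg ^+ 2 by rewrite ler_pXn2r ?nnegrE ?(ltW sg0)// ltW.
    by have := sqr_ge0 sg; lra.
  rewrite mulrDr mulr1 /C; have : 0 <= C * A `^ b by rewrite mulr_ge0// addr_ge0.
  rewrite /C; lra.
have A00 : 0 < A by exact: lt_le_trans sA.
pose w := (sg / A) ^+ 2.
have w0 : 0 <= w by exact: sqr_ge0.
have w1 : w <= 1.
  by rewrite /w expr_le1// ?divr_ge0 ?(ltW sg0)// ler_pdivrMr// mul1r.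
have -> : Num.sqrt (A ^+ 2 + sg ^+ 2) `^ al = A `^ al * (1 + w) `^ h.
  have -> : A ^+ 2 + sg ^+ 2 = A ^+ 2 * (1 + w) by rewrite /w; field; rewrite gt_eqF.
  rewrite sqrtrM ?sqr_ge0// sqrtr_sqr ger0_norm// powRM ?sqrtr_ge0//.
  congr (_ * _); rewrite -powR12_sqrt ?addr_ge0// -powRrM; congr (_ `^ _).
  by rewrite /h mulrC.
have e1 : (1 + w) `^ h <= 1 + h * expR h * w.
  have l1 : (1 + w) `^ h <= expR (h * w).
    rewrite /powR gt_eqF ?ltr_wpDr// ler_expR ler_pM2l//.
    by apply: le_ln1Dx; apply: lt_le_trans w0; rewrite ltrN10.
  apply: le_trans l1 _.
  have hw : h * w <= h by rewrite ler_piMr// ltW.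
  have := expR_ge1Dx (- (h * w)).
  rewrite -(ler_pM2l (expR_gt0 (h * w))) -expRD subrr expR0 => h1.
  have h2 : h * w * expR (h * w) <= h * w * expR h.
    by rewrite ler_wpM2l ?ler_expR// mulr_ge0 ?(ltW h0).
  lra.
apply: (@le_trans _ _ (A `^ al * (h * expR h * w))).
  have := ler_wpM2l (powR_ge0 A al) e1; lra.
have -> : A `^ al * (h * expR h * w) = K * A `^ (al - 2).
  rewrite powRB; last by rewrite (gt_eqF A00) implybT.
  by rewrite -[2]/(2%:R) powR_mulrn// /w /K; field; rewrite gt_eqF.
apply: (@le_trans _ _ (K * (sg `^ (al - 2 - b) * A `^ b))).
  rewrite ler_wpM2l//.
  have -> : A `^ (al - 2) = A `^ (al - 2 - b) * A `^ b.
    by rewrite -powRD ?subrK// (gt_eqF A00) implybT.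
  rewrite ler_wpM2r//.
  have E u : 0 < u -> u `^ (al - 2 - b) = (u `^ (2 + b - al))^-1.
    by move=> u0; rewrite -powRN; congr (_ `^ _); ring.
  rewrite !E// lef_pV2 ?posrE ?powR_gt0//; apply: ge0_ler_powR => //.
  - lra.
  - by rewrite nnegrE ltW.
rewrite mulrA /C; move: C1 C2 Ab0.
move: ((2 * sg) `^ al) (K * sg `^ (al - 2 - b)) (A `^ b) => p q B p0 q0 B0.
have := mulr_ge0 p0 B0; lra.
Qed.

(** * Truncated powers *)

Section truncated_power.
Context {R : realType}.
Variable al : R.
Hypothesis al_gt0 : 0 < al.
Implicit Types v x l t : R.

(** The truncation keeps the expectations finite, since the moment of order [al]
    of the stationary law is infinite. *)
Definition tpow v x : R := Num.min v x `^ al.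

Let mono v x : 0 <= v -> v <= x -> v `^ al <= x `^ al.
Proof.
by move=> v0 vx; apply: ge0_ler_powR; rewrite ?nnegrE ?(ltW al_gt0) ?(le_trans v0).
Qed.

Lemma tpow_low v x : v <= x -> tpow v x = v `^ al.
Proof. by move=> vx; rewrite /tpow min_l. Qed.

Lemma tpow_high v x : x <= v -> tpow v x = x `^ al.
Proof. by move=> vx; rewrite /tpow min_r. Qed.

Lemma tpow_ge0 v x : 0 <= tpow v x.
Proof. exact: powR_ge0. Qed.

Lemma tpow_le v x : 0 <= v -> 0 <= x -> tpow v x <= x `^ al.
Proof. by move=> v0 x0; apply: mono; rewrite ?ge_min ?lexx ?orbT// le_min v0. Qed.

Lemma tpow_nd v v' x x' : 0 <= v -> 0 <= x -> v <= v' -> x <= x' ->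
  tpow v x <= tpow v' x'.
Proof.
move=> v0 x0 vv xx; apply: mono; first by rewrite le_min v0.
by rewrite le_min !ge_min vv xx orbT.
Qed.

Lemma tpow_hom c v x : 0 < c -> 0 <= v -> 0 < x ->
  c `^ al * tpow v (x / c) = tpow (c * v) x.
Proof.
move=> c0 v0 x0; have [vx|xv] := leP v (x / c).
  rewrite !tpow_low//; first by rewrite powRM// ltW.
  by rewrite mulrC -ler_pdivlMr.
rewrite !tpow_high ?(ltW xv)//; last by rewrite mulrC -ler_pdivrMr// ltW.
by rewrite -powRM ?divr_ge0 ?(ltW c0) ?(ltW x0)// mulrC divfK// gt_eqF.
Qed.

Lemma tpow_growth e v x : 0 < e < al -> 0 <= v -> 0 < x ->
  tpow v x <= x `^ e * v `^ (al - e).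
Proof.
move=> /andP[e0 eal] v0 x0; rewrite /tpow.
have m0 : 0 <= Num.min v x by rewrite le_min v0 ltW.
have -> : Num.min v x `^ al = Num.min v x `^ e * Num.min v x `^ (al - e).
  by rewrite -powRD; rewrite addrC subrK// gt_eqF.
apply: ler_pM; rewrite ?powR_ge0//; apply: ge0_ler_powR;
  rewrite ?nnegrE ?(ltW e0) ?subr_ge0 ?(ltW eal) ?(ltW x0)//;
  by rewrite ge_min lexx ?orbT.
Qed.

Lemma tpow_diff_nd v v' x x' : 0 <= v -> v <= v' -> 0 <= x -> x <= x' ->
  tpow v' x - tpow v x <= tpow v' x' - tpow v x'.
Proof.
move=> v0 vv x0 xx; have [vx|xv] := leP v x.
  rewrite (tpow_low vx) (tpow_low (le_trans vx xx)) lerD2r.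
  by apply: tpow_nd => //; exact: le_trans vv.
rewrite (tpow_high (ltW xv)) (tpow_high (le_trans (ltW xv) vv)) subrr.
by rewrite subr_ge0; apply: tpow_nd => //; exact: le_trans xx.
Qed.

Lemma tpow_diff_le v v' x : 0 <= v -> v <= v' -> 0 <= x ->
  tpow v' x - tpow v x <= v' `^ al - v `^ al.
Proof.
move=> v0 vv x0; have v'0 := le_trans v0 vv.
pose y := Num.max x v'.
have xy : x <= y by rewrite le_max lexx.
have vy : v' <= y by rewrite le_max lexx orbT.
apply: le_trans (tpow_diff_nd v0 vv x0 xy) _.
by rewrite (tpow_low vy) (tpow_low (le_trans vv vy)).
Qed.

Lemma tpow_diff_gt0 v v' x : 0 <= v -> v < v' -> v < x -> 0 < tpow v' x - tpow v x.
Proof.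
move=> v0 vv vx; rewrite subr_gt0 (tpow_low (ltW vx)) /tpow.
by apply: gt0_ltr_powR; rewrite ?nnegrE ?lt_min ?vv// le_min !ltW ?(le_lt_trans v0).
Qed.

(** The truncated power is homogeneous, so increments at level t x compare with
    increments at level x for the smaller argument v / t. *)
Lemma tpow_scale l t v x : 0 <= v -> 1 <= l -> 1 <= t -> 0 < x ->
  tpow v (l * (t * x)) - tpow v (t * x) <= t `^ al * (tpow v (l * x) - tpow v x).
Proof.
move=> v0 l1 t1 x0.
have t0 : 0 < t by exact: lt_le_trans t1.
have l0 : 0 < l by exact: lt_le_trans l1.
have -> : l * (t * x) = t * (l * x) by ring.
have ta0 : 0 <= t `^ al by exact: powR_ge0.
have xlx : x <= l * x by rewrite ler_peMl// ltW.
have vt : v / t <= v by rewrite ler_pdivrMr// ler_peMr.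
have vt0 : 0 <= v / t by rewrite divr_ge0// ltW.
have hom y : 0 < y -> tpow v (t * y) = t `^ al * tpow (v / t) y.
  move=> y0; rewrite -[y in RHS](_ : t * y / t = y); last by field; rewrite gt_eqF.
  rewrite tpow_hom// ?mulr_gt0//; congr (tpow _ _).
  by rewrite mulrC divfK// gt_eqF.
rewrite !hom ?mulr_gt0// -mulrBr ler_wpM2l//.
have := tpow_diff_nd vt0 vt (ltW x0) xlx; lra.
Qed.

(** Integrated over v, this brackets the tail of v by the increments of the mean
    truncated power. *)
Lemma tpow_incr l v x : 0 <= v -> 1 <= l -> 0 < x ->
  (l `^ al - 1) * x `^ al * (l * x < v)%R%:R <= tpow v (l * x) - tpow v x
    <= (l `^ al - 1) * x `^ al * (x < v)%R%:R.
Proof.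
move=> v0 l1 x0.
have l0 : 0 < l by exact: lt_le_trans l1.
have xlx : x <= l * x by rewrite ler_peMl// ltW.
have Elx : (l * x) `^ al = l `^ al * x `^ al by rewrite powRM ?(ltW l0) ?(ltW x0).
have d0 : 0 <= tpow v (l * x) - tpow v x.
  by rewrite subr_ge0; apply: tpow_nd => //; exact: ltW.
apply/andP; split.
  case: ltP => h; last by rewrite mulr0.
  rewrite mulr1 (tpow_high (ltW h)) (tpow_high (le_trans xlx (ltW h))) Elx.
  by rewrite mulrBl mul1r.
case: ltP => h.
  rewrite mulr1 mulrBl mul1r (tpow_high (ltW h)) lerD2r -Elx.
  by apply: tpow_le => //; rewrite mulr_ge0// ltW.
by rewrite mulr0 (tpow_low h) (tpow_low (le_trans h xlx)) subrr.
Qed.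

End truncated_power.

(** * The tail of the scalar stationary law *)

Section tail_of_fixed_point.
Context d (T : measurableType d) (R : realType) (P : probability T R).
Local Notation nu := (gauss (0 : R) 1).
Variables (U : T -> R) (a sg al : R).
Hypothesis sg_gt0 : 0 < sg.
Hypothesis al_gt0 : 0 < al.
Hypothesis mU : measurable_fun setT U.
Hypothesis a_moment : (\int[nu]_z (`|a * z| `^ al)%:E = 1)%E.
Let B (s : R) := Num.sqrt ((a * s) ^+ 2 + sg ^+ 2).
Hypothesis law : forall f : R -> \bar R, (forall u, (0 <= f u)%E) ->
  measurable_fun setT f ->
  (\int[P]_w f (U w) = \int[P]_w \int[nu]_z f (B (U w) * z)%R)%E.

Let B_gt0 s : 0 < B s.
Proof. by rewrite sqrtr_gt0 ltr_wpDl ?sqr_ge0 ?exprn_gt0. Qed.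

Let B_norm s : B s = Num.sqrt ((`|a| * `|s|) ^+ 2 + sg ^+ 2).
Proof. by rewrite /B -normrM real_normK ?num_real. Qed.

Let iz (p : R) : 0 <= p -> nu.-integrable setT (EFin \o (fun z : R => `|z| `^ p)).
Proof.
move=> p0; rewrite (_ : (fun z : R => _) = (fun z => `|1 * z| `^ p)).
  exact: integrable_multiplier_powR.
by apply/funext => z; rewrite mul1r.
Qed.

Let mabsU (p : R) : measurable_fun setT (fun w => `|U w| `^ p).
Proof.
by apply: (measurableT_comp (measurable_powR p)); exact: measurableT_comp.
Qed.

Let mBz : measurable_fun setT (fun wz : T * R => B (U wz.1) * wz.2).
Proof.
apply: measurable_funM; last exact: measurable_snd.
apply: (measurableT_comp (measurable_sd a sg)).
exact: (measurableT_comp mU).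
Qed.

Let inner_measurable (f : R -> R) : (forall u, 0 <= f u) -> measurable_fun setT f ->
  measurable_fun setT (fun w => (\int[nu]_z (f (B (U w) * z))%:E)%E).
Proof.
move=> f0 mf; apply: (@measurable_fun_fubini_tonelli_F _ _ _ _ _ nu
  (fun wz : T * R => (f (B (U wz.1) * wz.2))%:E)).
  by apply/measurable_EFinP; exact: (measurableT_comp mf mBz).
by move=> wz; rewrite lee_fin.
Qed.

(** A drift inequality: the first coefficient is less than 1 for small e when
    E |a z|^b < 1. *)
Let gaussian_step_moment (b e C : R) : 0 < b ->
  (forall A, 0 <= A -> Num.sqrt (A ^+ 2 + sg ^+ 2) `^ b <= (1 + e) * A `^ b + C) ->
  forall s, \int[nu]_z (`|B s * z| `^ b) <=
    (1 + e) * (\int[nu]_z (`|a * z| `^ b)) * `|s| `^ b + C * \int[nu]_z (`|z| `^ b).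
Proof.
move=> b0 HC s.
have ia := integrable_multiplier_powR a (ltW b0).
have iB := integrable_multiplier_powR (B s) (ltW b0).
have i1 := iz (ltW b0).
have -> : (1 + e) * (\int[nu]_z (`|a * z| `^ b)) * `|s| `^ b + C * \int[nu]_z (`|z| `^ b) =
    \int[nu]_z ((1 + e) * `|s| `^ b * `|a * z| `^ b + C * `|z| `^ b).
  rewrite RintegralD//; [|exact: integZl|exact: integZl].
  rewrite (RintegralZl _ measurableT ia) (RintegralZl _ measurableT i1).
  by move: (\int[nu]_z _) => k; ring.
apply: le_Rintegral => //.
  by apply: integD; exact: integZl.
move=> z _; rewrite normrM powRM// (ger0_norm (ltW (B_gt0 s))) B_norm.
apply: le_trans (ler_wpM2r (powR_ge0 _ _) (HC _ _)) _; first exact: mulr_ge0.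
rewrite mulrDl lerD2r normrM !powRM//.
by rewrite le_eqVlt; apply/orP; left; apply/eqP; ring.
Qed.

(** With V = |U|^b, invariance of the law and the drift inequality give
    E min(V, x) <= E min(k' V + c, x) with k' < 1; comparing the integrands
    bounds E (V ; V <= n) by c / (1 - k') uniformly in n. *)
Lemma moment_fin (b : R) : 0 < b < al -> (\int[P]_w (`|U w| `^ b)%:E < +oo)%E.
Proof.
move=> /[dup] bb /andP[b0 bal].
have k1 := multiplier_moment_lt1 al_gt0 a_moment bb.
have k0 : 0 <= \int[nu]_z (`|a * z| `^ b).
  by apply: Rintegral_ge0 => z _; exact: powR_ge0.
have gsm := fun e C => @gaussian_step_moment b e C b0.
move: (\int[nu]_z (`|a * z| `^ b)) k0 k1 gsm => k k0 k1 gsm.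
have cz0 : 0 <= \int[nu]_z (`|z| `^ b).
  by apply: Rintegral_ge0 => z _; exact: powR_ge0.
move: (\int[nu]_z (`|z| `^ b)) cz0 gsm => cz cz0 gsm.
pose e := (1 - k) / 2.
have e0 : 0 < e by rewrite divr_gt0// subr_gt0.
have [C C0 HC] := powR_sqrt_add_le sg_gt0 b0 e0.
pose k' := (1 + e) * k; pose c := C * cz.
have k'1 : k' < 1.
  have : e * k <= e * 1 by rewrite ler_wpM2l// ltW.
  by rewrite /k' mulrDl mul1r /e; lra.
have k'0 : 0 <= k' by rewrite mulr_ge0// addr_ge0// ltW.
have c0 : 0 <= c by exact: mulr_ge0.
have step s : \int[nu]_z (`|B s * z| `^ b) <= k' * `|s| `^ b + c by exact: gsm.
pose V w := `|U w| `^ b.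
have V0 w : 0 <= V w by exact: powR_ge0.
have mV : measurable_fun setT V by exact: mabsU.
have mpow : measurable_fun setT (fun u : R => `|u| `^ b).
  by apply: (measurableT_comp (measurable_powR b)); exact: normr_measurable.
have bnd (v x : R) : 0 <= v -> 0 <= x -> 0 <= Num.min v x <= x.
  by move=> v0 x0; rewrite le_min v0 x0 ge_min lexx orbT.
have mf1 (x : R) : measurable_fun setT (fun w => Num.min (V w) x) by exact: measurable_minr.
have mf2 (x : R) : measurable_fun setT (fun w => Num.min (k' * V w + c) x).
  by apply: measurable_minr => //; apply: measurable_funD => //; exact: measurable_funM.
have trunc (x : R) : 0 <= x ->
    \int[P]_w Num.min (V w) x <= \int[P]_w Num.min (k' * V w + c) x.
  move=> x0.
  have [i1 _ E1] := Rintegral_bounded P (mf1 x) (fun w => bnd _ _ (V0 w) x0).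
  have kV0 w : 0 <= k' * V w + c by rewrite addr_ge0// mulr_ge0.
  have [i2 _ E2] := Rintegral_bounded P (mf2 x) (fun w => bnd _ _ (kV0 w) x0).
  rewrite -lee_fin -E1 -E2.
  have h0 (u : R) : (0 <= (Num.min (`|u| `^ b) x)%:E)%E.
    by rewrite lee_fin le_min powR_ge0 x0.
  have mh : measurable_fun setT (fun u : R => (Num.min (`|u| `^ b) x)%:E).
    by apply/measurable_EFinP; exact: measurable_minr.
  apply: (@le_trans _ _ (\int[P]_w \int[nu]_z (Num.min (`|B (U w) * z| `^ b) x)%:E)%E).
    by rewrite -(law h0 mh).
  have mBzs s : measurable_fun setT (fun z : R => `|B s * z| `^ b).
    exact: measurable_multiplier_powR.
  have inner s : (\int[nu]_z (Num.min (`|B s * z| `^ b) x)%:E <=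
      (Num.min (k' * `|s| `^ b + c) x)%:E)%E.
    have [i3 /andP[_ le_x] ->] := Rintegral_bounded nu
      (measurable_minr (mBzs s) (measurable_cst x)) (fun z => bnd _ _ (powR_ge0 _ _) x0).
    rewrite lee_fin le_min le_x andbT; apply: le_trans (step s).
    apply: le_Rintegral => //; first exact: integrable_multiplier_powR (ltW b0).
    by move=> z _; rewrite ge_min lexx.
  apply: ge0_le_integral => //.
  - move=> w _; exact: integral_ge0.
  - apply: (@inner_measurable (fun u => Num.min (`|u| `^ b) x)).
      by move=> u; rewrite le_min powR_ge0 x0.
    exact: measurable_minr.
  - exact/measurable_EFinP.
pose g (n : nat) w := V w * (V w <= n%:R)%R%:R.
have g0 n w : 0 <= g n w by rewrite mulr_ge0.
have gn n w : g n w <= n%:R.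
  by rewrite /g; case: (leP (V w) n%:R) => h; rewrite ?mulr1 ?mulr0.
have mg n : measurable_fun setT (g n).
  apply: measurable_funM => //.
  rewrite (_ : (fun w => _) = \1_(V @^-1` `]-oo, n%:R]%classic)).
    by apply: measurable_indic; rewrite -[X in measurable X]setTI; exact: mV.
  apply/funext => w; rewrite indicE; case: (leP (V w) n%:R) => h.
    by rewrite mem_set//= in_itv.
  by rewrite memNset//= in_itv/=; apply/negP; rewrite -ltNge.
have g_bnd n w : 0 <= g n w <= n%:R by rewrite g0 gn.
have gint n : \int[P]_w g n w <= c / (1 - k').
  have n0 : 0 <= n%:R :> R by [].
  have [ig _ _] := Rintegral_bounded P (mg n) (g_bnd n).
  have [i1 _ _] := Rintegral_bounded P (mf1 n%:R) (fun w => bnd _ _ (V0 w) n0).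
  have kV0 w : 0 <= k' * V w + c by rewrite addr_ge0// mulr_ge0.
  have [i2 _ _] := Rintegral_bounded P (mf2 n%:R) (fun w => bnd _ _ (kV0 w) n0).
  have tr := trunc _ n0.
  have k'10 : 0 < 1 - k' by rewrite subr_gt0.
  rewrite ler_pdivlMr// mulrC.
  have : \int[P]_w ((1 - k') * g n w - c) <=
      \int[P]_w (Num.min (V w) n%:R - Num.min (k' * V w + c) n%:R).
    apply: le_Rintegral => //.
    - by apply: integB; [exact: integZl|exact: finite_measure_integrable_cst].
    - exact: integB.
    move=> w _; rewrite /g; case: (leP (V w) n%:R) => h.
      rewrite mulr1.
      have : Num.min (k' * V w + c) n%:R <= k' * V w + c by rewrite ge_min lexx.
      lra.
    rewrite !mulr0.
    have : Num.min (k' * V w + c) n%:R <= n%:R by rewrite ge_min lexx orbT.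
    lra.
  rewrite RintegralB//; last 2 first.
  - exact: integZl.
  - exact: finite_measure_integrable_cst.
  rewrite RintegralB// RintegralZl// Rintegral_prob_cst.
  move: tr; move: (\int[P]_w _) (\int[P]_w Num.min (k' * V w + c) n%:R).
  move=> I1 I2 h1; lra.
have gV w : (g n w)%:E @[n --> \oo] --> (V w)%:E.
  apply: cvg_near_cst; have := nbhs_infty_ger (V w); apply: filterS => n h.
  by rewrite /g h mulr1.
have g_nd w : {homo (fun n => (g n w)%:E) : n m / (n <= m)%N >-> (n <= m)%E}.
  move=> n n' nn'; rewrite lee_fin /g ler_wpM2l// ler_nat.
  case: (leP (V w) n%:R) => //= h; case: (leP (V w) n'%:R) => //= h'.
  by move: h'; rewrite ltNge (le_trans h)// ler_nat.
have mgE n : measurable_fun setT (fun w => (g n w)%:E) by exact/measurable_EFinP.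
have := @cvg_monotone_convergence _ _ _ P setT measurableT (fun n w => (g n w)%:E)
  mgE (fun n w _ => g0 n w) (fun w _ => g_nd w).
rewrite (_ : (fun w => limn _) = (fun w => (V w)%:E)); last first.
  by apply/funext => w; apply/cvg_lim => //; exact: gV.
move=> cv; apply: (@le_lt_trans _ _ (c / (1 - k'))%:E); last exact: ltry.
rewrite -(cvg_lim _ cv)//; apply: lime_le; first by apply/cvg_ex; eexists; exact: cv.
apply: nearW => n; have [_ _ ->] := Rintegral_bounded P (mg n) (g_bnd n).
by rewrite lee_fin.
Qed.

(** By the fixed point equation the law of [U] is a mixture of centred normal
    laws. *)
Lemma tail_symmetric (x : R) : P [set w | x < U w] = P [set w | U w < - x].
Proof.
have ray (D : set R) : measurable D ->
    P (U @^-1` D) = (\int[P]_w gauss 0 1 [set z : R | D (B (U w) * z)%R])%E.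
  move=> mD; have mUD : measurable (U @^-1` D).
    by rewrite -[X in measurable X]setTI; exact: mU.
  have m1 : measurable_fun setT (fun u : R => (\1_D u : R)%:E).
    by apply/measurable_EFinP; exact: measurable_indic.
  transitivity (\int[P]_w (\1_D (U w) : R)%:E)%E.
    rewrite (_ : (fun w => _) = (fun w => (\1_(U @^-1` D) w : R)%:E)).
      by rewrite integral_indic// setIT.
    by apply/funext => w; rewrite !indicE.
  have f0 u : (0 <= (\1_D u : R)%:E)%E by rewrite lee_fin.
  rewrite (law f0 m1); apply: eq_integral => w _.
  pose D' := [set z : R | D (B (U w) * z)].
  have mD' : measurable D'.
    rewrite -[X in measurable X]setTI.
    by apply: (_ : measurable_fun setT (fun z : R => B (U w) * z)) => //;
      exact: measurable_funM.
  rewrite (_ : (fun z => _) = (fun z => (\1_D' z : R)%:E)).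
    by rewrite integral_indic// setIT.
  by apply/funext => z; rewrite !indicE.
have -> : [set w | x < U w] = U @^-1` `]x, +oo[%classic.
  by apply/seteqP; split => w /=; rewrite in_itv/= andbT.
have -> : [set w | U w < - x] = U @^-1` `]-oo, (- x)[%classic.
  by apply/seteqP; split => w /=; rewrite in_itv/=.
have m1 : measurable (`]x, +oo[%classic : set R) by [].
have m2 : measurable (`]-oo, (- x)[%classic : set R) by [].
apply: etrans (ray _ m1) _; apply: etrans _ (esym (ray _ m2)).
apply: eq_integral => w _; apply: etrans (esym (gauss_sym _)) _.
  rewrite -[X in measurable X]setTI.
  by apply: (_ : measurable_fun setT (fun z : R => B (U w) * z)) => //;
    exact: measurable_funM.
congr (gauss 0 1 _); apply/seteqP; split => z /=; rewrite !in_itv/= andbT mulrN.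
  by rewrite ltrNr.
by rewrite ltrNr.
Qed.

Let V w := `|U w|.
Let V_ge0 w : 0 <= V w. Proof. exact: normr_ge0. Qed.
Let mV : measurable_fun setT V. Proof. exact: measurableT_comp. Qed.
(** The value at negative arguments is set to that at 0, so that [J] is monotone
    on the whole line. *)
Let J (x : R) := \int[P]_w tpow al (V w) (Num.max x 0).
Let y (z : R) := `|a * z|.

Let mtpow (d' : measure_display) (T' : measurableType d') (v : T' -> R) (x : R) :
  measurable_fun setT v -> measurable_fun setT (fun w => tpow al (v w) x).
Proof.
move=> mv; apply: (measurableT_comp (measurable_powR al)).
by apply: measurable_minr => //; exact: measurable_cst.
Qed.

Let tpow_bnd v x : 0 <= v -> 0 <= x -> 0 <= tpow al v x <= x `^ al.
Proof. by move=> v0 x0; rewrite tpow_ge0 tpow_le. Qed.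

Let max0 (x : R) : 0 <= Num.max x 0.
Proof. by rewrite le_max lexx orbT. Qed.

Let J_pos (x : R) : 0 <= x -> J x = \int[P]_w tpow al (V w) x.
Proof. by move=> x0; rewrite /J max_l. Qed.

Let iJ (x : R) : 0 <= x -> P.-integrable setT (EFin \o (fun w => tpow al (V w) x)).
Proof.
by move=> x0; have [] := Rintegral_bounded P (mtpow x mV)
  (fun w => tpow_bnd (V_ge0 w) x0).
Qed.

Let J_ge0 x : 0 <= J x.
Proof. by apply: Rintegral_ge0 => w _; exact: tpow_ge0. Qed.

Let J_le x : 0 < x -> J x <= x `^ al.
Proof.
move=> /ltW x0; rewrite J_pos//.
by have [_ /andP[]] := Rintegral_bounded P (mtpow x mV)
  (fun w => tpow_bnd (V_ge0 w) x0).
Qed.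

Let J_nd : {homo J : x x' / x <= x'}.
Proof.
move=> x x' xx; apply: le_Rintegral => //; [exact: iJ|exact: iJ|].
move=> w _; apply: tpow_nd => //.
by rewrite ge_max !le_max xx lexx !orbT.
Qed.

Let J_scale l t x : 1 <= l -> 1 <= t -> 0 < x ->
  J (l * (t * x)) - J (t * x) <= t `^ al * (J (l * x) - J x).
Proof.
move=> l1 t1 x0.
have t0 : 0 <= t by exact: le_trans t1.
have l0 : 0 <= l by exact: le_trans l1.
have x0' := ltW x0.
have tx := mulr_ge0 t0 x0'; have lx := mulr_ge0 l0 x0'; have ltx := mulr_ge0 l0 tx.
rewrite (J_pos ltx) (J_pos tx) (J_pos lx) (J_pos x0').
rewrite -[leLHS](RintegralB measurableT (iJ ltx) (iJ tx)).
rewrite -[X in _ <= _ * X](RintegralB measurableT (iJ lx) (iJ x0')).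
have i1 := integB (iJ lx) (iJ x0').
rewrite -RintegralZl//; apply: le_Rintegral => //.
- by apply: integB; exact: iJ.
- exact: integZl.
- by move=> w _; exact: tpow_scale.
Qed.

Let iVpow (b : R) : 0 < b < al -> P.-integrable setT (EFin \o (fun w => V w `^ b)).
Proof.
move=> bb; apply/integrableP; split; first by apply/measurable_EFinP; exact: mabsU.
under eq_integral do rewrite /= ger0_norm ?powR_ge0//.
exact: moment_fin.
Qed.

Let J_growth (e : R) : 0 < e < al -> exists C, forall x : R, 0 < x -> J x <= C * x `^ e.
Proof.
move=> /andP[e0 eal]; exists (\int[P]_w (V w `^ (al - e))) => x x0.
have iV : P.-integrable setT (EFin \o (fun w => V w `^ (al - e))).
  by apply: iVpow; apply/andP; split; lra.
rewrite J_pos ?(ltW x0)// mulrC -RintegralZl//; apply: le_Rintegral => //.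
- exact: iJ (ltW x0).
- exact: integZl.
- by move=> w _; apply: tpow_growth => //; apply/andP; split.
Qed.

(** On the product space carrying U and an independent normal Z, the fixed point
    equation says that the truncated power [k1] of |B (U) Z| has mean J, while
    the truncated power [k2] of |a Z| |U| has mean K J by homogeneity.  So the
    defect L is the mean of k1 - k2, and |a Z| |U| <= |B (U) Z| yields its sign
    and its monotonicity. *)
Let PP : probability (T * measurableTypeR R)%type R := (P \x nu)%E.
Let k1 x (wz : T * R) := tpow al (`|B (U wz.1) * wz.2|) x.
Let k2 x (wz : T * R) := tpow al (y wz.2 * V wz.1) x.

Let mk1 x : measurable_fun setT (k1 x).
Proof. by apply: mtpow; exact: (measurableT_comp (@normr_measurable R setT) mBz). Qed.

Let myV : measurable_fun setT (fun wz : T * R => y wz.2 * V wz.1).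
Proof.
apply: measurable_funM; last exact: (measurableT_comp mV).
exact: (measurableT_comp (measurable_multiplier a)).
Qed.

Let mk2 x : measurable_fun setT (k2 x).
Proof. exact: mtpow. Qed.

Let k2_le_k1 wz : y wz.2 * V wz.1 <= `|B (U wz.1) * wz.2|.
Proof.
rewrite /y /V !normrM mulrAC ler_wpM2r// (ger0_norm (ltW (B_gt0 _))) -normrM.
rewrite -(@ler_pXn2r _ 2) ?nnegrE ?(ltW (B_gt0 _))//.
by rewrite real_normK ?num_real// sqr_sqrtr ?lerDl ?addr_ge0 ?sqr_ge0.
Qed.

Let yV_ge0 wz : 0 <= y wz.2 * V wz.1.
Proof. by rewrite mulr_ge0 ?normr_ge0. Qed.

Let k1_bounded x : 0 <= x -> _ :=
  fun x0 => Rintegral_bounded PP (mk1 x) (fun wz => tpow_bnd (normr_ge0 _) x0).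

Let k2_bounded x : 0 <= x -> _ :=
  fun x0 => Rintegral_bounded PP (mk2 x) (fun wz => tpow_bnd (yV_ge0 wz) x0).

Let J_k1 x : 0 <= x -> J x = \int[PP]_wz k1 x wz.
Proof.
move=> x0; rewrite J_pos//; apply: EFin_inj.
have [_ _ <-] := k1_bounded x0.
have [_ _ <-] := Rintegral_bounded P (mtpow x mV) (fun w => tpow_bnd (V_ge0 w) x0).
have f0 (u : R) : (0 <= (tpow al `|u| x)%:E)%E by rewrite lee_fin tpow_ge0.
have mf : measurable_fun setT (fun u : R => (tpow al `|u| x)%:E).
  by apply/measurable_EFinP; apply: mtpow; exact: normr_measurable.
apply: etrans (law f0 mf) _; apply/esym.
apply: (@fubini_tonelli1 _ _ _ _ _ P nu (fun wz => (k1 x wz)%:E)).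
  by apply/measurable_EFinP; exact: mk1.
by move=> wz; rewrite lee_fin tpow_ge0.
Qed.

Let J_k2 x : 0 < x -> \int[nu]_z (y z `^ al * J (x / y z)) = \int[PP]_wz k2 x wz.
Proof.
move=> x0; have x0' := ltW x0.
have E z : (\int[P]_w (k2 x (w, z))%:E)%E = (y z `^ al * J (x / y z))%:E.
  have [_ _ ->] := Rintegral_bounded P
    (mtpow x (measurable_funM (@measurable_cst _ _ _ _ setT (y z)) mV))
    (fun w => tpow_bnd (yV_ge0 (w, z)) x0').
  congr EFin.
  have : 0 <= y z by exact: normr_ge0.
  rewrite le_eqVlt => /orP[/eqP yz|yz].
    rewrite -yz powR0 ?gt_eqF// mul0r.
    rewrite (_ : (fun w => _) = cst 0) ?Rintegral_prob_cst//.
    apply/funext => w; change (Num.min (0 * V w) x `^ al = 0).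
    by rewrite mul0r min_l// powR0// gt_eqF.
  rewrite J_pos ?divr_ge0 ?(ltW yz)// -RintegralZl//; last first.
    by apply: iJ; rewrite divr_ge0 ?(ltW yz).
  by apply: eq_Rintegral => w _; rewrite tpow_hom.
apply: EFin_inj; have [_ _ <-] := k2_bounded x0'.
rewrite (@fubini_tonelli2 _ _ _ _ _ P nu (fun wz => (k2 x wz)%:E)).
- have my : measurable_fun setT y by exact: measurable_multiplier.
  have y0 z : 0 <= y z by exact: normr_ge0.
  have i1 := integrable_convolved nu al_gt0 my y0 J_ge0 J_le J_nd x0.
  rewrite /Rintegral fineK; last exact: integrable_fin_num i1.
  by apply: eq_integral => z _; rewrite -E.
- by apply/measurable_EFinP; exact: mk2.
- by move=> wz; rewrite lee_fin tpow_ge0.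
Qed.

Let L x := \int[nu]_z (y z `^ al * (J x - J (x / y z))).

Let my : @measurable_fun _ _ (measurableTypeR R) R setT y. Proof. exact: measurable_multiplier. Qed.
Let y_ge0 z : 0 <= y z. Proof. exact: normr_ge0. Qed.
Let iyal : nu.-integrable setT (EFin \o (fun z => y z `^ al)).
Proof. exact: integrable_multiplier_powR (ltW al_gt0). Qed.
Let Eyal : \int[nu]_z (y z `^ al) = 1. Proof. exact: multiplier_moment1. Qed.

Let ik1 x : 0 <= x -> PP.-integrable setT (EFin \o k1 x).
Proof. by move=> x0; have [] := k1_bounded x0. Qed.

Let ik2 x : 0 <= x -> PP.-integrable setT (EFin \o k2 x).
Proof. by move=> x0; have [] := k2_bounded x0. Qed.

Let L_PP x : 0 < x -> L x = \int[PP]_wz (k1 x wz - k2 x wz).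
Proof.
move=> x0; have x0' := ltW x0.
have -> : L x = J x - \int[nu]_z (y z `^ al * J (x / y z)).
  exact: (balance_convolved al_gt0 my y_ge0 iyal Eyal J_ge0 J_le J_nd x0).
by rewrite (RintegralB measurableT (ik1 x0') (ik2 x0')) -J_k1// -J_k2.
Qed.

Let ik12 x : 0 <= x -> PP.-integrable setT (EFin \o (fun wz => k1 x wz - k2 x wz)).
Proof. by move=> x0; apply: integB; [exact: ik1|exact: ik2]. Qed.

Let L_ge0 x : 0 < x -> 0 <= L x.
Proof.
move=> x0; rewrite L_PP//; apply: Rintegral_ge0 => wz _.
by rewrite subr_ge0; apply: tpow_nd => //; exact: ltW.
Qed.

Let L_nd x x' : 0 < x -> x <= x' -> L x <= L x'.
Proof.
move=> x0 xx; have x'0 := lt_le_trans x0 xx.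
rewrite (L_PP x0) (L_PP x'0).
apply: (le_Rintegral measurableT (ik12 (ltW x0)) (ik12 (ltW x'0))) => wz _.
by apply: tpow_diff_nd => //; exact: ltW.
Qed.

(** The difference of the untruncated powers is of order |U|^b |Z|^al with
    b < al, which is integrable. *)
Let L_bounded : exists Lb, forall x, 0 < x -> L x <= Lb.
Proof.
have [b [C [bb C0 HC]]] := powR_sqrt_sub_le sg_gt0 al_gt0.
have b0 : 0 < b by case/andP: bb.
pose h (w : T) := C * (1 + `|a| `^ b * V w `^ b).
pose H (wz : T * R) := h wz.1 * `|wz.2| `^ al.
have h0 w : 0 <= h w.
  by rewrite mulr_ge0// addr_ge0// mulr_ge0 ?powR_ge0.
have ih : P.-integrable setT (EFin \o h).
  apply: integZl; apply: integD; first exact: finite_measure_integrable_cst.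
  by apply: integZl; exact: iVpow.
have H0 wz : 0 <= H wz by rewrite mulr_ge0 ?powR_ge0.
have mpow : measurable_fun setT (fun z : R => `|z| `^ al).
  by apply: (measurableT_comp (measurable_powR al)); exact: normr_measurable.
have mh : measurable_fun setT h by apply/measurable_EFinP; exact: measurable_int ih.
have mH : measurable_fun setT H.
  by apply: measurable_funM; [exact: (measurableT_comp mh)|exact: (measurableT_comp mpow)].
have ial := iz (ltW al_gt0).
have cE : (\int[nu]_z (`|z| `^ al)%:E)%E = (\int[nu]_z (`|z| `^ al))%:E.
  by rewrite /Rintegral fineK//; exact: integrable_fin_num ial.
have iH : PP.-integrable setT (EFin \o H).
  apply/integrableP; split; first exact/measurable_EFinP.
  apply: (@le_lt_trans _ _ (\int[PP]_wz (H wz)%:E)%E).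
    by apply: ge0_le_integral => //; [exact/measurable_EFinP/measurableT_comp
      |exact/measurable_EFinP|move=> wz _; rewrite /= ger0_norm].
  rewrite (@fubini_tonelli1 _ _ _ _ _ P nu (fun wz => (H wz)%:E)); last 2 first.
  - exact/measurable_EFinP.
  - by move=> wz; rewrite lee_fin.
  have E w : fubini_F nu (fun wz => (H wz)%:E) w =
      ((h w)%:E * (\int[nu]_z (`|z| `^ al))%:E)%E.
    rewrite -cE -ge0_integralZl//; first exact/measurable_EFinP.
    by rewrite lee_fin.
  rewrite (funext E) ge0_integralZr//; last first.
  - by rewrite lee_fin; apply: Rintegral_ge0 => z _; exact: powR_ge0.
  - by move=> w _; rewrite lee_fin.
  - exact/measurable_EFinP.
  rewrite lte_mul_pinfty//.
  - by apply: integral_ge0 => w _; rewrite lee_fin.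
  - exact: integrable_fin_num ih.
  - exact: ltry.
exists (\int[PP]_wz H wz) => x x0; rewrite L_PP//; apply: le_Rintegral => //.
  exact/ik12/ltW.
move=> [w z] _; apply: le_trans (tpow_diff_le al_gt0 _ (k2_le_k1 (w, z)) (ltW x0)) _ => //=.
  exact: yV_ge0 (w, z).
have -> : `|B (U w) * z| = B (U w) * `|z|.
  by rewrite normrM (ger0_norm (ltW (B_gt0 _))).
have -> : y z * V w = `|a| * V w * `|z| by rewrite /y normrM mulrAC.
have aV : 0 <= `|a| * V w by rewrite mulr_ge0.
rewrite !(@powRM _ _ `|z|)// ?(ltW (B_gt0 _))// -mulrBl ler_wpM2r ?powR_ge0// B_norm.
apply: le_trans (HC _ aV) _.
by rewrite powRM.
Qed.

(** The inequality |a Z| |U| < |B (U) Z| is strict for Z != 0, and the truncation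
    does not affect the smaller side when |U| <= M, |Z| <= 2 and x > 2 |a| M. *)
Let L_pos : exists2 x, 0 < x & 0 < L x.
Proof.
have [M M0 HM] := tight_rv P mU (ltac:(lra) : 0 < 2^-1 :> R).
pose x := `|a| * 2 * M + 1.
have x0 : 0 < x by rewrite ltr_wpDl// !mulr_ge0// ltW.
exists x => //; rewrite L_PP//.
pose A1 := ~` [set w | M < `|U w|].
have mgtM : measurable [set w | M < `|U w|] by exact: measurable_norm_gt.
have mA1 : measurable A1 by exact: measurableC.
have PA1 : (0 < P A1)%E.
  rewrite probability_setC// sube_gt0 -[X in (X < _)%E]fineK ?fin_num_measure//.
  by rewrite lte_fin; apply: le_lt_trans HM _; lra.
pose A2 : set (measurableTypeR R) := `[1, 2]%classic.
have mA2 : measurable A2 by exact: measurable_itv.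
apply: (@Rintegral_gt0 _ _ _ PP _ (A1 `*` A2)).
- by move=> wz; rewrite subr_ge0; apply: tpow_nd => //; exact: ltW.
- exact/ik12/ltW.
- exact: measurableX.
- have E : PP (A1 `*` A2) = (P A1 * nu A2)%E by exact: product_measure1E.
  suff h : (0 < P A1 * nu A2)%E by apply: lt_le_trans h _; rewrite -E.
  by rewrite mule_gt0//; apply: gauss_itv_gt0; lra.
move=> [w z] [/= /negP wM]; rewrite /A2 /= in_itv/= => /andP[z1 z2].
apply: tpow_diff_gt0 => //=.
- exact: yV_ge0 (w, z).
- rewrite /y /V !normrM mulrAC ltr_pM2r ?normr_gt0 ?gt_eqF//; last by lra.
  rewrite (ger0_norm (ltW (B_gt0 _))) -normrM -(@ltr_pXn2r _ 2) ?nnegrE ?(ltW (B_gt0 _))//.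
  by rewrite real_normK ?num_real// sqr_sqrtr ?ltrDl ?exprn_gt0// addr_ge0 ?sqr_ge0.
- rewrite -leNgt in wM.
  apply: (@le_lt_trans _ _ (`|a| * 2 * M)); last by rewrite /x ltrDl.
  rewrite /y normrM ler_pM ?mulr_ge0// ler_wpM2l// ger0_norm; lra.
Qed.

(** The renewal theorem applied to the mean truncated power of |U| and the
    multiplier |a Z|. *)
Theorem fixed_point_tail : exists2 c : R, 0 < c &
  x `^ al * fine (P [set w | x < `|U w|]) @[x --> +oo] --> c.
Proof.
have [Lb L_le] := L_bounded.
have ilog := integrable_multiplier_ln a al_gt0.
have drift := multiplier_drift_gt0 al_gt0 a_moment.
have y_itv (u v : R) : 0 < u -> u < v -> 0 < fine (nu [set z | u <= y z <= v]).
  move=> u0 uv; apply: fine_gt0; rewrite (multiplier_itv_gt0 al_gt0 a_moment u0 uv)/=.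
  by rewrite (le_lt_trans (probability_le1 _ _)) ?ltry//; exact: measurable_multiplier_itv.
apply: (renewal_tail_pos al_gt0 my y_ge0 iyal Eyal ilog drift y_itv J_ge0 J_le J_nd
  J_scale J_growth L_nd L_ge0 L_le L_pos (p := fun x => fine (P [set w | x < `|U w|]))).
  by move=> x; rewrite fine_ge0.
move=> l x l1 x0.
have x0' := ltW x0.
have l0 : 0 <= l by exact: le_trans l1.
have lx := mulr_ge0 l0 x0'.
have Eind (c t : R) : c * fine (P [set w | t < `|U w|]) =
    \int[P]_w (c * (t < V w)%R%:R).
  have mt : measurable [set w | t < `|U w|] by exact: measurable_norm_gt.
  rewrite (_ : (fun w => _) = (fun w => c * (\1_[set w | t < `|U w|] w))).
    rewrite RintegralZl//; last exact: integrable_indic.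
    by rewrite /Rintegral integral_indic// setIT.
  apply/funext => w; rewrite indicE; case: (ltP t (V w)) => h.
    by rewrite mem_set.
  by rewrite memNset//=; apply/negP; rewrite -leNgt.
have iind (c t : R) : P.-integrable setT (EFin \o (fun w => c * (t < V w)%R%:R)).
  have mt : measurable [set w | t < `|U w|] by exact: measurable_norm_gt.
  rewrite (_ : (fun w => _) = (fun w => c * (\1_[set w | t < `|U w|] w))).
    by apply: integZl; exact: integrable_indic.
  apply/funext => w; rewrite indicE; case: (ltP t (V w)) => h.
    by rewrite mem_set.
  by rewrite memNset//=; apply/negP; rewrite -leNgt.
rewrite !mulrA !Eind (J_pos lx) (J_pos x0') -(RintegralB measurableT (iJ lx) (iJ x0')).
have i1 := integB (iJ lx) (iJ x0').
by apply/andP; split; apply: le_Rintegral => // w _;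
  have /andP[] := tpow_incr al_gt0 (V_ge0 w) l1 x0.
Qed.

End tail_of_fixed_point.


(** * Regular variation and light perturbations *)

Section tail_asymptotics.
Context {R : realType}.
Implicit Types (p r s : R -> R) (al c k l : R).

Lemma cvg_scale_pinfty k : 0 < k -> k * x @[x --> +oo] --> +oo.
Proof.
move=> k0; apply/cvgryPge => A; near=> x.
rewrite -ler_pdivrMl//; near: x; apply: nbhs_pinfty_ge; exact: num_real.
Unshelve. all: end_near. Qed.

Lemma tail_rescale p al c k : 0 < k ->
  x `^ al * p x @[x --> +oo] --> c ->
  x `^ al * p (k * x) @[x --> +oo] --> c * k `^ (- al).
Proof.
move=> k0 pc.
have pk : k `^ (- al) * ((k * x) `^ al * p (k * x)) @[x --> +oo] --> k `^ (- al) * c.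
  by apply: cvgMr => //; exact: (cvg_comp _ _ (cvg_scale_pinfty k0) pc).
rewrite mulrC; apply: cvg_trans pk; apply: near_eq_cvg; near=> x.
have x0 : 0 <= x by near: x; apply: nbhs_pinfty_ge; exact: num_real.
by rewrite mulrA powRM ?(ltW k0)// mulrA powRN mulVf ?mul1r// gt_eqF// powR_gt0.
Unshelve. all: end_near. Qed.

(** A perturbation by r is absorbed by a dilation of the level, whose cost tends
    to 1 with the dilation. *)
Lemma tail_perturbation p r s al c : 0 < al -> 0 <= c ->
  x `^ al * p x @[x --> +oo] --> c ->
  x `^ al * r x @[x --> +oo] --> 0 ->
  (forall l : R, 1 < l -> exists2 k : R, 0 < k & forall x : R, 0 < x ->
     p (l * x) - r (k * x) <= s x <= p (l^-1 * x) + r (k * x)) ->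
  x `^ al * s x @[x --> +oo] --> c.
Proof.
move=> al0 c0 pc r0 sandwich; apply/cvgrPdist_le => e e0.
pose h := e / (2 * (c + 1)).
have h0 : 0 < h by rewrite divr_gt0// mulr_gt0// ltr_wpDl.
have ch : c * h <= e / 2.
  have -> : e / 2 = (c + 1) * h by rewrite /h; field; rewrite gt_eqF// ltr_wpDl.
  by rewrite ler_wpM2r ?(ltW h0)// lerDl.
(* the dilation l is chosen so that rescaling by it costs a factor 1 + h *)
pose l := (1 + h) `^ al^-1.
have h1 : 0 < 1 + h by rewrite addr_gt0.
have l0 : 0 < l by exact: powR_gt0.
have lal : l `^ al = 1 + h.
  by rewrite /l -powRrM mulVf ?gt_eqF// powRr1// ltW.
have l1 : 1 < l.
  rewrite ltNge; apply/negP => l1.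
  have : l `^ al <= 1 `^ al by rewrite ge0_ler_powR ?nnegrE ?(ltW al0) ?(ltW l0).
  by rewrite powR1 lal; lra.
have [k k0 ps] := sandwich l l1.
have lo : x `^ al * p (l * x) - x `^ al * r (k * x) @[x --> +oo] -->
    c * l `^ (- al) - 0 * k `^ (- al).
  by apply: cvgB; exact: tail_rescale.
have up : x `^ al * p (l^-1 * x) + x `^ al * r (k * x) @[x --> +oo] -->
    c * l^-1 `^ (- al) + 0 * k `^ (- al).
  by apply: cvgD; apply: tail_rescale => //; rewrite invr_gt0.
have lalN : l `^ (- al) = (1 + h)^-1 by rewrite powRN lal.
have lVal : l^-1 `^ (- al) = 1 + h.
  have lV0 : 0 <= l by exact: ltW.
  by rewrite -[l^-1](powR_inv1 lV0) -powRrM mulrNN mul1r.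
rewrite lalN mul0r subr0 in lo; rewrite lVal mul0r addr0 in up.
have lo' : c - e < c / (1 + h).
  rewrite ltr_pdivlMr// mulrDr mulr1.
  have := mulr_gt0 e0 h0; rewrite mulrBl; lra.
have up' : c * (1 + h) < c + e by rewrite mulrDr mulr1; lra.
near=> x.
have x0 : 0 < x by near: x; apply: nbhs_pinfty_gt; exact: num_real.
have /andP[psl psu] := ps x x0.
have xal : 0 <= x `^ al by exact: powR_ge0.
have hl : c - e < x `^ al * p (l * x) - x `^ al * r (k * x).
  by near: x; exact: cvgr_gt lo _ lo'.
have hu : x `^ al * p (l^-1 * x) + x `^ al * r (k * x) < c + e.
  by near: x; exact: cvgr_lt up _ up'.
rewrite ler_distlC; apply/andP; split.
  by apply: le_trans (ltW hl) _; rewrite -mulrBr ler_wpM2l.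
by apply: le_trans _ (ltW hu); rewrite -mulrDr ler_wpM2l.
Unshelve. all: end_near. Qed.

End tail_asymptotics.

Section tails_of_random_variables.
Context d (T : measurableType d) (R : realType) (P : probability T R).
Implicit Types (U V W : T -> R) (al b c x : R).

Let fineP_leD (A B D : set T) : measurable A -> measurable B -> measurable D ->
  A `<=` B `|` D -> fine (P A) <= fine (P B) + fine (P D).
Proof.
move=> mA mB mD AB; rewrite -fineD ?fin_num_measure//.
rewrite fine_le ?fin_numD ?fin_num_measure//.
apply: (@le_trans _ _ (P (B `|` D))).
  by rewrite le_measure ?inE//; exact: measurableU.
exact: measureU2.
Qed.

Let mgt U x : measurable_fun setT U -> measurable [set w | x < U w].
Proof.
move=> mU; have -> : [set w | x < U w] = U @^-1` `]x, +oo[%classic.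
  by apply/seteqP; split => w /=; rewrite in_itv/= andbT.
by rewrite -[X in measurable X]setTI; exact: mU.
Qed.

Let mlt U x : measurable_fun setT U -> measurable [set w | U w < x].
Proof.
move=> mU; have -> : [set w | U w < x] = U @^-1` `]-oo, x[%classic.
  by apply/seteqP; split => w /=; rewrite in_itv/=.
by rewrite -[X in measurable X]setTI; exact: mU.
Qed.

Let mle U x : measurable_fun setT U -> measurable [set w | U w <= x].
Proof.
move=> mU; have -> : [set w | U w <= x] = U @^-1` `]-oo, x]%classic.
  by apply/seteqP; split => w /=; rewrite in_itv/=.
by rewrite -[X in measurable X]setTI; exact: mU.
Qed.

Let mabs U x : measurable_fun setT U -> measurable [set w | x < `|U w|].
Proof. exact: measurable_norm_gt. Qed.

(** A variable that does not contribute to a tail of order x^(-al). *)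
Definition light_tail al V := x `^ al * tail_abs P V x @[x --> +oo] --> 0.

(** Markov's inequality at the higher order [b]. *)
Lemma light_tail_moment V al b : 0 < al < b -> measurable_fun setT V ->
  (\int[P]_w (`|V w| `^ b)%:E < +oo)%E -> light_tail al V.
Proof.
move=> /andP[al0 alb] mV Vb.
have b0 : 0 < b by exact: lt_trans alb.
have mVb : measurable_fun setT (fun w => `|V w| `^ b).
  by apply: (measurableT_comp (measurable_powR b)); exact: measurableT_comp.
have I0 : (0 <= \int[P]_w (`|V w| `^ b)%:E)%E.
  by apply: integral_ge0 => w _; rewrite lee_fin powR_ge0.
pose K := fine (\int[P]_w (`|V w| `^ b)%:E).
have KE : (\int[P]_w (`|V w| `^ b)%:E)%E = K%:E by rewrite fineK// ge0_fin_numE.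
have K0 : 0 <= K by exact: fine_ge0.
have markov x : 0 < x -> x `^ b * tail_abs P V x <= K.
  move=> x0; pose A := [set w | x < `|V w|].
  have mA : measurable A by exact: mabs.
  rewrite -lee_fin -KE EFinM /tail_abs fineK ?fin_num_measure//.
  have -> : P A = (\int[P]_w (\1_A w)%:E)%E by rewrite integral_indic// setIT.
  rewrite -ge0_integralZl//; last 2 first.
  - by apply/measurable_EFinP; exact: measurable_indic.
  - by rewrite lee_fin powR_ge0.
  apply: ge0_le_integral => //.
  - by move=> w _; rewrite -EFinM lee_fin mulr_ge0 ?powR_ge0.
  - by apply/measurable_EFinP; apply: measurable_funM => //; exact: measurable_indic.
  - exact/measurable_EFinP.
  - move=> w _; rewrite -EFinM lee_fin indicE.
    case: (boolP (w \in A)) => [|_]; last by rewrite mulr0 powR_ge0.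
    rewrite inE /A/= mulr1 => xV.
    by rewrite ge0_ler_powR ?nnegrE ?(ltW b0) ?(ltW x0)// ltW.
rewrite /light_tail; apply/cvgr0Pnorm_le => e e0; near=> x.
have x1 : 0 < x by near: x; apply: nbhs_pinfty_gt; exact: num_real.
have tx0 : 0 <= tail_abs P V x by exact: fine_ge0.
rewrite ger0_norm ?mulr_ge0 ?powR_ge0//.
have ba : 0 < b - al by rewrite subr_gt0.
have Kx : K / e <= x `^ (b - al).
  have -> : K / e = ((K / e) `^ (b - al)^-1) `^ (b - al).
    by rewrite -powRrM mulVf ?gt_eqF// powRr1// divr_ge0// ltW.
  have Cx : (K / e) `^ (b - al)^-1 <= x.
    by near: x; apply: nbhs_pinfty_ge; exact: num_real.
  by apply: (ge0_ler_powR (ltW ba)) Cx; rewrite nnegrE ?powR_ge0 ?(ltW x1).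
have xp : 0 < x `^ (b - al) by exact: powR_gt0.
rewrite -(ler_pM2l xp); apply: (@le_trans _ _ K).
  have := markov x x1.
  by rewrite mulrA -powRD ?subrK//; apply/implyP => _; rewrite gt_eqF.
by rewrite -ler_pdivrMr.
Unshelve. all: end_near. Qed.

Lemma light_tail0 al : light_tail al (cst 0).
Proof.
rewrite /light_tail; apply/cvgr0Pnorm_le => e e0; near=> x.
have x0 : 0 < x by near: x; apply: nbhs_pinfty_gt; exact: num_real.
rewrite /tail_abs (_ : [set w | _] = set0) ?measure0 ?mulr0 ?normr0 ?(ltW e0)//.
apply/seteqP; split => // w /=; rewrite normr0 => h.
by have := lt_trans h x0; rewrite ltxx.
Unshelve. all: end_near. Qed.

Lemma light_tailZ al V c : light_tail al V -> light_tail al (fun w => c * V w).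
Proof.
have [->|c0] := eqVneq c 0.
  move=> _; rewrite (_ : (fun w => _) = cst 0); first exact: light_tail0.
  by apply/funext => w; rewrite mul0r.
move=> /(@tail_rescale R _ _ _ `|c|^-1); rewrite mul0r invr_gt0 normr_gt0 => /(_ c0).
apply: cvg_trans; apply: near_eq_cvg; apply: nearW => x.
congr (_ * fine (P _)); apply/seteqP; split => w /=; rewrite normrM.
  by rewrite ltr_pdivrMl ?normr_gt0.
by rewrite ltr_pdivrMl ?normr_gt0.
Qed.

Lemma light_tailD al U V : measurable_fun setT U -> measurable_fun setT V ->
  light_tail al U -> light_tail al V -> light_tail al (fun w => U w + V w).
Proof.
move=> mU mV lU lV.
have half : 0 < 2^-1 :> R by rewrite invr_gt0.
have lUV : x `^ al * tail_abs P U (2^-1 * x) + x `^ al * tail_abs P V (2^-1 * x)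
    @[x --> +oo] --> 0.
  rewrite (_ : 0 = 0 * 2^-1 `^ (- al) + 0 * 2^-1 `^ (- al)); last by rewrite mul0r addr0.
  by apply: cvgD; exact: tail_rescale.
rewrite /light_tail; apply: (squeeze_cvgr _ _ lUV); last exact: cvg_cst.
near=> x; rewrite mulr_ge0 ?powR_ge0 ?fine_ge0//=.
rewrite -mulrDr ler_wpM2l ?powR_ge0//; apply: fineP_leD; [| | |].
- by apply: mabs; exact: measurable_funD.
- exact: mabs.
- exact: mabs.
move=> w /= xUV; apply/orP; rewrite -[_ || _]negbK negb_or -!leNgt.
apply/negP => /andP[hU hV]; move: xUV; rewrite ltNge => /negP; apply.
by apply: le_trans (ler_normD _ _) _; lra.
Unshelve. all: end_near. Qed.

Lemma measurable_sum_cond (I : Type) (s : seq I) (Q : pred I) (V : I -> T -> R) :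
  (forall i, measurable_fun setT (V i)) ->
  measurable_fun setT (fun w => \sum_(i <- s | Q i) V i w).
Proof.
move=> mV; under eq_fun do rewrite big_mkcond/=.
by apply: measurable_sum => j; case: (Q j).
Qed.

Lemma light_tail_sum (I : Type) (s : seq I) (Q : pred I) (V : I -> T -> R) al :
  (forall i, measurable_fun setT (V i)) -> (forall i, Q i -> light_tail al (V i)) ->
  light_tail al (fun w => \sum_(i <- s | Q i) V i w).
Proof.
move=> mV lV; elim: s => [|i s IH].
  rewrite (_ : (fun w => _) = cst 0); first exact: light_tail0.
  by apply/funext => w; rewrite big_nil.
case: (boolP (Q i)) => Qi; last first.
  by rewrite (_ : (fun w => _) = (fun w => \sum_(i <- s | Q i) V i w))//;
    apply/funext => w; rewrite big_cons (negPf Qi).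
rewrite (_ : (fun w => _) = (fun w => V i w + \sum_(i <- s | Q i) V i w)).
  apply: light_tailD => //; last exact: lV.
  exact: measurable_sum_cond.
by apply/funext => w; rewrite big_cons Qi.
Qed.

(** The symmetric variable W splits its tail equally between the two sides, and
    the events for W + V at level x are compared with those for W at the levels
    x / l and l x, up to the event that V is large. *)
Lemma regularly_varying_perturbation W V al c : 0 < al -> 0 < c ->
  measurable_fun setT W -> measurable_fun setT V ->
  (forall x, P [set w | x < W w] = P [set w | W w < - x]) ->
  x `^ al * tail_abs P W x @[x --> +oo] --> c -> light_tail al V ->
  regularly_varying P (fun w => W w + V w) al.
Proof.
move=> al0 c0 mW mV Wsym Wc lV.
set S := fun w => W w + V w.
have mS : measurable_fun setT S by exact: measurable_funD.
(* the size of V that a dilation of the level x by l can absorb *)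
have absorb (l : R) : 1 < l -> let k := (1 - l^-1) / 2 in
    [/\ 0 < k, k < 1 - l^-1 & k < l - 1].
  move=> l1 k; have l0 : 0 < l by exact: lt_trans l1.
  have lV0 : 0 < 1 - l^-1 by rewrite subr_gt0 invf_lt1.
  have : 1 - l^-1 < l - 1.
    have -> : l - 1 = l * (1 - l^-1) by rewrite mulrBr mulr1 divff ?gt_eqF.
    by rewrite ltr_pMl.
  by rewrite /k; split; lra.
have absorbx (l x : R) : 1 < l -> 0 < x -> let k := (1 - l^-1) / 2 in
    l^-1 * x + k * x < x /\ x + k * x < l * x.
  move=> l1 x0 k; have [_ k1 k2] := absorb l l1.
  by split; rewrite -?mulrDl -[ltRHS]mul1r ?[1 * (l * x)]mul1r -1?[X in X + k * x]mul1r
    -?mulrDl ltr_pM2r// /k; lra.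
have half : x `^ al * fine (P [set w | x < W w]) @[x --> +oo] --> c / 2.
  have Wc2 : 2^-1 * (x `^ al * tail_abs P W x) @[x --> +oo] --> 2^-1 * c.
    exact: cvgMr.
  rewrite mulrC; apply: cvg_trans Wc2; apply: near_eq_cvg; near=> x.
  have x0 : 0 < x by near: x; apply: nbhs_pinfty_gt; exact: num_real.
  have -> : tail_abs P W x = 2 * fine (P [set w | x < W w]).
    have disj : [set w | x < W w] `&` [set w | W w < - x] = set0.
      apply/seteqP; split => // w /= [h1 h2].
      have := lt_trans h1 h2; lra.
    have E : [set w | x < `|W w|] = [set w | x < W w] `|` [set w | W w < - x].
      by apply/seteqP; split => w /=; rewrite lter_normr ltrNr => /orP.
    have mU := @measureU _ _ _ P _ _ (mgt x mW) (mlt (- x) mW) disj.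
    rewrite /tail_abs E -[LHS]/(fine (P _)) mU fineD ?fin_num_measure//.
    - have -> : fine (P [set w | W w < - x]) = fine (P [set w | x < W w]).
        by congr fine; exact/esym/Wsym.
      by rewrite -mulr2n mulr_natl.
    - exact: mgt.
    - exact: mlt.
  by field.
have right : x `^ al * fine (P [set w | x < S w]) @[x --> +oo] --> c / 2.
  apply: (tail_perturbation al0 _ half lV); first by rewrite divr_ge0// ltW.
  move=> l l1; exists ((1 - l^-1) / 2); first by have [] := absorb l l1.
  move=> x x0; have [up lo] := absorbx l x l1 x0; apply/andP; split.
    rewrite lerBlDr; apply: fineP_leD; [exact: mgt|exact: mgt|exact: mabs|].
    move=> w /= h; have [hV|hV] := ltP ((1 - l^-1) / 2 * x) `|V w|; first by right.
    by left; move: hV; rewrite ler_norml => /andP[hV _]; rewrite /S; lra.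
  apply: fineP_leD; [exact: mgt|exact: mgt|exact: mabs|].
  move=> w /= h; have [hV|hV] := ltP ((1 - l^-1) / 2 * x) `|V w|; first by right.
  by left; move: hV h; rewrite ler_norml /S => /andP[_ hV] h; lra.
have left : x `^ al * fine (P [set w | S w <= - x]) @[x --> +oo] --> c / 2.
  apply: (tail_perturbation al0 _ half lV); first by rewrite divr_ge0// ltW.
  move=> l l1; exists ((1 - l^-1) / 2); first by have [] := absorb l l1.
  move=> x x0; have [up lo] := absorbx l x l1 x0; rewrite !Wsym; apply/andP; split.
    rewrite lerBlDr; apply: fineP_leD; [exact: mlt|exact: mle|exact: mabs|].
    move=> w /= h; have [hV|hV] := ltP ((1 - l^-1) / 2 * x) `|V w|; first by right.
    by left; move: hV; rewrite ler_norml => /andP[_ hV]; rewrite /S; lra.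
  apply: fineP_leD; [exact: mle|exact: mlt|exact: mabs|].
  move=> w /= h; have [hV|hV] := ltP ((1 - l^-1) / 2 * x) `|V w|; first by right.
  by left; move: hV h; rewrite ler_norml /S => /andP[hV _] h; lra.
have both : x `^ al * tail_abs P S x @[x --> +oo] --> c.
  apply: (tail_perturbation al0 (ltW c0) Wc lV).
  move=> l l1; exists ((1 - l^-1) / 2); first by have [] := absorb l l1.
  move=> x x0; have [up lo] := absorbx l x l1 x0; apply/andP; split.
    rewrite lerBlDr; apply: fineP_leD; [exact: mabs|exact: mabs|exact: mabs|].
    move=> w /= h; have [hV|hV] := ltP ((1 - l^-1) / 2 * x) `|V w|; first by right.
    left; have : `|W w| <= `|S w| + `|V w| by rewrite -{1}(addrK (V w) (W w)) ler_normB.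
    lra.
  apply: fineP_leD; [exact: mabs|exact: mabs|exact: mabs|].
  move=> w /= h; have [hV|hV] := ltP ((1 - l^-1) / 2 * x) `|V w|; first by right.
  left; have : `|S w| <= `|W w| + `|V w| by exact: ler_normD.
  lra.
have ratio (f : R -> R) (a : R) : x `^ al * f x @[x --> +oo] --> a ->
    f x / tail_abs P S x @[x --> +oo] --> a / c.
  move=> fa.
  have fS : (x `^ al * f x) / (x `^ al * tail_abs P S x) @[x --> +oo] --> a / c.
    by apply: cvgM fa _; apply: cvgV both; rewrite gt_eqF.
  apply: cvg_trans fS; apply: near_eq_cvg; near=> x.
  have x0 : 0 < x `^ al.
    by rewrite powR_gt0//; near: x; apply: nbhs_pinfty_gt; exact: num_real.
  rewrite /= invfM mulrACA divff ?mul1r// gt_eqF//.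
split; first exact: ltW.
  move=> k k0; have := ratio _ _ (tail_rescale k0 both).
  by rewrite mulrAC divff ?mul1r// gt_eqF.
exists (c / 2 / c), (c / 2 / c); split; [| | |exact: ratio|exact: ratio].
- by rewrite !divr_ge0// ltW.
- by rewrite !divr_ge0// ltW.
- by field; rewrite gt_eqF.
Unshelve. all: end_near. Qed.

End tails_of_random_variables.


(** * Projections of the process on left eigenvectors *)

Section generated_sigma_algebras.
Context {R : realType}.

(** The membership of an event in a generated sigma-algebra, as needed for
    independence and stationarity, is obtained by viewing the linear form as a
    measurable function for that sigma-algebra. *)
Lemma sigma_lincomb (U : pointedType) (G : set (set U)) n (c : 'I_n -> R)
    (f : 'I_n -> U -> R) (B : set R) :
  (forall i D, measurable D -> <<s G >> (f i @^-1` D)) -> measurable B ->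
  <<s G >> ((fun x => \sum_i c i * f i x) @^-1` B).
Proof.
move=> mf mB.
have mfi i : @measurable_fun _ _ (g_sigma_algebraType G) R setT (f i).
  by move=> _ D mD; rewrite setTI; exact: mf.
have mS : @measurable_fun _ _ (g_sigma_algebraType G) R setT
    (fun x => \sum_i c i * f i x).
  by apply: measurable_sum => i; apply: measurable_funM => //; exact: measurable_cst.
by have := mS measurableT B mB; rewrite setTI.
Qed.

Context d (T : measurableType d).

Lemma sigma_gen_preimage (K : Type) (F : K -> T -> R) k (B : set R) :
  measurable B -> sigma_gen F (F k @^-1` B).
Proof.
move=> mB; apply: sub_sigma_algebra; exists k => //.
by exists B => //; rewrite setTI.
Qed.

Lemma sigma_gen_bigcap (K : Type) (F : K -> T -> R) (I : choiceType) (s : seq I)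
    (A : I -> set T) : (forall i, i \in s -> sigma_gen F (A i)) ->
  sigma_gen F (\bigcap_(i in [set` s]) A i).
Proof.
move=> FA; rewrite bigcap_seq big_seq.
exact: (@bigsetI_measurable _ (g_sigma_algebraType
  (\bigcup_k preimage_set_system setT (F k) measurable))).
Qed.

End generated_sigma_algebras.

Section projection.
Context {R : realType} disp (T : measurableType disp) (Pr : probability T R) (d : nat).
Variables (C A1 : 'M[R]_d) (X : int -> T -> 'cV[R]_d) (m1 : int -> {RV Pr >-> R})
  (Q : int -> T -> 'cV[R]_d).
Hypothesis C_pd : pd_mx C.
Hypothesis X_meas : forall t i, measurable_fun setT (vcoord (X t) i).
Hypothesis X_sre : sre_representation C A1 X m1 Q.
Hypothesis X_stationary : strictly_stationary Pr X.
Variables (u : 'rV[R]_d) (a al : R).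
Hypothesis u_neq0 : u != 0.
Hypothesis u_eigen : u *m A1 = a *: u.
Hypothesis al_gt0 : 0 < al.
Hypothesis a_moment : (\int[gauss (0 : R) 1]_z (`|a * z| `^ al)%:E = 1)%E.

Definition proj (V : int -> T -> 'cV[R]_d) (t : int) (w : T) : R := (u *m V t w) 0 0.
Let sg : R := Num.sqrt (quad_form C u^T).

Lemma projE V t w : proj V t w = \sum_i u 0 i * vcoord (V t) i w.
Proof. by rewrite /proj mxE. Qed.

Lemma measurable_proj V t : (forall i, measurable_fun setT (vcoord (V t) i)) ->
  measurable_fun setT (proj V t).
Proof.
move=> mV; rewrite (funext (projE V t)); apply: measurable_sum => i.
by apply: measurable_funM => //; exact: measurable_cst.
Qed.

Let sg_gt0 : 0 < sg.
Proof.
rewrite sqrtr_gt0; apply: C_pd.2; apply: contra u_neq0 => /eqP uT.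
by rewrite -(trmxK u) uT trmx0.
Qed.

Let Q_gauss := sre_Q X_sre.

Let mQ t : measurable_fun setT (proj Q t).
Proof. by apply: measurable_proj => i; exact: (igv_meas Q_gauss). Qed.

Let mm1 t : measurable_fun setT (m1 t : T -> R).
Proof. exact: measurable_funPT. Qed.

Let m1_law t A : measurable A -> Pr (m1 t @^-1` A) = gauss 0 1 A.
Proof. by move=> mA; rewrite gaussE -(isn_law (sre_m X_sre) t mA). Qed.

Let Q_law t A : measurable A -> Pr (proj Q t @^-1` A) = gauss 0 sg A.
Proof.
move=> mA; rewrite gaussE; have := igv_law Q_gauss t u^T mA.
rewrite trmxK /normal_var ifF//.
by apply/negbTE; rewrite gt_eqF// -sqrtr_gt0.
Qed.

Let sigma_gen_proj t B : measurable B ->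
  sigma_gen (vcoord (Q t)) (proj Q t @^-1` B).
Proof.
move=> mB; rewrite (funext (projE Q t)); apply: sigma_lincomb => // i D mD.
exact: sigma_gen_preimage.
Qed.

Let sigma_gen_proj_all t B : measurable B ->
  sigma_gen (fun ti : int * 'I_d => vcoord (Q ti.1) ti.2) (proj Q t @^-1` B).
Proof.
move=> mB; rewrite (funext (projE Q t)); apply: sigma_lincomb => // i D mD.
exact: (@sigma_gen_preimage _ _ _ _ (fun ti : int * 'I_d => vcoord (Q ti.1) ti.2) (t, i)).
Qed.

(** The events are split according to their noise: the two families are
    independent of each other, and each is mutually independent. *)
Let noise_indep (s : seq (int * bool)) (A : int * bool -> set R) :
  uniq s -> (forall i, measurable (A i)) ->
  fine (Pr (\bigcap_(i in [set` s]) noise m1 (proj Q) i @^-1` A i)) =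
  \prod_(i <- s) fine (Pr (noise m1 (proj Q) i @^-1` A i)).
Proof.
move=> us mA.
pose part b := [seq p.1 | p <- s & p.2 == b].
have partP b t : (t \in part b) = ((t, b) \in s).
  apply/mapP/idP => [[[t' b']]|ts]; last by exists (t, b); rewrite ?mem_filter ?eqxx.
  by rewrite mem_filter => /andP[/= /eqP -> ts] ->.
have upart b : uniq (part b).
  rewrite map_inj_in_uniq ?filter_uniq// => -[t1 b1] [t2 b2].
  by rewrite !mem_filter /= => /andP[/eqP -> _] /andP[/eqP -> _] ->.
pose E b := \bigcap_(t in [set` part b]) noise m1 (proj Q) (t, b) @^-1` A (t, b).
have -> : \bigcap_(i in [set` s]) noise m1 (proj Q) i @^-1` A i = E true `&` E false.
  apply/seteqP; split => [w h|w [hT hF] [t b] /= ts].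
    by split => t /=; rewrite partP => ts; exact: (h _ ts).
  by case: b ts => ts; [apply: hT|apply: hF]; rewrite /= partP.
have gT : sigma_gen (fun t => m1 t : T -> R) (E true).
  apply: sigma_gen_bigcap => t _.
  exact: (@sigma_gen_preimage _ _ _ _ (fun t => m1 t : T -> R) t).
have gF : sigma_gen (fun ti : int * 'I_d => vcoord (Q ti.1) ti.2) (E false).
  by apply: sigma_gen_bigcap => t _; exact: sigma_gen_proj_all.
have prodE b : \prod_(i <- s | i.2 == b) fine (Pr (noise m1 (proj Q) i @^-1` A i)) =
    \prod_(t <- part b) fine (Pr (noise m1 (proj Q) (t, b) @^-1` A (t, b))).
  by rewrite big_map big_filter; apply: eq_bigr => -[t b'] /= /eqP ->.
have PT : fine (Pr (E true)) =
    \prod_(t <- part true) fine (Pr (noise m1 (proj Q) (t, true) @^-1` A (t, true))).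
  apply: (isn_indep (sre_m X_sre) (upart true)) => t _.
  exact: (@sigma_gen_preimage _ _ _ _ (fun _ : unit => m1 t : T -> R) tt).
have PF : fine (Pr (E false)) =
    \prod_(t <- part false) fine (Pr (noise m1 (proj Q) (t, false) @^-1` A (t, false))).
  by apply: (igv_indep Q_gauss (upart false)) => t _; exact: sigma_gen_proj.
have mnoise p : measurable (noise m1 (proj Q) p @^-1` A p).
  rewrite -[X in measurable X]setTI.
  by rewrite /noise; case: p.2; [exact: mm1|exact: mQ].
have mE b : measurable (E b).
  by rewrite /E bigcap_seq; apply: bigsetI_measurable.
rewrite (sre_indep X_sre gT gF) fineM ?fin_num_measure// PT PF -!prodE.
rewrite [RHS](bigID (fun p : int * bool => p.2 == true))/=; congr (_ * _).
by apply: eq_bigl => -[t []].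
Qed.

Let proj_rec t : {ae Pr, forall w,
  proj X t w = a * m1 t w * proj X (t - 1) w + proj Q t w}.
Proof.
have := sre_eq X_sre t; apply: filterS => w Xw.
rewrite /proj Xw mulmxDr mxE; congr (_ + _).
by rewrite mulmxA -scalemxAr u_eigen scalerA -scalemxAl mxE [m1 t w * a]mulrC.
Qed.

Let proj_stationary s t A : measurable A ->
  Pr (proj X s @^-1` A) = Pr (proj X t @^-1` A).
Proof.
move=> mA.
pose E : set (int -> 'cV[R]_d) := [set x | A (\sum_i u 0 i * x 0 i 0)].
have cE : path_cylinders E.
  apply: (@sigma_lincomb R _ _ _ (u 0) (fun i (x : int -> 'cV[R]_d) => x 0 i 0)) => //.
  by move=> i D mD; apply: sub_sigma_algebra; exists 0, i, D.
have st h : Pr (proj X h @^-1` A) = Pr (proj X 0 @^-1` A).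
  have := X_stationary h cE.
  rewrite /E /= => st; rewrite (funext (projE X h)) (funext (projE X 0)).
  by rewrite -[h in LHS]add0r; exact: st.
by rewrite !st.
Qed.

Let mproj t : measurable_fun setT (proj X t).
Proof. exact: measurable_proj. Qed.

Let contraction : exists2 b : R, 0 < b & \int[gauss 0 1]_z (`|a * z| `^ b) < 1.
Proof.
exists (al / 2); first by rewrite divr_gt0.
by apply: (multiplier_moment_lt1 al_gt0 a_moment); rewrite divr_gt0//= gtr_pMr// invf_lt1// ltr1n.
Qed.

Let proj_law t : forall f : R -> \bar R, (forall v, (0 <= f v)%E) ->
  measurable_fun setT f ->
  (\int[Pr]_w f (proj X t w) = \int[Pr]_w \int[gauss (0 : R) 1]_z
     f (Num.sqrt ((a * proj X t w) ^+ 2 + sg ^+ 2) * z)%R)%E.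
Proof.
move=> f f0 mf.
exact: (law_fixed_point sg_gt0 mm1 mQ mproj noise_indep m1_law Q_law proj_rec
  proj_stationary contraction).
Qed.

Lemma proj_tail t : exists2 c : R, 0 < c &
  x `^ al * tail_abs Pr (proj X t) x @[x --> +oo] --> c.
Proof. exact: (fixed_point_tail sg_gt0 al_gt0 (mproj t) a_moment (@proj_law t)). Qed.

Lemma proj_tail_symmetric t x :
  Pr [set w | x < proj X t w] = Pr [set w | proj X t w < - x].
Proof. exact: (tail_symmetric (mproj t) (@proj_law t)). Qed.

Lemma proj_light_tail t b : 0 < b < al -> light_tail Pr b (proj X t).
Proof.
move=> /andP[b0 bal]; have [b1 b2] := midf_lt bal.
apply: (@light_tail_moment _ _ _ _ _ b ((b + al) / 2)) => //; first by rewrite b0.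
apply: (moment_fin sg_gt0 al_gt0 (mproj t) a_moment (@proj_law t)).
by rewrite b2 (lt_trans b0).
Qed.

End projection.


(** * Regular variation of the components *)

Theorem theorem5p8 (R : realType) (disp : measure_display)
  (T : measurableType disp) (Pr : probability T R)
  (d : nat) (d_ge1 : (1 <= d)%N)
  (C A1 : 'M[R]_d) (C_pd : pd_mx C)
  (X : int -> T -> 'cV[R]_d) (m1 : int -> {RV Pr >-> R})
  (Q : int -> T -> 'cV[R]_d)
  (X_meas : forall t i, measurable_fun setT (vcoord (X t) i))
  (X_bekk : bekk_arch1 Pr C A1 X)
  (X_sre : sre_representation C A1 X m1 Q)
  (X_stationary : strictly_stationary Pr X)
  (P D1 : 'M[R]_d) (P_unit : P \in unitmx) (D1_diag : is_diag_mx D1)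
  (D1E : D1 = P *m A1 *m invmx P)
  (alphaY : 'I_d -> R) (alphaY_gt0 : forall j, 0 < alphaY j)
  (alphaY_moment : forall j t,
     ('E_Pr[(fun w => `|D1 j j * m1 t w| `^ alphaY j)%R] = 1)%E)
  (i : 'I_d) (alpha_i : R) (alpha_iE : is_min (index_set P alphaY i) alpha_i)
  (D1_eq : forall j k, minimal_indices P alphaY i alpha_i j ->
     minimal_indices P alphaY i alpha_i k -> D1 j j = D1 k k) :
  forall t, regularly_varying Pr (vcoord (X t) i) alpha_i.
Proof.
move=> t.
have PA : D1 *m P = P *m A1 by rewrite D1E mulmxKV.
have moment j : (\int[gauss (0 : R) 1]_z (`|D1 j j * z| `^ alphaY j)%:E = 1)%E.
  rewrite -[RHS](alphaY_moment j 0) unlock; apply/esym.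
  apply: (@ge0_integral_law _ _ _ Pr (m1 0 : T -> R) (gauss 0 1) _ _
    (fun z : R => (`|D1 j j * z| `^ alphaY j)%:E)).
  - exact: measurable_funPT.
  - by move=> A mA; rewrite gaussE -(isn_law (sre_m X_sre) 0 mA).
  - by move=> z; rewrite lee_fin powR_ge0.
  - apply/measurable_EFinP.
    exact: (measurableT_comp (measurable_powR _) (measurable_multiplier _)).
have eigen (v : 'rV[R]_d) a : v *m D1 = a *: v -> (v *m P) *m A1 = a *: (v *m P).
  by move=> vD; rewrite -mulmxA -PA mulmxA vD scalemxAl.
have neq0 (v : 'rV[R]_d) : v != 0 -> v *m P != 0.
  by apply: contra => /eqP vP; rewrite -(mulmxK P_unit v) vP mul0mx.
have [[j0 /= Pj0 aj0] minimal] := alpha_iE.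
have alpha_gt0 : 0 < alpha_i by rewrite -aj0.
pose a := D1 j0 j0.
pose G j := (invmx P i j != 0) && (alphaY j == alpha_i).
have GD j : G j -> D1 j j = a by move=> /andP[Pj /eqP aj]; apply: D1_eq.
pose v : 'rV[R]_d := \row_j (if G j then invmx P i j else 0).
have v0 : v != 0.
  by apply/eqP => /rowP /(_ j0); rewrite !mxE /G Pj0 aj0 eqxx; exact/eqP.
have vD : v *m D1 = a *: v.
  apply/rowP => k; rewrite !mxE (bigD1 k)//= big1 ?addr0; last first.
    by move=> j jk; rewrite (is_diag_mxP D1_diag) ?mulr0.
  by rewrite mxE; case: ifPn => [/GD ->|_]; rewrite ?mul0r ?mulr0// mulrC.
have a_moment : (\int[gauss (0 : R) 1]_z (`|a * z| `^ alpha_i)%:E = 1)%E.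
  by rewrite -aj0; exact: moment.
pose e j : 'rV[R]_d := delta_mx 0 j.
have e0 j : e j != 0.
  by apply/eqP => /rowP /(_ j); rewrite !mxE !eqxx => /eqP; rewrite oner_eq0.
have eD j : e j *m D1 = D1 j j *: e j.
  rewrite -rowE; apply/rowP => k; rewrite !mxE eqxx/=.
  by case: eqVneq => [->|jk]; rewrite ?mulr1// mulr0 (is_diag_mxP D1_diag)// eq_sym.
pose W := proj (v *m P) X t.
pose V w := \sum_(j | ~~ G j) invmx P i j * proj (e j *m P) X t w.
have XE : vcoord (X t) i = (fun w => W w + V w).
  apply/funext => w; rewrite /vcoord -[X t w](mulKmx P_unit) mxE.
  rewrite (bigID G)/= /W /V /proj -mulmxA mxE [in RHS](bigID G)/=.
  rewrite [X in _ = _ + X + _]big1 ?addr0; last first.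
    by move=> j /negbTE nG; rewrite mxE nG mul0r.
  congr (_ + _); apply: eq_bigr => j Gj; first by rewrite [v _ _]mxE Gj.
  by rewrite -mulmxA -rowE [row _ _ _ _]mxE.
have mproj u : measurable_fun setT (proj u X t) by exact: measurable_proj.
rewrite XE.
have [c c0 Wc] := proj_tail C_pd X_meas X_sre X_stationary (neq0 _ v0) (eigen _ _ vD)
  alpha_gt0 a_moment t.
apply: (regularly_varying_perturbation alpha_gt0 c0) => //.
- exact: mproj.
- by apply: measurable_sum_cond => j; apply: measurable_funM => //;
    exact: measurable_cst.
- move=> x; exact: (proj_tail_symmetric C_pd X_meas X_sre X_stationary (neq0 _ v0)
    (eigen _ _ vD) alpha_gt0 a_moment).
apply: light_tail_sum => [j|j nG].
  by apply: measurable_funM => //; exact: measurable_cst.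
have [->|Pj] := eqVneq (invmx P i j) 0.
  rewrite (_ : (fun w => _) = cst 0); first exact: light_tail0.
  by apply/funext => w; rewrite mul0r.
apply: light_tailZ.
apply: (proj_light_tail C_pd X_meas X_sre X_stationary (neq0 _ (e0 j))
  (eigen _ _ (eD j)) (alphaY_gt0 j) (moment j)).
rewrite alpha_gt0/= lt_neqAle eq_sym; apply/andP; split.
  by move: nG; rewrite /G Pj.
by apply: minimal; exists j.
Qed.
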